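(* Let $T>0$, let $(W_t)_{0\le t\le T}$ and $(B_t)_{0\le t\le T}$ be two independent standard real Brownian motions, and set $$\bar\beta^T_t = W_t-\frac{t}{T}W_T+\frac{t}{T}B_t,\qquad 0\le t\le T.$$ Then the canonical decomposition of the semimartingale $\bar\beta^T$ in its natural filtration $\mathbb F^{\bar\beta^T}$ is $$\bar\beta^T_t=\int_0^t\sqrt{\frac{T^2+s^2}{T^2}}\,\mathrm d\bar B_s-\int_0^t\frac{\bar\beta^T_s}{T-s}\,\mathrm ds+\int_0^t\int_0^s\frac{\mathfrak a(s,u)}{T-s}\,\mathrm d\bar\beta^T_u\,\mathrm ds,\qquad t<T,$$ where $\bar B$ is an $\mathbb F^{\bar\beta^T}$-Brownian motion and, for $0\le u\le s<T$, $$\mathfrak a(s,u)=\frac{T-s}{T-s+s\tan^{-1}\left(\frac sT\right)}\left(\frac{Tu}{u^2+T^2}+\tan^{-1}\left(\frac uT\right)\right)+\frac{s\tan^{-1}\left(\frac sT\right)}{T-s+s\tan^{-1}\left(\frac sT\right)}.$$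
   Context: The natural filtration $\mathbb F^{\bar\beta^T}$ is the filtration generated by $\bar\beta^T$, completed with the null sets. The inner integral $\int_0^s \mathfrak a(s,u)\,\mathrm d\bar\beta^T_u$ is the stochastic integral, for fixed $s$, of the deterministic smooth function $u\mapsto\mathfrak a(s,u)$ against the semimartingale $\bar\beta^T$. Here $\tan^{-1}$ is the arctangent. The canonical decomposition is the decomposition into a (local) martingale plus a continuous adapted finite variation process, with respect to $\mathbb F^{\bar\beta^T}$. *)

(* Defs.v *)
From HB Require Import structures.
From mathcomp Require Import all_boot all_order all_algebra.
From mathcomp Require Import all_classical all_reals all_analysis.

Set Implicit Arguments.
Unset Strict Implicit.
Unset Printing Implicit Defensive.

Import Order.TTheory GRing.Theory Num.Theory.
Import numFieldNormedType.Exports.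

Local Open Scope classical_set_scope.
Local Open Scope ring_scope.

(** Processes are functions [X : R -> Omega -> R] of time, then of the outcome.
    They matter only on a time set [I] ([0, T] or [0, T[); their values at other
    times are irrelevant. *)

Section Processes.
Context {d : measure_display} {Omega : measurableType d} {R : realType}.
Variable P : probability Omega R.
Implicit Types (X : R -> Omega -> R) (F : R -> set (set Omega)) (I : set R).

Definition sigma_of (f : Omega -> R) : set (set Omega) :=
  preimage_set_system setT f measurable.

Definition raw_natural_filtration X (t : R) : set (set Omega) :=
  <<s \bigcup_(s in `[0, t]%classic) sigma_of (X s) >>.

(** Completion by the measurable null sets. These are all the null sets if [P]
    is complete; otherwise no further set can be added if the filtration is to
    remain inside the sigma-algebra of [Omega]. *)
Definition natural_filtration X (t : R) : set (set Omega) :=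
  <<s (\bigcup_(s in `[0, t]%classic) sigma_of (X s)) `|`
      [set N | measurable N /\ P N = 0%E] >>.

Definition independent (G H : set (set Omega)) :=
  forall A B, G A -> H B -> P (A `&` B) = (P A * P B)%E.

Definition adapted F I X := forall t, I t -> sigma_of (X t) `<=` F t.

Definition continuous_process I X :=
  {ae P, forall w, {within I, continuous (fun t => X t w)}}.

Definition brownian_motion F I X :=
  [/\ forall t, I t -> measurable_fun setT (X t),
      adapted F I X,
      {ae P, forall w, X 0 w = 0},
      forall s t, I s -> I t -> s < t ->
        independent (F s) (sigma_of (X t \- X s)) /\
        forall Y : set R, measurable Y ->
          P ((X t \- X s) @^-1` Y) = normal_prob 0 (Num.sqrt (t - s)) Y
    & continuous_process I X].

Definition standard_brownian_motion I X :=
  brownian_motion (raw_natural_filtration X) I X.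

Definition independent_processes (T : R) (X Y : R -> Omega -> R) :=
  independent (raw_natural_filtration X T) (raw_natural_filtration Y T).

(** The integral over [0, t] of the step function with value [c i] on the i-th
    interval ]p_i, p_(i+1)] of the subdivision [0 :: p] of [0, t]. *)
Definition step_integral X (t : R) (p : seq R) (c : nat -> R) (w : Omega) : R :=
  let x := nth t (0 :: p) in
  \sum_(0 <= i < size p) c i * (X (x i.+1) w - X (x i) w).

Definition step_close (f : R -> R) (t : R) (p : seq R) (c : nat -> R) (e : R) :=
  let x := nth t (0 :: p) in
  forall i u, (i < size p)%N -> x i < u <= x i.+1 -> `|c i - f u| <= e.

(** [Y] is (a version of) the stochastic integral over [0, t] of the
    deterministic continuous function [f] against the semimartingale [X]. The
    integral is the extension of the elementary one by continuity: it is the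
    limit in probability of the integrals of step functions converging to [f]
    uniformly on ]0, t]. Continuity of [f] ensures that such step functions
    exist, so that [Y] is determined almost surely. *)
Definition is_stochastic_integral (f : R -> R) X (t : R) (Y : Omega -> R) :=
  [/\ {within `[0, t], continuous f},
      measurable_fun setT Y
    & forall eps eta : R, 0 < eps -> 0 < eta ->
      exists2 delta : R, 0 < delta &
      forall (p : seq R) (c : nat -> R),
        itv_partition 0 t p -> step_close f t p c delta ->
        (P [set w | (eps < `|step_integral X t p c w - Y w|)%R] <= eta%:E)%E].

(** The equality of integrals over every event of [F s] says that
    [E[M t | F s] = M s]. *)
Definition martingale F I (M : R -> Omega -> R) :=
  [/\ adapted F I M,
      forall t, I t -> P.-integrable setT (EFin \o M t)
    & forall s t, I s -> I t -> s <= t ->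
      forall E, F s E ->
        (\int[P]_(w in E) (M t w)%:E = \int[P]_(w in E) (M s w)%:E)%E].

Definition stopping_time F (T : R) (tau : Omega -> R) :=
  (forall w, 0 <= tau w <= T) /\
  (forall t, 0 <= t < T -> F t [set w | tau w <= t]).

(** On the time set [0, T[, the terminal time [T] plays the role of infinity. *)
Definition local_martingale F (T : R) (M : R -> Omega -> R) :=
  exists tau : nat -> Omega -> R,
  [/\ forall n, stopping_time F T (tau n),
      {ae P, forall w, nondecreasing_seq (fun n => tau n w) /\
                       (fun n => tau n w) @ \oo --> T}
    & forall n, martingale F `[0, T[%classic
                  (fun t w => M (Num.min t (tau n w)) w)].

Definition canonical_decomposition F (T : R) (X M A : R -> Omega -> R) :=
  [/\ {ae P, forall w, M 0 w = 0 /\ A 0 w = 0},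
      local_martingale F T M /\ continuous_process `[0, T[ M,
      adapted F `[0, T[ A /\ continuous_process `[0, T[ A,
      {ae P, forall w, forall t, 0 <= t < T ->
         bounded_variation 0 t (fun s => A s w)}
    & {ae P, forall w, forall t, 0 <= t < T -> X t w = X 0 w + M t w + A t w}].

End Processes.

Section Bridge.
Context {Omega : Type} {R : realType}.

Definition bar_beta (T : R) (W B : R -> Omega -> R) (t : R) (w : Omega) : R :=
  W t w - t / T * W T w + t / T * B t w.

Definition kernel_a (T s u : R) : R :=
  (T - s) / (T - s + s * atan (s / T)) *
    (T * u / (u ^+ 2 + T ^+ 2) + atan (u / T)) +
  s * atan (s / T) / (T - s + s * atan (s / T)).

End Bridge.

(* Main.v *)
(* Off a null set, beta is a continuous Gaussian process b with covariance
   cov(s, t) = s - s t / T + s^2 t / T^2 for s <= t. All the processes involved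
   lie in the closed Gaussian space H generated by W and B, where independence
   reduces to orthogonality: characteristic functions determine laws, and two
   orthogonal subspaces of H are independent.

   With g(u) = 2 T^3 / (u^2 + T^2)^2, G the primitive of g given by
   T u / (u^2 + T^2) + atan(u / T), and D(s) = T - s + s atan(s / T), set
     L_s = D(s)^-1 ((1 - G(s)) b_s + int_0^s g b),   M_t = b_t + int_0^t L.
   A computation with antiderivatives gives E[b_u L_s] = u (T - u) / T^2 for
   u <= s, so that M_t - M_s is orthogonal to b_u for u <= s <= t: M is a
   martingale. As d<M>_s = f(s)^2 ds with f(s)^2 = 1 + s^2 / T^2, the process
   Bbar = int (1 / f) dM, defined by integration by parts, has independent
   increments of variance t - s, and M = int f dBbar. Also by parts,
   b_s - (T - s) L_s = int_0^s a(s, u) db_u, and hence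
   L_s = b_s / (T - s) - int_0^s a(s, u) / (T - s) db_u.

   Both integrands are smooth and nondecreasing. If step functions lie within
   delta of f, the error on a step [p, q] is at most 3 delta times the largest
   |X_r - X_p| in L^2; these errors are orthogonal for a martingale and are
   simply added for the drift. *)
Require Import Defs.
From HB Require Import structures.
From mathcomp Require Import all_boot all_order all_algebra.
From mathcomp Require Import all_classical all_reals all_analysis.
From mathcomp Require Import measurable_realfun.
From mathcomp Require Import ring lra.

Set Implicit Arguments.
Unset Strict Implicit.
Unset Printing Implicit Defensive.

Import Order.TTheory GRing.Theory Num.Theory.
Import numFieldNormedType.Exports.

Local Open Scope classical_set_scope.
Local Open Scope ring_scope.

(** * Primitives and Riemann sums *)

(** The form of L is forced. Orthogonality of M_t - M_s to the past asks that E[b_u L_s] = - d/ds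
    cov(u, s) for u <= s. Trying L_s = alpha b_s + int_0^s k(u) b_u du and differentiating three
    times in u leaves (u^2 + T^2) k' + 4 u k = 0, so k is a multiple of (u^2 + T^2)^-2; the multiple
    and alpha depend on s and are fixed by the lower-order conditions, which produce D(s). D stays
    positive up to T, so L is regular on the closed interval, although the two terms of its final
    expression carry the factor 1 / (T - s). All estimates are therefore made on L, and the singular
    form appears only at the end. No stochastic calculus enters. Integrals of smooth deterministic
    functions are given by parts, double integrals by antiderivatives, and the bracket of M by the
    uniform estimate E[(Bbar_t - Bbar_s)^2] = t - s + o(t - s): as variances of orthogonal
    increments add up, summing it over finer and finer subdivisions leaves no error. In a Gaussian
    space, orthogonal increments of the right variance already make Bbar a Brownian motion. *)

Section Calculus.
Context {R : realType}.
Notation mu := (@lebesgue_measure R).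
Implicit Types (f g : R -> R) (a b t : R).

(** Compactness in its near-covering form: a radius that works near each point of the segment yields
    a common one. Only [x] is confined to the segment. *)
Lemma uniform_continuous_segment f a b : continuous f ->
  forall e : R, 0 < e -> exists2 d : R, 0 < d &
    forall x y, a <= x <= b -> `|x - y| < d -> `|f x - f y| < e.
Proof.
move=> cf e e0.
have /compact_near_coveringP K := @segment_compact R a b.
have := K R (0^'+) (fun d x => forall y, `|x - y| < d -> `|f x - f y| < e).
have H : (forall x, `[a, b]%classic x ->
    \forall x' \near x & d \near 0^'+, forall y, `|x' - y| < d -> `|f x' - f y| < e).
  move=> x _.
  have /cvgrPdist_lt/(_ (e / 2)) := cf x.
  rewrite divr_gt0// => /(_ isT)[r /= r0 rP].
  exists (ball x (r / 2), [set d | d < r / 2]) => /=.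
    split; first by apply: nbhsx_ballx; rewrite divr_gt0.
    by apply: nbhs_right_lt; rewrite divr_gt0.
  move=> [x' d] /= [xx' dr] y x'y.
  have h1 : `|f x - f x'| < e / 2.
    by apply: rP => /=; apply: lt_trans xx' _; rewrite ltr_pdivrMr// ltr_pMr// ltr1n.
  have h2 : `|f x - f y| < e / 2.
    apply: rP => /=; rewrite [ltRHS](splitr r).
    rewrite -(subrKA x') (le_lt_trans (ler_normD _ _))//.
    by rewrite ltrD//; exact: lt_trans dr.
  rewrite (splitr e) -(subrKA (f x)) (le_lt_trans (ler_normD _ _))//.
  by rewrite ltrD// distrC.
move=> /(_ _ H) /= [d /= d0 dP].
exists (d / 2); first by rewrite divr_gt0.
move=> x y xab; apply: (dP (d / 2)) => //=.
- rewrite sub0r normrN gtr0_norm ?divr_gt0// ltr_pdivrMr// ltr_pMr// ltr1n//.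
- by rewrite divr_gt0.
Qed.

Lemma bounded_segment f a b : continuous f ->
  exists2 M, 0 <= M & forall x, a <= x <= b -> `|f x| <= M.
Proof.
move=> cf.
have cfab : {within `[a, b], continuous f} by exact: continuous_subspaceT.
have /compact_bounded[M [_ MP]] :=
  continuous_compact cfab (@segment_compact R a b).
exists (`|M| + 1); first by rewrite addr_ge0.
move=> x xab; apply: (MP (`|M| + 1)); first by rewrite ltr_pwDr// ler_norm.
by exists x => //=; rewrite in_itv.
Qed.

Lemma continuous_integrable_segment f a b : continuous f ->
  mu.-integrable `[a, b] (EFin \o f).
Proof.
move=> cf; apply: continuous_compact_integrable; first exact: segment_compact.
exact: continuous_subspaceT.
Qed.

Lemma is_derive_continuous f x l : is_derive x (1 : R) f l ->
  {for x, continuous f}.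
Proof. by case=> df _; apply: differentiable_continuous; apply/derivable1_diffP. Qed.

(** For [t <= 0] the value is 0. The primitive of a continuous function is thus continuous on the
    whole line, but its derivative is known to be [f t] only for [0 < t]. *)
Definition primitive f t : R := \int[mu]_(x in `[0, t]) f x.

Lemma primitive_le0 f t : t <= 0 -> primitive f t = 0.
Proof.
rewrite le_eqVlt => /predU1P[->|t0].
  by rewrite /primitive set_itv1 Rintegral_set1.
by rewrite /primitive set_itv_ge ?Rintegral_set0// bnd_simp -ltNge.
Qed.

Lemma primitive0 f : primitive f 0 = 0.
Proof. exact: primitive_le0. Qed.

Lemma is_derive_primitive f t : continuous f -> 0 < t ->
  is_derive t (1 : R) (primitive f) (f t).
Proof.
move=> cf t0.
have [] := @continuous_FTC1_closed R f 0 t (t + 1) _ _ t0 (cf t).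
- by rewrite ltrDl.
- exact: continuous_integrable_segment.
by move=> d e; apply: DeriveDef => //; rewrite -derive1E.
Qed.

Lemma continuous_primitive f : continuous f -> continuous (primitive f).
Proof.
move=> cf t.
have [t0|t0|t0] := ltgtP t 0.
- have /near_eq_cvg/cvg_trans : \near t, cst 0 t = primitive f t.
    near=> s; rewrite primitive_le0//; near: s.
    by near do apply: ltW; exact: lt_nbhsl.
  by apply; rewrite primitive_le0 ?ltW//; exact: cvg_cst.
- exact: is_derive_continuous (is_derive_primitive cf t0).
- rewrite t0 /continuous_at primitive0.
  have [M M0 Mf] := bounded_segment 0 1 cf.
  apply/cvgrPdist_le => /= e e0; near=> s.
  rewrite sub0r normrN.
  have [s0|s0] := leP s 0; first by rewrite primitive_le0// normr0 ltW.
  have s1 : s <= 1 by apply: ltW; near: s; exact: lt_nbhsl.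
  apply: (@le_trans _ _ (M * s)).
    apply: le_trans (le_normr_Rintegral _ _) _ => //.
      exact: continuous_integrable_segment.
    apply: (@le_trans _ _ (\int[mu]_(x in `[0, s]) M)).
      apply: le_Rintegral => //.
      - apply: continuous_integrable_segment => x.
        apply: continuous_comp; first exact: cf.
        exact: norm_continuous.
      - by apply: continuous_integrable_segment => x; exact: cvg_cst.
      - move=> x /=; rewrite in_itv/= => /andP[x0 xs].
        by apply: Mf; rewrite x0 (le_trans xs).
    rewrite Rintegral_cst//= lebesgue_measure_itv/= lte_fin s0/=.
    by rewrite subr0.
  apply: (@le_trans _ _ (M * (e / (M + 1)))).
    rewrite ler_wpM2l//; apply: ltW; near: s; apply: lt_nbhsl.
    by rewrite divr_gt0// ltr_pwDr.
  rewrite mulrA ler_pdivrMr ?ltr_pwDr// mulrC ler_wpM2l ?(ltW e0)//.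
  by rewrite lerDl.
Unshelve. all: by end_near. Qed.

Lemma primitive_MVT f a b : continuous f -> 0 <= a -> a < b ->
  exists2 c, a < c < b & primitive f b - primitive f a = f c * (b - a).
Proof.
move=> cf a0 ab.
have [||c] := @MVT R (primitive f) f a b ab.
- move=> x; rewrite in_itv/= => /andP[ax _].
  exact: is_derive_primitive (le_lt_trans a0 ax).
- by apply: continuous_subspaceT; exact: continuous_primitive.
by rewrite in_itv/= => acb ->; exists c.
Qed.

Lemma derive0_constant (F : R -> R) a b : a <= b -> continuous F ->
  (forall x, a < x < b -> is_derive x (1 : R) F 0) -> F b = F a.
Proof.
rewrite le_eqVlt => /predU1P[->//|ab] cF dF.
have dF' x : x \in `]a, b[ -> is_derive x (1 : R) F (cst 0 x).
  by rewrite in_itv/=; exact: dF.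
have [|c _] := @MVT R F (cst 0) a b ab dF'; first exact: continuous_subspaceT.
by rewrite mul0r => /eqP; rewrite subr_eq0 => /eqP.
Qed.

Lemma primitive_unique (F : R -> R) f t : 0 <= t -> continuous F ->
  continuous f -> (forall x, 0 < x < t -> is_derive x (1 : R) F (f x)) ->
  primitive f t = F t - F 0.
Proof.
move=> t0 cF cf dF.
suff: (F \- primitive f) t = (F \- primitive f) 0.
  by rewrite /= primitive0 subr0 => <-; rewrite subKr.
apply: derive0_constant => //.
- by move=> x; apply: continuousB; [exact: cF|exact: continuous_primitive].
- move=> x xt; rewrite -(subrr (f x)); apply: is_deriveB; first exact: dF.
  by apply: is_derive_primitive => //; case/andP: xt.
Qed.

Definition riemann_sum f a b (n : nat) : R :=
  \sum_(0 <= k < n) (b - a) / n%:R * f (a + k%:R * ((b - a) / n%:R)).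

Lemma primitive_step f t e d : continuous f -> 0 < d ->
  (forall x y, 0 <= x <= t -> `|x - y| < d -> `|f x - f y| < e) ->
  forall a b, 0 <= a -> a <= b -> b <= t -> b - a < d ->
  `|primitive f b - primitive f a - (b - a) * f a| <= e * (b - a).
Proof.
move=> cf d0 fd a b a0; rewrite le_eqVlt => /predU1P[<-|ab] bt bad.
  by rewrite !subrr mul0r subrr mulr0 normr0.
have [c /andP[ac cb] ->] := primitive_MVT cf a0 ab.
rewrite mulrC -mulrBr normrM gtr0_norm ?subr_gt0// mulrC.
rewrite ler_wpM2r ?subr_ge0 ?(ltW ab)// distrC ltW//.
apply: fd; first by rewrite a0 (le_trans (ltW ab)).
rewrite distrC gtr0_norm ?subr_gt0//; apply: le_lt_trans bad.
by rewrite lerB// ltW.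
Qed.

Lemma riemann_sum_cvg f a b : continuous f -> 0 <= a -> a <= b ->
  riemann_sum f a b n @[n --> \oo] --> primitive f b - primitive f a.
Proof.
move=> cf a0 ab; apply/cvgrPdist_le => /= e e0.
(* The added 1 covers the case [a = b]; the same device recurs in the later tolerances of the form
   [e / (K + 1)]. *)
have ba1 : 0 < b - a + 1 by rewrite ltr_wpDl// subr_ge0.
have [d d0 fd] := uniform_continuous_segment 0 b cf (divr_gt0 e0 ba1).
near=> n.
have n0 : (0 < n)%N by near: n; exists 1%N.
have n0R : 0 < n%:R :> R by rewrite ltr0n.
pose h := (b - a) / n%:R.
have h0 : 0 <= h by rewrite divr_ge0 ?subr_ge0// ltW.
have hd : h < d.
  rewrite /h ltr_pdivrMr// -ltr_pdivrMl// mulrC.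
  by near: n; exact: nbhs_infty_gtr.
have nh : n%:R * h = b - a by rewrite /h mulrC divfK// gt_eqF.
pose x k := a + k%:R * h.
have xS k : x k.+1 - x k = h by rewrite /x -natr1; ring.
have -> : primitive f b - primitive f a =
    \sum_(0 <= k < n) (primitive f (x k.+1) - primitive f (x k)).
  rewrite telescope_sumr// /x nh mul0r addr0; congr (primitive f _ - _).
  by rewrite addrC subrK.
rewrite /riemann_sum -sumrB.
apply: (@le_trans _ _ (\sum_(0 <= k < n) e / (b - a + 1) * h)).
  apply: le_trans (ler_norm_sum _ _ _) _.
  rewrite big_nat_cond [leRHS]big_nat_cond; apply: ler_sum => k /andP[/= kn _].
  have xk0 : 0 <= x k by rewrite addr_ge0// mulr_ge0.
  have xkS : x k <= x k.+1 by rewrite -subr_ge0 xS.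
  have xb : x k.+1 <= b.
    rewrite /x -lerBrDl -nh ler_wpM2r// ler_nat//.
  have := primitive_step cf d0 fd xk0 xkS xb.
  by rewrite xS; exact.
rewrite sumr_const_nat subn0 -mulr_natl mulrCA nh.
rewrite mulrAC ler_pdivrMr// ler_wpM2l ?(ltW e0)// lerDl//.
Unshelve. all: by end_near. Qed.

End Calculus.

(** * Square-integrable random variables *)

Lemma le_of_eq {disp : Order.disp_t} {T : porderType disp} (x y : T) :
  x = y -> (x <= y)%O.
Proof. by move->. Qed.

Lemma Rintegral_dominated_cvg {d : measure_display} {T : measurableType d}
    {R : realType} (mu : {measure set T -> \bar R})
    (f_ : nat -> T -> R) (f g : T -> R) :
  (forall n, measurable_fun setT (f_ n)) ->
  (forall x, f_ n x @[n --> \oo] --> f x) ->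
  mu.-integrable setT (EFin \o g) ->
  (forall n x, `|f_ n x| <= g x) ->
  \int[mu]_x f_ n x @[n --> \oo] --> \int[mu]_x f x.
Proof.
move=> mf ff ig fg.
have mf' : measurable_fun setT f by exact: measurable_fun_cvg mf (fun x _ => ff x).
have fi : mu.-integrable setT (EFin \o f).
  apply: le_integrable ig => //; first exact/measurable_EFinP.
  move=> x _; rewrite /= lee_fin; apply: le_trans (ler_norm _).
  have /cvg_norm cn : f_ n x @[n --> \oo] --> f x by exact: ff.
  by rewrite -(cvg_lim _ cn)//; apply: limr_le; [apply/cvg_ex; eexists; exact: cn|exact: nearW].
apply: fine_cvg; rewrite fineK; last exact: integrable_fin_num fi.
apply: (@dominated_cvg _ _ _ mu setT measurableT
  (fun n => EFin \o f_ n) (EFin \o f) (EFin \o g)) => //.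
- by move=> n; exact/measurable_EFinP.
- by move=> x _; apply: cvg_EFin; [exact: nearW|exact: ff].
- by move=> n x _; rewrite /= lee_fin.
Qed.

Lemma bounded_integrable {d : measure_display} {T : measurableType d}
    {R : realType} (mu : {finite_measure set T -> \bar R}) (f : T -> R) (M : R) :
  measurable_fun setT f -> (forall x, `|f x| <= M) ->
  mu.-integrable setT (EFin \o f).
Proof.
move=> mf fM; apply: le_integrable (@finite_measure_integrable_cst _ _ _ mu setT M measurableT) => //.
  exact/measurable_EFinP.
by move=> x _; rewrite /= lee_fin (le_trans (fM x))// ler_norm.
Qed.

Section SquareIntegrable.
Context {d : measure_display} {Omega : measurableType d} {R : realType}.
Variable P : probability Omega R.
Implicit Types (X Y Z : Omega -> R).

(** Random variables are functions, not classes modulo null sets, so that [norm2] below is only a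
    seminorm. *)
Definition square_integrable X :=
  measurable_fun setT X /\ P.-integrable setT (EFin \o (fun w => X w ^+ 2)).
Notation L2 := square_integrable.

Lemma square_integrable_prod X Y : L2 X -> L2 Y ->
  P.-integrable setT (EFin \o (fun w => X w * Y w)).
Proof.
move=> [mX iX] [mY iY].
have iXY := integrableD measurableT iX iY.
apply: le_integrable iXY => //.
  by apply/measurable_EFinP; exact: measurable_funM.
move=> w _ /=; rewrite lee_fin normrM [leRHS]ger0_norm; last first.
  by rewrite addr_ge0// sqr_ge0.
rewrite -[X w ^+ 2]real_normK ?num_real// -[Y w ^+ 2]real_normK ?num_real//.
set x := `|X w|; set y := `|Y w|.
have x0 : 0 <= x := normr_ge0 _.
have y0 : 0 <= y := normr_ge0 _.
by have := sqr_ge0 (x - y); nra.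
Qed.

Lemma square_integrable_cst c : L2 (cst c).
Proof.
split; first exact: measurable_cst.
exact: (@finite_measure_integrable_cst _ _ _ P setT (c ^+ 2) measurableT).
Qed.

Lemma square_integrable_integrable X : L2 X -> P.-integrable setT (EFin \o X).
Proof.
move=> LX; have := square_integrable_prod LX (square_integrable_cst 1).
by apply: eq_integrable => // w _ /=; rewrite mulr1.
Qed.

Lemma square_integrableD X Y : L2 X -> L2 Y -> L2 (X + Y).
Proof.
move=> LX LY; have [mX iX] := LX; have [mY iY] := LY.
split; first exact: measurable_funD.
have iXY := integrableZl measurableT 2 (square_integrable_prod LX LY).
have := integrableD measurableT (integrableD measurableT iX iY) iXY.
apply: eq_integrable => // w _ /=.
rewrite -[(X + Y) w]/(X w + Y w) -EFinM -!EFinD; congr EFin; ring.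
Qed.

Lemma square_integrableZ c X : L2 X -> L2 (cst c * X).
Proof.
move=> [mX iX]; split; first exact: measurable_funM.
have := integrableZl measurableT (c ^+ 2) iX.
by apply: eq_integrable => // w _ /=; rewrite -EFinM -exprMn.
Qed.

Lemma square_integrableN X : L2 X -> L2 (- X).
Proof.
move=> LX; have -> : - X = cst (-1) * X by rewrite funeqE => w; rewrite !fctE mulN1r.
exact: square_integrableZ.
Qed.

Lemma square_integrableB X Y : L2 X -> L2 Y -> L2 (X - Y).
Proof. by move=> LX LY; apply: square_integrableD => //; exact: square_integrableN. Qed.

Lemma square_integrable_sum (I : Type) (r : seq I) (Q : pred I) (F : I -> Omega -> R) :
  (forall i, Q i -> L2 (F i)) -> L2 (\sum_(i <- r | Q i) F i).
Proof.
move=> LF; elim/big_rec : _ => [|i X Qi LX]; first exact: square_integrable_cst.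
by apply: square_integrableD => //; exact: LF.
Qed.

Definition iprod X Y : R := \int[P]_w (X w * Y w).

Lemma iprodC X Y : iprod X Y = iprod Y X.
Proof. by apply: eq_Rintegral => w _; rewrite mulrC. Qed.

Lemma iprodDl X Y Z : L2 X -> L2 Y -> L2 Z ->
  iprod (X + Y) Z = iprod X Z + iprod Y Z.
Proof.
move=> LX LY LZ; rewrite /iprod -RintegralD//; try exact: square_integrable_prod.
by apply: eq_Rintegral => w _; rewrite -mulrDl.
Qed.

Lemma iprodZl c X Y : L2 X -> L2 Y -> iprod (cst c * X) Y = c * iprod X Y.
Proof.
move=> LX LY; rewrite /iprod -RintegralZl//; last exact: square_integrable_prod.
by apply: eq_Rintegral => w _; rewrite mulrA.
Qed.

Lemma iprodBl X Y Z : L2 X -> L2 Y -> L2 Z ->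
  iprod (X - Y) Z = iprod X Z - iprod Y Z.
Proof.
move=> LX LY LZ; rewrite /iprod -RintegralB//; try exact: square_integrable_prod.
by apply: eq_Rintegral => w _; rewrite -mulrBl.
Qed.

Lemma iprodDr X Y Z : L2 X -> L2 Y -> L2 Z ->
  iprod Z (X + Y) = iprod Z X + iprod Z Y.
Proof. by move=> *; rewrite iprodC iprodDl// !(iprodC Z). Qed.

Lemma iprodBr X Y Z : L2 X -> L2 Y -> L2 Z ->
  iprod Z (X - Y) = iprod Z X - iprod Z Y.
Proof. by move=> *; rewrite iprodC iprodBl// !(iprodC Z). Qed.

Lemma iprodZr c X Y : L2 X -> L2 Y -> iprod Y (cst c * X) = c * iprod Y X.
Proof. by move=> *; rewrite iprodC iprodZl// iprodC. Qed.

Lemma iprod0l Y : iprod 0 Y = 0.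
Proof.
rewrite /iprod (@eq_Rintegral _ _ _ _ _ (cst 0)); last by move=> w _; rewrite mul0r.
by rewrite Rintegral_cst// mul0r.
Qed.

Lemma iprod_suml (I : Type) (r : seq I) (Q : pred I) (F : I -> Omega -> R) Y :
  (forall i, Q i -> L2 (F i)) -> L2 Y ->
  iprod (\sum_(i <- r | Q i) F i) Y = \sum_(i <- r | Q i) iprod (F i) Y.
Proof.
move=> LF LY; pose K X a := L2 X /\ iprod X Y = a.
suff: K (\sum_(i <- r | Q i) F i) (\sum_(i <- r | Q i) iprod (F i) Y) by case.
elim/big_rec2 : _ => [|i a X Qi [LX <-]].
  by split; [exact: square_integrable_cst|exact: iprod0l].
by split; [exact: square_integrableD (LF _ Qi) LX|rewrite iprodDl//; exact: LF].
Qed.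

Lemma iprod_ge0 X : 0 <= iprod X X.
Proof. by apply: Rintegral_ge0 => w _; rewrite -expr2 sqr_ge0. Qed.

Lemma cauchy_schwarz X Y : L2 X -> L2 Y ->
  iprod X Y ^+ 2 <= iprod X X * iprod Y Y.
Proof.
move=> LX LY.
have pol r : 0 <= iprod X X - 2 * r * iprod X Y + r ^+ 2 * iprod Y Y.
  have := iprod_ge0 (X - cst r * Y).
  have LrY := square_integrableZ r LY.
  rewrite iprodBl//; last exact: square_integrableB.
  rewrite !iprodBr// !iprodZl// !iprodZr// (iprodC Y X).
  by move=> /le_trans; apply; apply/le_of_eq; ring.
have [Y0|Y0] := eqVneq (iprod Y Y) 0.
  have [->|XY0] := eqVneq (iprod X Y) 0; first by rewrite expr0n/= Y0 mulr0.
  (* When [iprod Y Y = 0] the polynomial is affine in [r]; this value of [r] makes it equal to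
     -1. *)
  have := pol ((iprod X X + 1) / (2 * iprod X Y)); rewrite Y0.
  have -> : 2 * ((iprod X X + 1) / (2 * iprod X Y)) * iprod X Y = iprod X X + 1.
    by field.
  by move=> H; exfalso; lra.
have YY : 0 < iprod Y Y by rewrite lt_def Y0 iprod_ge0.
have := pol (iprod X Y / iprod Y Y).
have -> : iprod X X - 2 * (iprod X Y / iprod Y Y) * iprod X Y +
   (iprod X Y / iprod Y Y) ^+ 2 * iprod Y Y =
   iprod X X - iprod X Y ^+ 2 / iprod Y Y by field.
by rewrite subr_ge0 ler_pdivrMr.
Qed.

Definition norm2 X : R := Num.sqrt (iprod X X).

Lemma norm2_ge0 X : 0 <= norm2 X. Proof. exact: sqrtr_ge0. Qed.

Lemma norm2_sqr X : norm2 X ^+ 2 = iprod X X.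
Proof. by rewrite sqr_sqrtr// iprod_ge0. Qed.

Lemma norm2_le X r : 0 <= r -> (norm2 X <= r) = (iprod X X <= r ^+ 2).
Proof. by move=> r0; rewrite -norm2_sqr ler_sqr// nnegrE norm2_ge0. Qed.

Lemma norm2_cauchy_schwarz X Y : L2 X -> L2 Y ->
  `|iprod X Y| <= norm2 X * norm2 Y.
Proof.
move=> LX LY; rewrite -ler_sqr ?nnegrE ?mulr_ge0 ?norm2_ge0//.
by rewrite real_normK ?num_real// exprMn !norm2_sqr cauchy_schwarz.
Qed.

Lemma norm2D X Y : L2 X -> L2 Y -> norm2 (X + Y) <= norm2 X + norm2 Y.
Proof.
move=> LX LY; have LXY := square_integrableD LX LY.
rewrite norm2_le ?addr_ge0 ?norm2_ge0//.
rewrite iprodDl// !iprodDr// (iprodC Y X) sqrrD !norm2_sqr.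
have := le_trans (ler_norm _) (norm2_cauchy_schwarz LX LY).
set a := iprod X Y; set b := norm2 X * norm2 Y => ab.
lra.
Qed.

Lemma norm2Z c X : L2 X -> norm2 (cst c * X) = `|c| * norm2 X.
Proof.
move=> LX; have LcX := square_integrableZ c LX.
by rewrite /norm2 iprodZl// iprodZr// mulrA -expr2 sqrtrM ?sqr_ge0// sqrtr_sqr.
Qed.

Lemma norm2N X : L2 X -> norm2 (- X) = norm2 X.
Proof.
move=> LX; have -> : - X = cst (-1) * X by rewrite funeqE => w; rewrite !fctE mulN1r.
by rewrite norm2Z// normrN1 mul1r.
Qed.

Lemma norm2B X Y : L2 X -> L2 Y -> norm2 (X - Y) <= norm2 X + norm2 Y.
Proof.
by move=> LX LY; rewrite -(norm2N LY) norm2D//; exact: square_integrableN.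
Qed.

Lemma norm2_distC X Y : L2 X -> L2 Y -> norm2 (X - Y) = norm2 (Y - X).
Proof. by move=> LX LY; rewrite -opprB norm2N//; exact: square_integrableB. Qed.

Lemma norm20 : norm2 0 = 0.
Proof. by rewrite /norm2 iprod0l sqrtr0. Qed.

Lemma norm2_sum (I : Type) (r : seq I) (Q : pred I) (F : I -> Omega -> R) :
  (forall i, Q i -> L2 (F i)) ->
  norm2 (\sum_(i <- r | Q i) F i) <= \sum_(i <- r | Q i) norm2 (F i).
Proof.
move=> LF; pose K X a := L2 X /\ norm2 X <= a.
suff: K (\sum_(i <- r | Q i) F i) (\sum_(i <- r | Q i) norm2 (F i)) by case.
elim/big_rec2 : _ => [|i a X Qi [LX Xa]].
  by split; [exact: square_integrable_cst|rewrite norm20].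
split; first exact: square_integrableD (LF _ Qi) LX.
by rewrite (le_trans (norm2D (LF _ Qi) LX))// lerD2l.
Qed.

Lemma square_integrableE X : measurable_fun setT X ->
  L2 X <-> (\int[P]_w (X w ^+ 2)%:E < +oo)%E.
Proof.
move=> mX; split=> [[_ /integrableP[_]]|iX].
  apply: le_lt_trans; apply/le_of_eq/eq_integral => w _ /=.
  by rewrite ger0_norm ?sqr_ge0.
- split => //; apply/integrableP; split.
    by apply/measurable_EFinP; exact: measurable_funX.
  apply: le_lt_trans iX; apply/le_of_eq/eq_integral => w _ /=.
  by rewrite ger0_norm ?sqr_ge0.
Qed.

Lemma iprodE X : L2 X -> ((iprod X X)%:E = \int[P]_w (X w ^+ 2)%:E)%E.
Proof.
move=> [mX iX]; rewrite /iprod /Rintegral.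
under eq_integral do rewrite -expr2.
by rewrite fineK//; exact: integrable_fin_num iX.
Qed.

(** Fatou's lemma applied to the squares. It turns pathwise limits, such as those of Riemann sums,
    into bounds in L2 without any dominating variable. *)
Lemma norm2_fatou (X_ : nat -> Omega -> R) X r : 0 <= r ->
  (forall n, L2 (X_ n)) -> (forall n, norm2 (X_ n) <= r) ->
  (forall w, X_ n w @[n --> \oo] --> X w) -> L2 X /\ norm2 X <= r.
Proof.
move=> r0 LX Xr Xcvg.
have mX : measurable_fun setT X.
  apply: (@measurable_fun_cvg _ _ _ setT X_) => // n; exact: (LX n).1.
have := @fatou _ _ _ P _ measurableT (fun n w => (X_ n w ^+ 2)%:E).
have -> : (fun w => limn_einf (fun n => (X_ n w ^+ 2)%:E)) =
          (fun w => (X w ^+ 2)%:E).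
  rewrite funeqE => w.
  have H : (X_ n w ^+ 2)%:E @[n --> \oo] --> (X w ^+ 2)%:E.
    apply: cvg_EFin; first exact: nearW.
    by apply: (cvg_comp _ (fun x : R => x ^+ 2) (Xcvg w)); exact: sqr_continuous.
  by rewrite is_cvg_limn_einfE ?(cvg_lim _ H)//; apply/cvg_ex; exists (X w ^+ 2)%:E.
have mX2 n : measurable_fun setT (fun w => (X_ n w ^+ 2)%:E).
  by apply/measurable_EFinP/measurable_funX; exact: (LX n).1.
move=> /(_ mX2) F.
have iX : (\int[P]_w (X w ^+ 2)%:E <= (r ^+ 2)%:E)%E.
  apply: le_trans (F _) _; first by move=> n w _; rewrite lee_fin sqr_ge0.
  rewrite limn_einf_lim; apply: lime_le; first exact: is_cvg_einfs.
  apply: nearW => n; apply: (@le_trans _ _ (\int[P]_w (X_ n w ^+ 2)%:E)%E).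
    by apply: ereal_inf_lbound; exists n => /=.
  by rewrite -iprodE// lee_fin -norm2_le.
have LX' : L2 X by apply/square_integrableE => //; exact: le_lt_trans iX (ltry _).
by split => //; rewrite norm2_le// -lee_fin iprodE.
Qed.

End SquareIntegrable.

(** * Characteristic functions determine laws *)

Section NormalCharacteristicFunction.
Context {R : realType}.
Notation mu := (@lebesgue_measure R).
Variable s : R.
Hypothesis s0 : 0 < s.
Let pdf := normal_pdf 0 s : R -> R.

Lemma integral_normal_prob (m : R) (f : R -> R) : measurable_fun setT f ->
  (normal_prob m s).-integrable setT (EFin \o f) ->
  \int[normal_prob m s]_x f x = \int[mu]_x (f x * normal_pdf m s x).
Proof.
move=> mf fi; rewrite /Rintegral; congr fine.
have dom := normal_prob_dominates m s.
rewrite -(Radon_Nikodym_change_of_variables dom)//=.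
apply: ae_eq_integral => //.
- by apply: emeasurable_funM => //; exact/measurable_EFinP.
- by apply/measurable_EFinP; apply: measurable_funM => //; exact: measurable_normal_pdf.
under [X in ae_eq _ _ _ X]eq_fun do rewrite EFinM.
apply: ae_eqe_mul2l => /=.
rewrite Radon_NikodymE/=; case: cid => /= h [h1 h2 h3].
apply: integral_ae_eq => //=.
- by apply/measurable_EFinP; exact: measurable_normal_pdf.
- by move=> E _ mE; rewrite -h3.
Qed.

(** Doubling the deviation changes the exponent by [3 / 8 * (x / s) ^+ 2], which pays for the factor
    [|x|] because y <= 1 + 3/8 y^2 <= exp(3/8 y^2). This single bound serves for the first moment,
    for the decay of the density and for the smoothing error. *)
Lemma normal_pdf_dominated x : `|x| * pdf x <= 2 * s * normal_pdf 0 (2 * s) x.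
Proof.
have s20 : 0 < 2 * s by rewrite mulr_gt0.
rewrite /pdf !normal_pdfE ?gt_eqF// /normal_peak /normal_fun !subr0.
have -> : (2 * s) ^+ 2 * pi *+ 2 = 2 ^+ 2 * (s ^+ 2 * pi *+ 2) :> R.
  by rewrite exprMn -mulrA mulrnAr.
rewrite sqrtrM ?sqr_ge0// sqrtr_sqr (@ger0_norm _ 2)// invfM.
set c := (Num.sqrt (s ^+ 2 * pi *+ 2))^-1.
have c0 : 0 <= c by rewrite invr_ge0 sqrtr_ge0.
have -> : 2 * s * (2^-1 * c * expR (- x ^+ 2 / ((2 * s) ^+ 2 *+ 2))) =
  c * (s * expR (- x ^+ 2 / ((2 * s) ^+ 2 *+ 2))) by field.
rewrite mulrCA ler_wpM2l//.
have -> : - x ^+ 2 / (s ^+ 2 *+ 2) =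
   - x ^+ 2 / ((2 * s) ^+ 2 *+ 2) - 3 / 8 * (x / s) ^+ 2.
  by field; rewrite gt_eqF.
rewrite expRD mulrCA mulrC ler_wpM2r ?expR_ge0//.
rewrite expRN ler_pdivrMr ?expR_gt0//.
apply: (@le_trans _ _ (s * (1 + 3 / 8 * (x / s) ^+ 2))).
  rewrite -[_ ^+ 2]real_normK ?num_real// normrM (@gtr0_norm _ s^-1) ?invr_gt0//.
  have {1}-> : `|x| = s * (`|x| / s) by field; rewrite gt_eqF.
  rewrite ler_wpM2l ?(ltW s0)//.
  by set y := `|x| / s; have := sqr_ge0 (y - 4 / 3); nra.
by rewrite ler_wpM2l ?(ltW s0)// expR_ge1Dx.
Qed.

Lemma normal_pdf_dominated_mean m x :
  `|x - m| * normal_pdf m s x <= 2 * s * normal_pdf m (2 * s) x.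
Proof.
have := normal_pdf_dominated (x - m).
by rewrite /pdf !normal_pdfE ?mulf_neq0 ?gt_eqF// !(normal_fun_center m).
Qed.

Lemma integrable_normal_pdf_moment : mu.-integrable setT (EFin \o (fun x => x * pdf x)).
Proof.
have := integrableZl measurableT (2 * s) (@integrable_normal_pdf R 0 (2 * s)).
apply: le_integrable => //.
  by apply/measurable_EFinP/measurable_funM => //; exact: measurable_normal_pdf.
move=> x _; rewrite /= lee_fin normrM (ger0_norm (normal_pdf_ge0 _ _ _)).
apply: le_trans (normal_pdf_dominated x) _; exact: ler_norm.
Qed.

Let u (t th x : R) := cos (t * x + th) * pdf x.

Let mlin (t th : R) : measurable_fun setT (fun x : R => t * x + th).
Proof. by apply: measurable_funD => //; apply: measurable_funM. Qed.

Let mcos (t th : R) : measurable_fun setT (fun x : R => cos (t * x + th)).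
Proof.
by apply: (measurableT_comp _ (mlin t th)); apply: continuous_measurable_fun;
  exact: continuous_cos.
Qed.

Let msin (t th : R) : measurable_fun setT (fun x : R => sin (t * x + th)).
Proof.
by apply: (measurableT_comp _ (mlin t th)); apply: continuous_measurable_fun;
  exact: continuous_sin.
Qed.

Let mpdf : measurable_fun setT pdf.
Proof. exact: measurable_normal_pdf. Qed.

Let iu t th : mu.-integrable setT (EFin \o u t th).
Proof.
apply: le_integrable (@integrable_normal_pdf R 0 s) => //.
  by apply/measurable_EFinP; apply: measurable_funM => //; exact: mcos.
move=> x _; rewrite /= lee_fin normrM ler_piMl// ler_norml.
by rewrite cos_geN1 cos_le1.
Qed.

Let v (t th x : R) := - (x * sin (t * x + th) * pdf x).

Let iv t th : mu.-integrable setT (EFin \o v t th).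
Proof.
apply: le_integrable integrable_normal_pdf_moment => //.
  apply/measurable_EFinP; apply: measurable_funN => //.
  by apply: measurable_funM => //; apply: measurable_funM => //; exact: msin.
move=> x _; rewrite /= lee_fin normrN mulrAC normrM ler_piMr// ler_norml.
by rewrite sin_geN1 sin_le1.
Qed.

Let du t th x : is_derive t (1 : R) (fun t => u t th x) (v t th x).
Proof.
rewrite /u.
apply: is_derive_eq; rewrite /v.
rewrite /GRing.scale/=; ring.
Qed.

Let Phi th t := \int[mu]_x u t th x.

Let dPhi th t : is_derive t (1 : R) (Phi th) (\int[mu]_x v t th x).
Proof.
have Ia : `](t - 1), (t + 1)[%classic t by rewrite /= in_itv/= ltrBlDr !ltrDl ltr01.
have intf x : `](t - 1), (t + 1)[%classic x -> mu.-integrable setT (EFin \o u x th).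
  by move=> _; exact: iu.
have der x y : `](t - 1), (t + 1)[%classic x -> setT y ->
  derivable ((fun t => u t th) ^~ y) x 1 by move=> _ _; have [] := du x th y.
have dE x y : partial1of2 (fun t => u t th) x y = v x th y.
  by rewrite partial1of2E; have [] := du x th y.
have G0 x : 0 <= `|x * pdf x| by [].
have iG : mu.-integrable setT (EFin \o (fun x => `|x * pdf x|)).
  exact: integrable_norm integrable_normal_pdf_moment.
have Gub x y : `](t - 1), (t + 1)[%classic x -> setT y ->
    `|partial1of2 (fun t => u t th) x y| <= `|y * pdf y|.
  move=> _ _; rewrite dE normrN mulrAC normrM ler_piMr// ler_norml.
  by rewrite sin_geN1 sin_le1.
have := differentiation_under_integral measurableT Ia intf der G0 iG Gub.
have := derivable_under_integral measurableT Ia intf der G0 iG Gub.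
move=> D1 D2; apply: DeriveDef; first exact: D1.
rewrite -derive1E [LHS]D2; apply: eq_Rintegral => y _.
exact: dE.
Qed.

Let normal_pdf_cvg0 : pdf n%:R @[n --> \oo] --> 0 /\ pdf (- n%:R) @[n --> \oo] --> 0.
Proof.
have E x : pdf (- x) = pdf x.
  by rewrite /pdf !normal_pdfE ?gt_eqF// /normal_fun !subr0 sqrrN.
suff H : pdf n%:R @[n --> \oo] --> 0 by split=> //; under eq_fun do rewrite E.
pose K := 2 * s * normal_peak (2 * s).
have K0 : 0 < K by rewrite !mulr_gt0 ?normal_peak_gt0 ?mulf_neq0 ?gt_eqF.
apply/cvgrPdist_le => /= e e0; near=> n.
have n0 : 0 < n%:R :> R by rewrite ltr0n; near: n; exists 1%N.
rewrite sub0r normrN ger0_norm ?normal_pdf_ge0//.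
have s20 : 0 < 2 * s by rewrite mulr_gt0.
have s2n0 : 2 * s != 0 by rewrite gt_eqF.
have := le_trans (normal_pdf_dominated n%:R)
  (ler_wpM2l (ltW s20) (normal_pdf_ub 0 n%:R s2n0)).
rewrite gtr0_norm// -ler_pdivlMl// => /le_trans; apply.
rewrite mulrC ler_pdivrMr// -ler_pdivrMl//.
by near: n; exact: nbhs_infty_ger.
Unshelve. all: by end_near. Qed.

(* Integration by parts against [pdf' = - x / s^2 * pdf]. *)
Let vE th t : \int[mu]_x v t th x = - (t * s ^+ 2) * Phi th t.
Proof.
pose F x := sin (t * x + th) * pdf x.
pose f x := t * u t th x + s ^- 2 * v t th x.
have dpdf x : is_derive x (1 : R) pdf (- (x / s ^+ 2) * pdf x).
  rewrite /pdf normal_pdfE ?gt_eqF// /normal_fun.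
  by apply: is_derive_eq; rewrite /GRing.scale/=; field; rewrite gt_eqF.
have dF x : is_derive x (1 : R) F (f x).
  rewrite /F; apply: is_derive_eq; rewrite /GRing.scale/= /f /u /v.
  by field; rewrite gt_eqF.
have i1 := integrableZl measurableT t (iu t th).
have i2 := integrableZl measurableT (s ^- 2) (iv t th).
have fi : mu.-integrable setT (EFin \o f) by exact: (integrableD measurableT i1 i2).
have If : \int[mu]_x f x = t * Phi th t + s ^- 2 * \int[mu]_x v t th x.
  rewrite /f (RintegralD measurableT i1 i2).
  by rewrite (RintegralZl _ measurableT (iu t th)) (RintegralZl _ measurableT (iv t th)).
suff f0 : \int[mu]_x f x = 0.
  have : t * Phi th t + s ^- 2 * \int[mu]_x v t th x = 0 by rewrite -If.
  have s2 : s ^+ 2 != 0 by rewrite expf_neq0 ?gt_eqF.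
  move=> E0; apply: (mulfI (invr_neq0 s2)); apply/eqP; rewrite -subr_eq0.
  by rewrite mulNr mulrN opprK mulrA mulrCA mulVf// mulr1 addrC E0.
have cF : continuous F.
  by move=> x; exact: is_derive_continuous (dF x).
have cpdf : continuous pdf by apply: continuous_normal_pdf; rewrite gt_eqF.
have cf : continuous f.
  by move=> x; rewrite /f /u /v; exact: is_derive_continuous.
pose A n := \int[mu]_(x in `[- n%:R, n%:R]) f x.
(* Indices start at 1, since the fundamental theorem is applied on a nondegenerate segment. *)
have AF n : A n.+1 = F n.+1%:R - F (- n.+1%:R).
  rewrite /A /Rintegral (@continuous_FTC2 _ f F)//.
  - by rewrite gtrN.
  - exact: continuous_subspaceT.
  - split; first by move=> x _; case: (dF x).
      by apply: cvg_at_right_filter; exact: cF.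
    by apply: cvg_at_left_filter; exact: cF.
  - by move=> x _; rewrite derive1E; case: (dF x).
have A0 : A n.+1 @[n --> \oo] --> 0.
  have [p1 p2] := normal_pdf_cvg0.
  have p0 : pdf n%:R + pdf (- n%:R) @[n --> \oo] --> 0.
    by rewrite -[X in _ --> X](addr0 0); exact: cvgD.
  have {}p0 : pdf n.+1%:R + pdf (- n.+1%:R) @[n --> \oo] --> 0.
    by rewrite (cvg_shiftS (fun n => pdf n%:R + pdf (- n%:R))).
  apply/cvgrPdist_le => e e0; have /cvgrPdist_le/(_ e e0) := p0.
  apply: filterS => n; rewrite !sub0r !normrN; apply: le_trans.
  rewrite AF /F [leRHS]ger0_norm ?addr_ge0 ?normal_pdf_ge0//.
  apply: le_trans (ler_normB _ _) _.
  by rewrite !normrM !(ger0_norm (normal_pdf_ge0 _ _ _)) lerD// ler_piMl//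
    ?normal_pdf_ge0// ler_norml sin_geN1 sin_le1.
have Af : A n @[n --> \oo] --> \int[mu]_x f x.
  under eq_fun do rewrite /A Rintegral_mkcond.
  apply: (@Rintegral_dominated_cvg _ _ _ mu _ f (fun x => `|f x|)).
  - move=> n; have mD : measurable (`[- n%:R, n%:R]%classic : set R) by [].
    apply: (measurable_restrictT f mD).1; apply: measurable_funTS.
    exact: continuous_measurable_fun cf.
  - move=> x; apply: cvg_near_cst; near=> n.
    rewrite patchE mem_set//= in_itv/= -ler_norml.
    by near: n; exact: nbhs_infty_ger.
  - exact: integrable_norm fi.
  - by move=> n x; rewrite patchE; case: ifP => // _; rewrite normr0.
rewrite -(cvg_shiftS A) in Af.
exact: (cvg_unique (@Rhausdorff R) Af A0).
Unshelve. all: by end_near. Qed.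

(** [Phi th] solves the linear equation Phi' = - t s^2 Phi: one differentiates under the integral,
    with dominating function |x| times the density, and integrates by parts. Multiplied by the
    integrating factor exp((t s)^2 / 2), it is constant, equal to its value [cos th] at 0. *)
Lemma normal_prob_cos th t :
  \int[normal_prob 0 s]_x cos (t * x + th) = expR (- (t * s) ^+ 2 / 2) * cos th.
Proof.
have cos1 x : `|cos (t * x + th)| <= 1 by rewrite ler_norml cos_geN1 cos_le1.
rewrite (integral_normal_prob (mcos t th)); last first.
  by apply: (@bounded_integrable _ _ R (normal_prob 0 s) _ 1) => //; exact: mcos.
rewrite -/(u t th) -/(Phi th t).
pose K t := expR ((t * s) ^+ 2 / 2) * Phi th t.
have dK x : is_derive x (1 : R) K 0.
  have := dPhi th x; rewrite vE => dP.
  by rewrite /K; apply: is_derive_eq; rewrite /GRing.scale/=; field.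
have K0 : Phi th 0 = cos th.
  rewrite /Phi /u; under eq_Rintegral do rewrite mul0r add0r.
  rewrite RintegralZl//; last exact: integrable_normal_pdf.
  by rewrite /Rintegral integral_normal_pdf mulr1.
have : K t = K 0 by exact: is_derive_0_is_cst.
rewrite /K mul0r expr0n/= mul0r expR0 mul1r K0 => <-.
by rewrite mulrA -expRD mulNr addNr expR0 mul1r.
Qed.

End NormalCharacteristicFunction.

(** Every section is asked to be integrable, not only almost every one, so that [fine] loses nothing
    in any inner integral. *)
Lemma Rintegral_Fubini {d1 d2 : measure_display} {T1 : measurableType d1}
    {T2 : measurableType d2} {R : realType}
    (m1 : {sigma_finite_measure set T1 -> \bar R})
    (m2 : {sigma_finite_measure set T2 -> \bar R}) (f : T1 * T2 -> R) :
  (m1 \x m2)%E.-integrable setT (EFin \o f) ->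
  (forall x, m2.-integrable setT (fun y => (f (x, y))%:E)) ->
  (forall y, m1.-integrable setT (fun x => (f (x, y))%:E)) ->
  \int[m1]_x \int[m2]_y f (x, y) = \int[m2]_y \int[m1]_x f (x, y).
Proof.
move=> fi f1 f2; rewrite /Rintegral; congr fine.
transitivity (\int[m1]_x \int[m2]_y (f (x, y))%:E)%E.
  by apply: eq_integral => x _; rewrite fineK//; exact: integrable_fin_num.
transitivity (\int[m2]_y \int[m1]_x (f (x, y))%:E)%E; first exact: (Fubini fi).
by apply: eq_integral => y _; rewrite fineK//; exact: integrable_fin_num.
Qed.

Section BoundedFubini.
Context {d1 d2 : measure_display} {T1 : measurableType d1} {T2 : measurableType d2}.
Context {R : realType}.
Variables (P1 : probability T1 R) (P2 : probability T2 R) (f : T1 * T2 -> R) (M : R).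
Hypotheses (mf : measurable_fun setT f) (fM : forall z, `|f z| <= M).

Let f1 x : P2.-integrable setT (fun y => (f (x, y))%:E).
Proof.
apply: (@bounded_integrable _ _ R P2 _ M) => //.
by apply: measurableT_comp mf _; exact: measurable_pair1.
Qed.

Let f2 y : P1.-integrable setT (fun x => (f (x, y))%:E).
Proof.
apply: (@bounded_integrable _ _ R P1 _ M) => //.
by apply: measurableT_comp mf _; exact: measurable_pair2.
Qed.

Lemma bounded_integrable_prod : (P1 \x P2)%E.-integrable setT (EFin \o f).
Proof.
apply/integrable12ltyP; first exact/measurable_EFinP.
apply: (@le_lt_trans _ _ (\int[P1]_x M%:E)%E); last first.
  by rewrite integral_cst// [X in (_ * X)%E](@probability_setT _ _ _ P1) mule1 ltry.
apply: ge0_le_integral => //.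
- by move=> x _; apply: integral_ge0.
- apply: (@measurable_fun_fubini_tonelli_F _ _ _ _ _ P2 (abse \o (EFin \o f))).
    by apply: measurableT_comp => //; exact/measurable_EFinP.
  by move=> z; exact: abse_ge0.
- move=> x _; apply: (@le_trans _ _ (\int[P2]_y M%:E)%E).
    apply: ge0_le_integral => //.
    + by apply: measurableT_comp => //; case/integrableP : (f1 x).
    + by move=> y _; rewrite lee_fin.
  by rewrite integral_cst// [X in (_ * X)%E](@probability_setT _ _ _ P2) mule1.
Qed.

Lemma bounded_Fubini :
  \int[P1]_x \int[P2]_y f (x, y) = \int[P2]_y \int[P1]_x f (x, y).
Proof. exact: Rintegral_Fubini bounded_integrable_prod f1 f2. Qed.

End BoundedFubini.

(** * Smoothing by Gaussian kernels *)

Section GaussianRegularisation.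
Context {d : measure_display} {Omega : measurableType d} {R : realType}.
Variables (P : probability Omega R) (X phi : Omega -> R) (M : R).
Hypotheses (mX : measurable_fun setT X) (mphi : measurable_fun setT phi).
Hypothesis phiM : forall w, `|phi w| <= M.
Notation mu := (@lebesgue_measure R).

(** The Fourier transform of the image under [X] of the signed measure of density [phi]. The phase
    [th] gives both its real part, at 0, and its imaginary part, at -pi/2, so that no complex number
    is needed. *)
Definition weighted_cos t th := \int[P]_w (phi w * cos (t * X w + th)).

(** The Gaussian function is an average of cosines under a normal law, by [normal_prob_cos]; Fubini
    exchanges this average with the expectation. *)
Lemma gauss_weighted_cos s a : 0 < s ->
  \int[P]_w (phi w * expR (- ((X w - a) * s) ^+ 2 / 2)) =
  \int[normal_prob 0 s]_t weighted_cos t (- (t * a)).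
Proof.
move=> s0.
pose f (z : Omega * R) := phi z.1 * cos ((X z.1 - a) * z.2).
have mf : measurable_fun setT f.
  apply: measurable_funM; first exact: measurableT_comp mphi measurable_fst.
  apply: (@measurableT_comp _ _ _ _ _ _ cos).
    by apply: continuous_measurable_fun; exact: continuous_cos.
  apply: measurable_funM => //.
  by apply: measurable_funB => //; exact: measurableT_comp mX measurable_fst.
have fM z : `|f z| <= M.
  rewrite /f normrM (le_trans _ (phiM z.1))// ler_piMr// ler_norml.
  by rewrite cos_geN1 cos_le1.
have := @bounded_Fubini _ _ _ (measurableTypeR R) _ P (@normal_prob R 0 s) f M mf fM.
rewrite /f /=.
have cosw w th : (@normal_prob R 0 s).-integrable setT
    (EFin \o (fun y : R => cos ((X w - a) * y + th))).
  apply: (@bounded_integrable _ _ R (@normal_prob R 0 s) _ 1).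
    apply: (@measurableT_comp _ _ _ _ _ _ cos).
      by apply: continuous_measurable_fun; exact: continuous_cos.
    by apply: measurable_funD => //; exact: measurable_funM.
  by move=> y; rewrite ler_norml cos_geN1 cos_le1.
under eq_Rintegral => w _.
  under eq_Rintegral do rewrite -[X in cos X]addr0.
  rewrite RintegralZl//= normal_prob_cos// cos0 mulr1.
  over.
move=> ->.
rewrite /weighted_cos.
apply: eq_Rintegral => t _; apply: eq_Rintegral => w _.
by congr (_ * cos _); ring.
Qed.

Lemma normal_pdf_center (m s x : R) : s != 0 -> normal_pdf m s x = normal_pdf 0 s (x - m).
Proof. by move=> s0; rewrite !normal_pdfE// !(normal_fun_center m). Qed.

Variable h : R -> R.
Hypotheses (mh : measurable_fun setT h) (h1 : forall x, `|h x| <= 1).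

Section Smoothing.
Variable s : R.
Hypothesis s0 : 0 < s.
Let s0' : s != 0. Proof. by rewrite gt_eqF. Qed.
Let f (z : Omega * measurableTypeR R) :=
  phi z.1 * (h z.2 * normal_pdf (X z.1) s z.2).

Let mf : measurable_fun setT f.
Proof.
apply: measurable_funM; first exact: measurableT_comp mphi measurable_fst.
apply: measurable_funM; first exact: measurableT_comp mh measurable_snd.
under eq_fun do rewrite normal_pdf_center//.
apply: measurableT_comp; first exact: measurable_normal_pdf.
by apply: measurable_funB => //; exact: measurableT_comp mX measurable_fst.
Qed.

Let M0 (w : Omega) : 0 <= M. Proof. exact: le_trans (phiM w). Qed.

Let fp z : `|f z| <= M * normal_pdf (X z.1) s z.2.
Proof.
rewrite /f normrM ler_pM// normrM (ger0_norm (normal_pdf_ge0 _ _ _)).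
by rewrite ler_piMl// normal_pdf_ge0.
Qed.

Let f1 w : mu.-integrable setT (fun a => (f (w, a))%:E).
Proof.
have := integrableZl measurableT M (@integrable_normal_pdf R (X w) s).
apply: le_integrable => //.
  by apply/measurable_EFinP; apply: measurableT_comp mf _; exact: measurable_pair1.
by move=> a _; rewrite /= lee_fin; apply: le_trans (fp _) _; exact: ler_norm.
Qed.

Let f2 a : P.-integrable setT (fun w => (f (w, a))%:E).
Proof.
apply: (@bounded_integrable _ _ R P _ (M * normal_peak s)).
  by apply: measurableT_comp mf _; exact: measurable_pair2.
move=> w; apply: le_trans (fp _) _; rewrite ler_wpM2l ?(M0 w)//.
exact: normal_pdf_ub.
Qed.

Let fi : (P \x mu)%E.-integrable setT (EFin \o f).
Proof.
apply/integrable12ltyP; first exact/measurable_EFinP.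
apply: (@le_lt_trans _ _ (\int[P]_x M%:E)%E); last first.
  by rewrite integral_cst// [X in (_ * X)%E](@probability_setT _ _ _ P) mule1 ltry.
apply: ge0_le_integral => //.
- by move=> x _; apply: integral_ge0.
- apply: (@measurable_fun_fubini_tonelli_F _ _ _ _ _ mu (abse \o (EFin \o f))).
    by apply: measurableT_comp => //; exact/measurable_EFinP.
  by move=> z; exact: abse_ge0.
- move=> w _; apply: (@le_trans _ _ (\int[mu]_a (M * normal_pdf (X w) s a)%:E)%E).
    apply: ge0_le_integral => //.
    + by apply: measurableT_comp => //; case/integrableP : (f1 w).
    + apply/measurable_EFinP/measurable_funM => //; exact: measurable_normal_pdf.
    + by move=> y _; rewrite lee_fin; exact: fp.
  under eq_integral do rewrite EFinM.
  rewrite integralZl//; last exact: integrable_normal_pdf.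
  by rewrite integral_normal_pdf mule1.
Qed.

Let ih m : mu.-integrable setT (EFin \o (fun a => h a * normal_pdf m s a)).
Proof.
apply: le_integrable (@integrable_normal_pdf R m s) => //.
  apply/measurable_EFinP; apply: measurable_funM => //; exact: measurable_normal_pdf.
by move=> a _; rewrite /= lee_fin normrM ler_piMl.
Qed.

(** The left side convolves the test function [h] with a Gaussian; on the right only Gaussian test
    functions meet [X], and those are determined by the cosines. *)
Lemma weighted_smoothing :
  \int[P]_w (phi w * \int[mu]_a (h a * normal_pdf (X w) s a)) =
  \int[mu]_a (h a * \int[P]_w (phi w * normal_pdf (X w) s a)).
Proof.
have := Rintegral_Fubini fi f1 f2; rewrite /f /=.
under eq_Rintegral do rewrite RintegralZl//.
move=> ->; apply: eq_Rintegral => a _.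
under eq_Rintegral do rewrite mulrCA.
rewrite RintegralZl//.
apply: (@bounded_integrable _ _ R P _ (M * normal_peak s)).
  apply: measurable_funM => //; under eq_fun do rewrite normal_pdf_center//.
  by apply: measurableT_comp; [exact: measurable_normal_pdf|exact: measurable_funB].
move=> w; rewrite normrM ler_pM// ger0_norm ?normal_pdf_ge0//.
exact: normal_pdf_ub.
Qed.

(** The error is at most [L] times the mean distance of the normal law to its centre, and
    [normal_pdf_dominated_mean] bounds this mean by [2 * s]. *)
Let smoothing_error L m : (forall x y, `|h x - h y| <= L * `|x - y|) ->
  `|\int[mu]_a (h a * normal_pdf m s a) - h m| <= L * (2 * s).
Proof.
move=> hL.
have ip := @integrable_normal_pdf R m s.
have mp := @measurable_normal_pdf R m s.
have ihm := integrableZl measurableT (h m) ip.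
have -> : h m = \int[mu]_a (h m * normal_pdf m s a).
  by rewrite RintegralZl// /Rintegral integral_normal_pdf mulr1.
rewrite -RintegralB//.
have i1 : mu.-integrable setT
    (EFin \o (fun a => h a * normal_pdf m s a - h m * normal_pdf m s a)).
  exact: (integrableB measurableT (ih m) ihm).
apply: le_trans (le_normr_Rintegral measurableT i1) _.
have i2 := integrableZl measurableT (L * (2 * s)) (@integrable_normal_pdf R m (2 * s)).
have -> : L * (2 * s) = \int[mu]_a (L * (2 * s) * normal_pdf m (2 * s) a).
  have I1 : \int[mu]_a normal_pdf m (2 * s) a = 1 by rewrite /Rintegral integral_normal_pdf.
  by rewrite RintegralZl ?I1 ?mulr1//; exact: integrable_normal_pdf.
have L0 : 0 <= L.
  by have := le_trans (normr_ge0 _) (hL 1 0); rewrite subr0 normr1 mulr1.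
apply: le_Rintegral => //; first exact: integrable_norm i1.
move=> a _; rewrite -mulrBl normrM (ger0_norm (normal_pdf_ge0 _ _ _)).
rewrite -mulrA; apply: le_trans (ler_wpM2l L0 (normal_pdf_dominated_mean s0 m a)).
by rewrite mulrA ler_wpM2r ?normal_pdf_ge0.
Qed.

Lemma weighted_smoothing_error L : (forall x y, `|h x - h y| <= L * `|x - y|) ->
  `|\int[P]_w (phi w * \int[mu]_a (h a * normal_pdf (X w) s a)) -
    \int[P]_w (phi w * h (X w))| <= M * (L * (2 * s)).
Proof.
move=> hL; pose g w := \int[mu]_a (h a * normal_pdf (X w) s a).
have ig : P.-integrable setT (EFin \o (fun w => phi w * g w)).
  have := integrable_fubini_F fi; apply: eq_integrable => // w _.
  rewrite /fubini_F /= /f /= /g -RintegralZl// /Rintegral fineK//.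
  exact: integrable_fin_num (f1 w).
have ihX : P.-integrable setT (EFin \o (fun w => phi w * h (X w))).
  apply: (@bounded_integrable _ _ R P _ M).
    by apply: measurable_funM => //; exact: measurableT_comp.
  by move=> w; rewrite normrM (le_trans _ (phiM w))// ler_piMr.
rewrite -RintegralB//.
have i1 : P.-integrable setT (EFin \o (fun w => phi w * g w - phi w * h (X w))).
  exact: (integrableB measurableT ig ihX).
apply: le_trans (le_normr_Rintegral measurableT i1) _.
have -> : M * (L * (2 * s)) = \int[P]_w (M * (L * (2 * s))).
  by rewrite Rintegral_cst// [X in fine X](@probability_setT _ _ _ P) mulr1.
apply: le_Rintegral => //.
- exact: integrable_norm i1.
- exact: finite_measure_integrable_cst.
- by move=> w _; rewrite -mulrBr normrM ler_pM// smoothing_error.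
Qed.

End Smoothing.

End GaussianRegularisation.

(** * Uniqueness of Fourier transforms of weighted laws *)

Section FourierUniqueness.
Context {d1 d2 : measure_display} {O1 : measurableType d1} {O2 : measurableType d2}.
Context {R : realType}.
Variables (P1 : probability O1 R) (X1 phi1 : O1 -> R).
Variables (P2 : probability O2 R) (X2 phi2 : O2 -> R).
Variable M : R.
Hypotheses (mX1 : measurable_fun setT X1) (mphi1 : measurable_fun setT phi1).
Hypotheses (mX2 : measurable_fun setT X2) (mphi2 : measurable_fun setT phi2).
Hypotheses (M1 : forall w, `|phi1 w| <= M) (M2 : forall w, `|phi2 w| <= M).
Hypothesis eq_cos : forall t th,
  weighted_cos P1 X1 phi1 t th = weighted_cos P2 X2 phi2 t th.

(** As a function of its centre, the density of deviation [s] is a multiple of a Gaussian at scale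
    [s^-1], hence a mixture of cosines under the normal law of deviation [s^-1]. *)
Let eq_pdf s a : 0 < s -> \int[P1]_w (phi1 w * normal_pdf (X1 w) s a) =
  \int[P2]_w (phi2 w * normal_pdf (X2 w) s a).
Proof.
move=> s0.
have E x : normal_pdf x s a = normal_peak s * expR (- ((x - a) * s^-1) ^+ 2 / 2).
  rewrite normal_pdfE ?gt_eqF// /normal_fun; congr (_ * expR _).
  by field; rewrite gt_eqF.
have H d (O : measurableType d) (P : probability O R) (X phi : O -> R) :
    measurable_fun setT X -> measurable_fun setT phi -> (forall w, `|phi w| <= M) ->
    \int[P]_w (phi w * normal_pdf (X w) s a) =
    normal_peak s * \int[normal_prob 0 s^-1]_t weighted_cos P X phi t (- (t * a)).
  move=> mX mphi MP.
  under eq_Rintegral do rewrite E mulrCA.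
  rewrite -(@gauss_weighted_cos _ _ _ P X phi M) ?invr_gt0// RintegralZl//.
  apply: (@bounded_integrable _ _ R P _ M).
    apply: measurable_funM => //; apply: measurableT_comp => //.
    apply: measurable_funM => //; apply: measurable_funN; apply: measurable_funX.
    by apply: measurable_funM => //; exact: measurable_funB.
  move=> w; rewrite normrM (le_trans _ (MP w))// ler_piMr// ger0_norm ?expR_ge0//.
  by rewrite -[leRHS]expR0 ler_expR mulNr oppr_le0 divr_ge0// sqr_ge0.
rewrite !H//; congr (_ * _); apply: eq_Rintegral => t _; exact: eq_cos.
Qed.

Let eq_lipschitz (h : R -> R) L : measurable_fun setT h -> (forall x, `|h x| <= 1) ->
  (forall x y, `|h x - h y| <= L * `|x - y|) ->
  \int[P1]_w (phi1 w * h (X1 w)) = \int[P2]_w (phi2 w * h (X2 w)).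
Proof.
move=> mh h1 hL; apply/eqP; rewrite -subr_eq0 -normr_le0.
apply/ler_addgt0Pr => e e0; rewrite add0r.
have L0 : 0 <= L.
  by have := le_trans (normr_ge0 _) (hL 1 0); rewrite subr0 normr1 mulr1.
have K0 : 0 <= `|M| * L * 4 by rewrite !mulr_ge0.
(* Each of the two smoothing errors is at most [M * (L * (2 * s))]; this choice of [s] brings their
   sum below [e]. *)
pose s := e / (`|M| * L * 4 + 1).
have s0 : 0 < s by rewrite divr_gt0// ltr_pwDr.
have A1 := weighted_smoothing_error P1 mX1 mphi1 M1 mh h1 s0 hL.
have A2 := weighted_smoothing_error P2 mX2 mphi2 M2 mh h1 s0 hL.
rewrite (weighted_smoothing P1 mX1 mphi1 M1 mh h1 s0) in A1.
rewrite (weighted_smoothing P2 mX2 mphi2 M2 mh h1 s0) in A2.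
have E : \int[lebesgue_measure]_a (h a * \int[P1]_w (phi1 w * normal_pdf (X1 w) s a)) =
  \int[lebesgue_measure]_a (h a * \int[P2]_w (phi2 w * normal_pdf (X2 w) s a)).
  by apply: eq_Rintegral => a _; rewrite eq_pdf.
rewrite E in A1; move: A1 A2; set y := \int[_]_a _; set x1 := \int[P1]_w _.
set x2 := \int[P2]_w _ => A1 A2.
rewrite -(subrKA y) (le_trans (ler_normD _ _))// [X in X + _]distrC.
apply: (le_trans (lerD A1 A2)).
apply: (@le_trans _ _ (`|M| * L * 4 * s)).
  have := ler_wpM2r (mulr_ge0 L0 (ltW s0)) (ler_norm M); nra.
rewrite /s mulrA ler_pdivrMr ?ltr_pwDr// mulrC ler_wpM2l ?(ltW e0)//.
by rewrite lerDl.
Qed.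

(** The indicator of an open ray is the pointwise limit of the Lipschitz ramps min(1, max(0, n (b -
    x))); the ray is open because every ramp vanishes at [b]. *)
Let eq_ray b : \int[P1]_(w in X1 @^-1` `]-oo, b[) phi1 w =
  \int[P2]_(w in X2 @^-1` `]-oo, b[) phi2 w.
Proof.
pose h (n : nat) x := Num.min 1 (Num.max 0 (n%:R * (b - x))) : R.
have h01 n x : 0 <= h n x <= 1.
  by rewrite /h le_min ler01 le_max lexx ge_min lexx.
have mh n : measurable_fun setT (h n).
  apply: measurable_minr => //; apply: measurable_maxr => //.
  by apply: measurable_funM => //; exact: measurable_funB.
have hL n x y : `|h n x - h n y| <= n%:R * `|x - y|.
  have -> : n%:R * `|x - y| = `|n%:R * (b - x) - n%:R * (b - y)|.
    by rewrite -mulrBr normrM ger0_norm//; congr (_ * _); rewrite distrC; congr `|_|; ring.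
  rewrite /h; set u := n%:R * _; set v := n%:R * (b - y).
  have clampE (z : R) : Num.min 1 (Num.max 0 z) =
      if z <= 0 then 0 else if 1 <= z then 1 else z.
    by case: (leP z 0) => z0; [rewrite min_r|case: (leP 1 z)].
  have := ler_norm (u - v); have := ler_norm (v - u); rewrite distrC; set r := `|u - v| => r1 r2.
  by rewrite !clampE; case: (lerP u 0) => ?; case: (lerP v 0) => ?;
    try (case: (lerP 1 u) => ?); try (case: (lerP 1 v) => ?);
    rewrite ler_norml; apply/andP; split; lra.
have hcvg x : h n x @[n --> \oo] --> (\1_(`]-oo, b[%classic : set R) x : R).
  rewrite indicE; have [bx|xb] := leP b x.
    rewrite memNset /=; last by rewrite in_itv/= ltNge bx.
    apply: cvg_near_cst; apply: nearW => n; rewrite /h max_l ?min_r//.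
    by rewrite mulr_ge0_le0// subr_le0.
  rewrite mem_set /= ?in_itv//=; apply: cvg_near_cst; near=> n.
  rewrite /h max_r ?min_l//; last by rewrite mulr_ge0// subr_ge0 ltW.
  rewrite -ler_pdivrMr ?subr_gt0//; near: n; exact: nbhs_infty_ger.
have H d (O : measurableType d) (P : probability O R) (X phi : O -> R) :
    measurable_fun setT X -> measurable_fun setT phi -> (forall w, `|phi w| <= M) ->
    \int[P]_w (phi w * h n (X w)) @[n --> \oo] -->
    \int[P]_(w in X @^-1` `]-oo, b[) phi w.
  move=> mX mphi MP.
  rewrite Rintegral_mkcond.
  apply: (@Rintegral_dominated_cvg _ _ _ P _ _ (fun=> M)).
  - by move=> n; apply: measurable_funM => //; exact: measurableT_comp.
  - move=> w.
    have -> : (phi \_ (X @^-1` `]-oo, b[)) w = phi w * \1_(`]-oo, b[%classic : set R) (X w).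
      by rewrite patchE indicE; case: ifPn; rewrite ?inE ?notin_setE => Xb;
        [rewrite mem_set// mulr1|rewrite memNset// mulr0].
    by apply: cvgM (hcvg (X w)); exact: cvg_cst.
  - exact: finite_measure_integrable_cst.
  - move=> n w; rewrite normrM (le_trans _ (MP w))// ler_piMr// ger0_norm.
      by case/andP: (h01 n (X w)).
    by case/andP: (h01 n (X w)).
have C1 := H _ _ P1 X1 phi1 mX1 mphi1 M1.
have C2 := H _ _ P2 X2 phi2 mX2 mphi2 M2.
have h1 n x : `|h n x| <= 1.
  by case/andP: (h01 n x) => h0 h1; rewrite ger0_norm.
rewrite (_ : (fun n => _) = (fun n => \int[P2]_w (phi2 w * h n (X2 w)))) in C1.
  exact: (cvg_unique (@Rhausdorff R) C1 C2).
by apply/funext => n; apply: eq_lipschitz (hL n).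
Unshelve. all: by end_near. Qed.

(** Open rays are stable under intersection and generate the Borel sets, and the total masses agree
    by frequency 0. Weights of any sign matter: the constant 1 compares laws, while other weights
    allow a cosine inside a product to be replaced by an indicator, which is how independence is
    obtained below. *)
Theorem fourier_uniqueness (S : set R) : measurable S ->
  \int[P1]_(w in X1 @^-1` S) phi1 w = \int[P2]_(w in X2 @^-1` S) phi2 w.
Proof.
move=> mS.
have i1 : P1.-integrable setT (EFin \o phi1) by exact: bounded_integrable M1.
have i2 : P2.-integrable setT (EFin \o phi2) by exact: bounded_integrable M2.
have m1 A : measurable A -> measurable (X1 @^-1` A).
  by move=> mA; rewrite -[X in measurable X]setTI; exact: mX1.
have m2 A : measurable A -> measurable (X2 @^-1` A).
  by move=> mA; rewrite -[X in measurable X]setTI; exact: mX2.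
have eqT : \int[P1]_w phi1 w = \int[P2]_w phi2 w.
  have := eq_cos 0 0; rewrite /weighted_cos.
  by under eq_Rintegral do rewrite mul0r addr0 cos0 mulr1;
    under [RHS]eq_Rintegral do rewrite mul0r addr0 cos0 mulr1.
have mE : @measurable _ R = <<s @RGenInftyO.G R >> by exact: RGenInftyO.measurableE.
rewrite mE in mS; move: S mS.
apply: dynkin_induction mE _ _ _ _ _.
- move=> _ _ [x ->] [y ->]; exists (Num.min x y).
  by rewrite predeqE => z; rewrite /= !in_itv/= lt_min; split => /andP.
- by rewrite !preimage_setT.
- by move=> _ [x ->]; exact: eq_ray.
- move=> S mS ES.
  have split d (O : measurableType d) (P : probability O R) (X phi : O -> R) :
      (forall A, measurable A -> measurable (X @^-1` A)) ->
      P.-integrable setT (EFin \o phi) ->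
      \int[P]_w phi w = \int[P]_(w in X @^-1` S) phi w + \int[P]_(w in X @^-1` (~` S)) phi w.
    move=> mX iphi; rewrite -Rintegral_setU//.
    + by rewrite -preimage_setU setUv preimage_setT.
    + exact: mX.
    + by apply: mX; exact: measurableC.
    + by rewrite -preimage_setU setUv preimage_setT.
    + by apply/disj_setPS => w [] /= + nSw; exact: nSw.
  move: eqT; rewrite (split _ _ P1 X1)// (split _ _ P2 X2)// ES.
  exact: addrI.
- move=> F mF tF EF.
  rewrite !preimage_bigcup /Rintegral !integral_bigcup//.
  + congr fine; apply: eq_eseriesr => n _.
    have := EF n; rewrite /Rintegral => /(congr1 (@EFin R)).
    rewrite fineK; last first.
      exact: (integrable_fin_num (m1 _ (mF n))
        (integrableS measurableT (m1 _ (mF n)) (@subsetT _ _) i1)).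
    rewrite fineK//; exact: (integrable_fin_num (m2 _ (mF n))
        (integrableS measurableT (m2 _ (mF n)) (@subsetT _ _) i2)).
  + by move=> i j _ _ [w [Fi Fj]]; apply: (tF i j) => //; eexists; split; [exact: Fi|exact: Fj].
  + by move=> k; apply: m2.
  + by apply: integrableS i2 => //; apply: bigcup_measurable => k _; exact: m2.
  + by move=> i j _ _ [w [Fi Fj]]; apply: (tF i j) => //; eexists; split; [exact: Fi|exact: Fj].
  + by move=> k; apply: m1.
  + by apply: integrableS i1 => //; apply: bigcup_measurable => k _; exact: m1.
Qed.

End FourierUniqueness.

(** * Independence and Gaussian variables *)

Section Independence.
Context {d : measure_display} {Omega : measurableType d} {R : realType}.
Variable P : probability Omega R.
Implicit Types (X Y : Omega -> R).

Lemma Rintegral_law (X : {mfun Omega >-> R}) (f : R -> R) : measurable_fun setT f ->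
  P.-integrable setT (EFin \o (f \o X)) ->
  \int[distribution P X]_x f x = \int[P]_w f (X w).
Proof.
move=> mf fi; rewrite /Rintegral (integral_distribution _ (f := EFin \o f))//.
exact/measurable_EFinP.
Qed.

(** The joint law agrees with the product of the two laws on rectangles, hence everywhere, and the
    integral factors by Fubini. *)
Lemma independent_prod X Y (G H : set (set Omega)) (f g : R -> R) (M : R) :
  measurable_fun setT X -> measurable_fun setT Y ->
  sigma_of X `<=` G -> sigma_of Y `<=` H -> independent P G H ->
  measurable_fun setT f -> measurable_fun setT g ->
  (forall x, `|f x| <= M) -> (forall x, `|g x| <= M) ->
  \int[P]_w (f (X w) * g (Y w)) = \int[P]_w f (X w) * \int[P]_w g (Y w).
Proof.
move=> mX mY XG YH GH mf mg fM gM.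
pose X' : {mfun Omega >-> R} := HB.pack X (isMeasurableFun.Build _ _ _ _ X mX).
pose Y' : {mfun Omega >-> R} := HB.pack Y (isMeasurableFun.Build _ _ _ _ Y mY).
have mXY : measurable_fun setT (fun w => (X w, Y w)).
  exact: measurable_fun_pair.
pose Z : {mfun Omega >-> (R * R)%type} :=
  HB.pack (fun w => (X w, Y w)) (isMeasurableFun.Build _ _ _ _ _ mXY).
have bint (m : probability R R) (h : R -> R) : measurable_fun setT h -> (forall x, `|h x| <= M) ->
    m.-integrable setT (EFin \o h).
  by move=> mh hM; exact: (@bounded_integrable _ _ R m _ M).
have Pint (h : R -> R) (V : Omega -> R) : measurable_fun setT V -> measurable_fun setT h ->
    (forall x, `|h x| <= M) -> P.-integrable setT (EFin \o (h \o V)).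
  by move=> mV mh hM; apply: (@bounded_integrable _ _ R P _ M) => [|w]; [exact: measurableT_comp mh mV|exact: hM].
have := @product_measure_unique _ _ _ _ _ (distribution P X') (distribution P Y') (distribution P Z).
move=> U.
have {}U : forall A, measurable A -> (distribution P X' \x distribution P Y')%E A = distribution P Z A.
  apply: U => A B mA mB; rewrite /distribution /pushforward.
  rewrite -GH.
  - by congr (P _).
  - by apply: XG; exists A => //; rewrite setTI.
  - by apply: YH; exists B => //; rewrite setTI.
pose F (z : R * R) := f z.1 * g z.2.
have mF : measurable_fun setT F.
  apply: measurable_funM; first exact: measurableT_comp mf measurable_fst.
  exact: measurableT_comp mg measurable_snd.
have FM z : `|F z| <= M * M by rewrite normrM ler_pM.
transitivity (\int[distribution P Z]_z F z).
  rewrite /Rintegral (integral_distribution _ (f := EFin \o F))//.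
    exact/measurable_EFinP.
  apply: (@bounded_integrable _ _ R P _ (M * M)) => //; exact: measurableT_comp.
have Fi := bounded_integrable_prod (distribution P X') (distribution P Y') mF FM.
transitivity (\int[distribution P X']_x \int[distribution P Y']_y F (x, y)).
  rewrite /Rintegral; congr fine.
  transitivity (\int[(distribution P X' \x distribution P Y')]_z (F z)%:E)%E.
    by apply: eq_measure_integral => A mA _; exact: esym (U A mA).
  rewrite -(integral12_prod_meas1 Fi); apply: eq_integral => x _.
  rewrite /fubini_F/= fineK//; apply: integrable_fin_num => //.
  have mFx : measurable_fun setT (fun y => F (x, y)).
    by apply: measurableT_comp mF _; exact: measurable_pair1.
  exact: (bounded_integrable (distribution P Y') mFx (fun y => FM (x, y))).
rewrite -(Rintegral_law (X := X') mf (Pint _ _ mX mf fM)).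
rewrite -(Rintegral_law (X := Y') mg (Pint _ _ mY mg gM)).
rewrite -RintegralZr//; last exact: bint.
apply: eq_Rintegral => x _; rewrite /F /= RintegralZl//; exact: bint.
Qed.

End Independence.

(** * Elementary bounds on sine and cosine *)

Section Trigonometry.
Context {R : realType}.
Implicit Types (x y : R).

Lemma lipschitz1_of_derive (f g : R -> R) : (forall x, is_derive x (1 : R) f (g x)) ->
  (forall x, `|g x| <= 1) -> forall x y, `|f x - f y| <= `|x - y|.
Proof.
move=> fg g1.
have H x y : x < y -> `|f x - f y| <= `|x - y|.
  move=> xy.
  have fg' z : z \in `]x, y[ -> is_derive z (1 : R) f (g z) by move=> _; exact: fg.
  have cf : {within `[x, y], continuous f}.
    by apply: continuous_subspaceT => z; exact: is_derive_continuous (fg z).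
  have [c _ E] := MVT xy fg' cf.
  by rewrite distrC E normrM (distrC x) ler_piMl.
move=> x y; have [xy|xy|->] := ltgtP x y; first exact: H.
  by rewrite distrC (distrC x); exact: H.
by rewrite !subrr.
Qed.

Lemma cos_lipschitz x y : `|cos x - cos y| <= `|x - y|.
Proof.
apply: (@lipschitz1_of_derive cos (fun x => - sin x)) => z.
by rewrite normrN ler_norml sin_geN1 sin_le1.
Qed.

Lemma sin_le_norm x : `|sin x| <= `|x|.
Proof.
have := @lipschitz1_of_derive sin cos _ _ x 0; rewrite sin0 !subr0; apply => z.
by rewrite ler_norml cos_geN1 cos_le1.
Qed.

Lemma sin_sqr_half_angle x : sin x ^+ 2 = (1 - cos (2 * x)) / 2.
Proof.
have -> : 2 * x = x + x by ring.
by rewrite cosD -!expr2 cos2sin2; field.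
Qed.

Lemma is_derive_cvg_seq (g : R -> R) l (a : nat -> R) : is_derive 0 (1 : R) g l ->
  g 0 = 0 -> (forall n, a n != 0) -> a n @[n --> \oo] --> 0 ->
  g (a n) / a n @[n --> \oo] --> l.
Proof.
move=> [dg gl] g0 an0 a0.
have /cvgr_dnbhsP/(_ a) := dg.
move=> /(_ (conj an0 a0)).
rewrite [lim _](_ : _ = l)//.
under eq_fun do rewrite /= addr0 g0 subr0 /GRing.scale/= mulr1 mulrC.
by [].
Qed.

End Trigonometry.

Lemma measurable_cos_affine {d : measure_display} {T : measurableType d} {R : realType}
    (X : T -> R) (t th : R) : measurable_fun setT X ->
  measurable_fun setT (fun w => cos (t * X w + th)).
Proof.
move=> mX; apply: (@measurableT_comp _ _ _ _ _ _ cos).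
  by apply: continuous_measurable_fun; exact: continuous_cos.
by apply: measurable_funD => //; exact: measurable_funM.
Qed.

(** * Centred Gaussian variables through their characteristic functions *)

Section GaussianVariables.
Context {d : measure_display} {Omega : measurableType d} {R : realType}.
Variable P : probability Omega R.
Implicit Types (X Y : Omega -> R) (v t th : R).
Local Notation L2 := (square_integrable P).

(** The centred normal law of variance [v], in the form that passes to L2 limits, adds up under
    independence and makes sense for [v = 0]. The phase [th] also contains the symmetry of the law:
    at pi/2 the mean of [sin (t * X)] is seen to vanish. *)
Definition gaussian_cf v X := forall t th,
  \int[P]_w cos (t * X w + th) = expR (- t ^+ 2 * v / 2) * cos th.

Lemma integrable_cos X t th : measurable_fun setT X ->
  P.-integrable setT (EFin \o (fun w => cos (t * X w + th))).
Proof.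
move=> mX; apply: (@bounded_integrable _ _ _ P _ 1).
  exact: measurable_cos_affine.
by move=> w; rewrite ler_norml cos_geN1 cos_le1.
Qed.

Lemma gaussian_cf_of_law s X : 0 < s -> measurable_fun setT X ->
  (forall Y : set R, measurable Y -> P (X @^-1` Y) = normal_prob 0 s Y) ->
  gaussian_cf (s ^+ 2) X.
Proof.
move=> s0 mX XN t th.
have mX' : measurable_fun setT (X : Omega -> measurableTypeR R) by exact: mX.
pose X' : {mfun Omega >-> measurableTypeR R} :=
  HB.pack (X : Omega -> measurableTypeR R) (isMeasurableFun.Build _ _ _ _ _ mX').
have -> : - t ^+ 2 * s ^+ 2 / 2 = - (t * s) ^+ 2 / 2 by rewrite exprMn mulNr.
have mc : measurable_fun setT (fun x : R => cos (t * x + th)).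
  exact: measurable_cos_affine (@measurable_id _ R setT).
have mc' : measurable_fun setT (EFin \o (fun x : measurableTypeR R => cos (t * x + th))).
  exact/measurable_EFinP.
rewrite -normal_prob_cos// /Rintegral; congr fine.
rewrite -(@integral_distribution _ _ _ _ _ P X' _ mc' (integrable_cos _ _ mX)).
by apply: eq_measure_integral => A mA _; exact: XN.
Qed.

Lemma law_of_gaussian_cf v X : 0 < v -> measurable_fun setT X -> gaussian_cf v X ->
  forall Y : set R, measurable Y -> P (X @^-1` Y) = normal_prob 0 (Num.sqrt v) Y.
Proof.
move=> v0 mX XN Y mY.
have s0 : 0 < Num.sqrt v by rewrite sqrtr_gt0.
pose N : probability (measurableTypeR R) R := @normal_prob R 0 (Num.sqrt v).
have m2 : measurable_fun (setT : set (measurableTypeR R)) (id : R -> R) by exact: measurable_id.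
have := @fourier_uniqueness _ _ Omega (measurableTypeR R) R P X (cst 1) N id (cst 1) 1
  mX (measurable_cst _) m2 (measurable_cst _).
have n1 : `|1 : R| <= 1 by rewrite normr1.
move=> /(_ (fun=> n1) (fun=> n1)) H.
have {}H := H _ Y mY.
have mXY : measurable (X @^-1` Y) by rewrite -[X in measurable X]setTI; exact: mX.
move: H; rewrite !Rintegral_cst// !mul1r => H.
rewrite -[LHS]fineK ?fin_num_measure//.
rewrite H ?fineK ?fin_num_measure//.
move=> t th; rewrite /weighted_cos.
under eq_Rintegral do rewrite mul1r.
under [RHS]eq_Rintegral do rewrite mul1r.
by rewrite XN normal_prob_cos// exprMn sqr_sqrtr ?(ltW v0)// mulNr.
Qed.

(** The square of sin(a X) / a is an affine function of cos(2 a X), so its mean (1 - exp(-2 v a^2))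
    / (2 a^2) is known; it is at most [v] and tends to [v] as a tends to 0. Fatou gives square
    integrability of [X], after which X^2 dominates and the limit identifies the variance. *)
Lemma gaussian_cf_square_integrable v X : 0 <= v -> measurable_fun setT X ->
  gaussian_cf v X -> L2 X /\ iprod P X X = v.
Proof.
move=> v0 mX XN.
pose a (n : nat) : R := harmonic n.
have a0 n : a n != 0 by rewrite /a /harmonic/= gt_eqF// invr_gt0.
pose f n w := sin (a n * X w) / a n.
have mf n : measurable_fun setT (f n).
  apply: measurable_funM => //; apply: (@measurableT_comp _ _ _ _ _ _ sin).
    by apply: continuous_measurable_fun; exact: continuous_sin.
  exact: measurable_funM.
have fX n w : `|f n w| <= `|X w|.
  rewrite normrM normfV ler_pdivrMr ?normr_gt0// (le_trans (sin_le_norm _))//.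
  by rewrite normrM mulrC.
have fn n : L2 (f n).
  split => //; apply: (@bounded_integrable _ _ _ P _ (`|(a n)^-1| ^+ 2)).
    exact: measurable_funX.
  move=> w; rewrite normrX ler_sqr ?nnegrE// normrM ler_piMl//.
  by rewrite ler_norml sin_geN1 sin_le1.
have fcvg w : f n w @[n --> \oo] --> X w.
  apply: (@is_derive_cvg_seq _ (fun y => sin (y * X w))).
  - apply: is_derive_eq; rewrite /GRing.scale/= mul0r cos0; ring.
  - by rewrite mul0r sin0.
  - exact: a0.
  - exact: cvg_harmonic.
have If n : iprod P (f n) (f n) = (1 - expR (- 2 * v * (a n ^+ 2))) / (2 * a n ^+ 2).
  rewrite /iprod.
  transitivity (\int[P]_w ((1 - cos (2 * a n * X w + 0)) / (2 * a n ^+ 2))).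
    apply: eq_Rintegral => w _.
    have -> : 2 * a n * X w + 0 = 2 * (a n * X w) by ring.
    have E := sin_sqr_half_angle (a n * X w).
    rewrite -[X in X / _](divfK (_ : 2 != 0)) // -E /f.
    by field; exact: a0.
  rewrite RintegralZr//; last first.
    exact: (integrableB measurableT (finite_measure_integrable_cst P 1 measurableT)
      (integrable_cos _ _ mX)).
  rewrite RintegralB//; last first.
  - exact: integrable_cos.
  - exact: finite_measure_integrable_cst.
  rewrite Rintegral_cst// [X in fine X](@probability_setT _ _ _ P) XN cos0 !mulr1.
  by congr ((1 - expR _) / _); field.
have an20 n : a n ^+ 2 != 0 by rewrite expf_neq0.
have Icvg : iprod P (f n) (f n) @[n --> \oo] --> v.
  have := @is_derive_cvg_seq _ (fun b => (1 - expR (- 2 * v * b)) / 2) v (fun n => a n ^+ 2).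
  have -> : (fun n => iprod P (f n) (f n)) =
    (fun n => (1 - expR (- 2 * v * a n ^+ 2)) / 2 / a n ^+ 2).
    by apply/funext => n; rewrite If invfM mulrA.
  apply => //.
  - by apply: is_derive_eq; rewrite /GRing.scale/= mulr0 expR0; field.
  - by rewrite mulr0 expR0 subrr mul0r.
  - rewrite -[X in _ --> X](expr0n _ 2).
    by apply: (cvg_comp _ (fun x : R => x ^+ 2) cvg_harmonic); exact: sqr_continuous.
have fv n : norm2 P (f n) <= Num.sqrt v.
  rewrite norm2_le ?sqrtr_ge0// sqr_sqrtr// If.
  have a2 : 0 < a n ^+ 2 by rewrite lt_def an20 sqr_ge0.
  have a22 : 0 < 2 * a n ^+ 2 by rewrite pmulr_rgt0.
  rewrite ler_pdivrMr//.
  by have := expR_ge1Dx (- 2 * v * a n ^+ 2); lra.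
have [LX _] := norm2_fatou (sqrtr_ge0 v) fn fv fcvg; split => //.
apply: (cvg_unique (@Rhausdorff R) _ Icvg).
apply: (@Rintegral_dominated_cvg _ _ _ P _ _ (fun w => X w ^+ 2)).
- by move=> n; apply: measurable_funM.
- by move=> w; apply: cvgM.
- by case: LX.
- move=> n w; rewrite -expr2 normrX -[X w ^+ 2]real_normK ?num_real//.
  by rewrite ler_sqr ?nnegrE.
Qed.

(** The addition formula for the cosine leaves two products of independent bounded variables; the
    one with sines vanishes by symmetry. *)
Lemma gaussian_cfD (G H : set (set Omega)) v v' X Y :
  measurable_fun setT X -> measurable_fun setT Y ->
  sigma_of X `<=` G -> sigma_of Y `<=` H -> independent P G H ->
  gaussian_cf v X -> gaussian_cf v' Y -> gaussian_cf (v + v') (X + Y).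
Proof.
move=> mX mY XG YH GH XN YN t th.
have cont (f : R -> R) b : continuous f -> measurable_fun setT (fun x : R => f (t * x + b)).
  move=> cf; apply: (@measurableT_comp _ _ _ _ _ _ f).
    exact: continuous_measurable_fun.
  by apply: measurable_funD => //; exact: measurable_funM.
have c1 b x : `|cos (t * x + b)| <= 1 by rewrite ler_norml cos_geN1 cos_le1.
have s1 b x : `|sin (t * x + b)| <= 1 by rewrite ler_norml sin_geN1 sin_le1.
have bi (f g : R -> R) b : continuous f -> continuous g ->
    (forall x, `|f x| <= 1) -> (forall x, `|g x| <= 1) ->
    P.-integrable setT (EFin \o (fun w => f (t * X w + 0) * g (t * Y w + b))).
  move=> cf cg f1 g1; apply: (@bounded_integrable _ _ _ P _ 1).
    apply: measurable_funM; first exact: measurableT_comp (cont f 0 cf) mX.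
    exact: measurableT_comp (cont g b cg) mY.
  by move=> w; rewrite normrM mulr_ile1.
have b1 : forall x, `|cos x : R| <= 1 by move=> x; rewrite ler_norml cos_geN1 cos_le1.
have b2 : forall x, `|sin x : R| <= 1 by move=> x; rewrite ler_norml sin_geN1 sin_le1.
transitivity (\int[P]_w (cos (t * X w + 0) * cos (t * Y w + th)
   - sin (t * X w + 0) * sin (t * Y w + th))).
  apply: eq_Rintegral => w _; rewrite -cosD; congr cos.
  rewrite -[(X + Y) w]/(X w + Y w); ring.
rewrite RintegralB//; last 2 first.
- by apply: bi => //; exact: continuous_cos.
- by apply: bi => //; exact: continuous_sin.
rewrite (independent_prod mX mY XG YH GH (cont cos 0 (@continuous_cos R))
  (cont cos th (@continuous_cos R)) (c1 0) (c1 th)).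
rewrite (independent_prod mX mY XG YH GH (cont sin 0 (@continuous_sin R))
  (cont sin th (@continuous_sin R)) (s1 0) (s1 th)).
(* The characteristic function at phase pi/2 has the factor cos(pi/2) = 0. *)
have -> : \int[P]_w sin (t * X w + 0) = 0.
  have := XN t (pi / 2); rewrite cos_pihalf mulr0.
  under eq_Rintegral do rewrite cosDpihalf -mulN1r.
  rewrite RintegralZl//; last first.
    apply: (@bounded_integrable _ _ _ P _ 1) => //.
    have := cont sin 0 (@continuous_sin R).
    under eq_fun do rewrite addr0.
    by move=> ms; exact: measurableT_comp ms mX.
  under [X in _ -> X = _]eq_Rintegral do rewrite addr0.
  by rewrite mulN1r => /eqP; rewrite oppr_eq0 => /eqP.
rewrite mul0r subr0 XN YN cos0 mulr1 mulrA -expRD.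
by congr (expR _ * _); field.
Qed.

Lemma Rintegral_norm_le X : L2 X -> \int[P]_w `|X w| <= norm2 P X.
Proof.
move=> LX; have LaX : L2 (fun w => `|X w|).
  split; first by apply: measurableT_comp => //; case: LX.
  by have [_] := LX; under eq_fun do rewrite /= -real_normK ?num_real//.
have := le_trans (ler_norm _) (norm2_cauchy_schwarz LaX (square_integrable_cst P 1)).
have -> : norm2 P (cst 1) = 1.
  rewrite /norm2 /iprod; under eq_Rintegral do rewrite mulr1.
  by rewrite Rintegral_cst// [X in fine X](@probability_setT _ _ _ P) mulr1 sqrtr1.
rewrite mulr1 /iprod; under eq_Rintegral do rewrite mulr1.
move=> /le_trans; apply; rewrite /norm2 le_eqVlt; apply/orP; left; apply/eqP.
congr Num.sqrt; apply: eq_Rintegral => w _.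
by rewrite -normrM ger0_norm// -expr2 sqr_ge0.
Qed.

(** Since the cosine is 1-Lipschitz, the mean of cos(t X + th) moves by at most |t| times the L2
    distance, and the variance is continuous for that distance as well. *)
Lemma gaussian_cf_limit X : L2 X ->
  (forall e, 0 < e -> exists Y, [/\ L2 Y, gaussian_cf (iprod P Y Y) Y &
    norm2 P (X - Y) <= e]) ->
  gaussian_cf (iprod P X X) X.
Proof.
move=> LX approx t th.
have /choice[Y YP] : forall n, exists Y, [/\ L2 Y, gaussian_cf (iprod P Y Y) Y &
    norm2 P (X - Y) <= harmonic n].
  by move=> n; apply: approx; rewrite /harmonic/= invr_gt0.
have LY n : L2 (Y n) by case: (YP n).
have h0 : harmonic n @[n --> \oo] --> (0 : R) by exact: cvg_harmonic.
have nY : norm2 P (Y n) @[n --> \oo] --> norm2 P X.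
  apply/cvgrPdist_le => e e0; move/cvgrPdist_le/(_ e e0) : h0.
  apply: filterS => n; rewrite sub0r normrN; apply: le_trans.
  have [_ _ XY] := YP n.
  rewrite [leRHS]ger0_norm; last exact: le_trans (norm2_ge0 _ _) XY.
  apply: le_trans XY; rewrite ler_norml; apply/andP; split.
    have := norm2D (square_integrableB (LY n) LX) LX.
    by rewrite subrK (norm2_distC (LY n) LX); lra.
  have := norm2D (square_integrableB LX (LY n)) (LY n).
  by rewrite subrK; lra.
have c1 : \int[P]_w cos (t * Y n w + th) @[n --> \oo] --> \int[P]_w cos (t * X w + th).
  apply/cvgrPdist_le => e e0.
  have e1 : 0 < e / (`|t| + 1) by rewrite divr_gt0// ltr_wpDl.
  move/cvgrPdist_le/(_ _ e1) : h0.
  apply: filterS => n; rewrite sub0r normrN => hn.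
  have [_ _ XY] := YP n; have {hn} XY := le_trans XY (le_trans (ler_norm _) hn).
  have LXY := square_integrableB LX (LY n).
  have iX := integrable_cos t th LX.1; have iY := integrable_cos t th (LY n).1.
  rewrite -RintegralB//.
  have i1 : P.-integrable setT (EFin \o (fun w => cos (t * X w + th) - cos (t * Y n w + th))).
    exact: (integrableB measurableT iX iY).
  have i2 := integrable_norm (square_integrable_integrable LXY).
  apply: le_trans (le_normr_Rintegral measurableT i1) _.
  apply: (@le_trans _ _ (\int[P]_w (`|t| * `|(X - Y n) w|))).
    apply: le_Rintegral => //.
    - exact: integrable_norm i1.
    - exact: (integrableZl measurableT `|t| i2).
    - move=> w _; apply: le_trans (cos_lipschitz _ _) _.
      rewrite -normrM le_eqVlt; apply/orP; left; apply/eqP; congr `|_|.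
      rewrite -[(X - Y n) w]/(X w - Y n w); ring.
  rewrite RintegralZl//.
  apply: (@le_trans _ _ (`|t| * (e / (`|t| + 1)))).
    by rewrite ler_wpM2l// (le_trans (Rintegral_norm_le LXY)).
  by rewrite mulrA ler_pdivrMr ?ltr_wpDl// mulrC ler_wpM2l ?(ltW e0)// lerDl.
have c2 : \int[P]_w cos (t * Y n w + th) @[n --> \oo] -->
    expR (- t ^+ 2 * iprod P X X / 2) * cos th.
  have -> : (fun n => \int[P]_w cos (t * Y n w + th)) =
    (fun n => expR (- t ^+ 2 * norm2 P (Y n) ^+ 2 / 2) * cos th).
    by apply/funext => n; have [_ -> _] := YP n; rewrite norm2_sqr.
  rewrite -norm2_sqr; apply: cvgM; last exact: cvg_cst.
  apply: (@cvg_comp _ _ _ (fun n => - t ^+ 2 * norm2 P (Y n) ^+ 2 / 2) expR);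
    last exact: continuous_expR.
  apply: cvgM; last exact: cvg_cst.
  apply: cvgM; first exact: cvg_cst.
  by apply: (cvg_comp _ (fun x : R => x ^+ 2) nY); exact: sqr_continuous.
exact: (cvg_unique (@Rhausdorff R) c1 c2).
Qed.

End GaussianVariables.

(** * From factorised cosines to independence *)

Section IndependenceFromCosines.
Context {d : measure_display} {Omega : measurableType d} {R : realType}.
Variable P : probability Omega R.
Implicit Types (X Y : Omega -> R) (v t th : R).

Lemma Rintegral_preimage_indic X phi (A : set R) :
  \int[P]_(w in X @^-1` A) phi w = \int[P]_w (phi w * (\1_A (X w) : R)).
Proof.
rewrite Rintegral_mkcond; apply: eq_Rintegral => w _.
rewrite patchE indicE; case: ifPn; rewrite ?inE ?notin_setE => Xb.
  by rewrite mem_set// mulr1.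
by rewrite memNset// mulr0.
Qed.

Lemma Rintegral_indic (A : set Omega) : measurable A ->
  (\int[P]_w (\1_A w : R))%:E = P A.
Proof.
move=> mA; rewrite /Rintegral integral_indic// setIT fineK//.
exact: fin_num_measure.
Qed.

Variables (V : set (Omega -> R)) (Z : Omega -> R).
Hypotheses (V0 : V 0) (mV : forall Y, V Y -> measurable_fun setT Y).
Hypothesis VD : forall Y Y' t, V Y -> V Y' -> V (Y + cst t * Y').
Hypothesis mZ : measurable_fun setT Z.
Hypothesis cosZV : forall xi eta th Y, V Y ->
  \int[P]_w (cos (Y w + th) * cos (xi * Z w + eta)) =
  \int[P]_w cos (Y w + th) * \int[P]_w cos (xi * Z w + eta).

Let indl (l : seq ((Omega -> R) * set R)) w : R :=
  \prod_(x <- l) \1_(x.2) (x.1 w).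

Let good_list (l : seq ((Omega -> R) * set R)) :=
  forall x, List.In x l -> V x.1 /\ measurable x.2.

Let mindl l : good_list l -> measurable_fun setT (indl l).
Proof.
elim: l => [_|x l IH gl]; rewrite /indl.
  by under eq_fun do rewrite big_nil; exact: measurable_cst.
under eq_fun do rewrite big_cons.
have [Vx mx] := gl x (or_introl erefl).
apply: measurable_funM; last by apply: IH => y yl; apply: gl; right.
by apply: measurableT_comp (mV Vx); exact: measurable_indic.
Qed.

Let indl1 l w : `|indl l w| <= 1.
Proof.
rewrite /indl normr_prod; apply: prodr_ile1 => x _.
by rewrite normr_ge0/= indicE; case: (_ \in _); rewrite ?normr1 ?normr0.
Qed.

Let mcosY Y th : V Y -> measurable_fun setT (fun w => cos (Y w + th)).
Proof.
move=> VY; have := measurable_cos_affine 1 th (mV VY).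
by under eq_fun do rewrite mul1r.
Qed.

Let c1 (x : R) : `|cos x| <= 1.
Proof. by rewrite ler_norml cos_geN1 cos_le1. Qed.

(** Cosines are traded for indicators one variable at a time, by induction on the list. A free
    factor [cos (Y w + th)] is carried along: to adjoin the event that [x.1] lies in [x.2], a cosine
    of [x.1] is merged into the free one by the product-to-sum formula, [V] being stable under
    combinations, and [fourier_uniqueness] then replaces it by the indicator of [x.2]. *)
Let key (B : set R) l : measurable B -> good_list l -> forall Y th, V Y ->
  \int[P]_w (indl l w * cos (Y w + th) * (\1_B (Z w) : R)) =
  \int[P]_w (indl l w * cos (Y w + th)) * \int[P]_w (\1_B (Z w) : R).
Proof.
move=> mB; pose pB := \int[P]_w (\1_B (Z w) : R).
have m1B : measurable_fun setT (fun w => \1_B (Z w) : R).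
  by apply: measurableT_comp mZ; exact: measurable_indic.
have i1B : P.-integrable setT (EFin \o (fun w => \1_B (Z w) : R)).
  apply: (@bounded_integrable _ _ _ P _ 1) => // w.
  by rewrite indicE; case: (_ \in _); rewrite ?normr1 ?normr0.
elim: l => [_|x l IH gl] Y th VY.
  pose c := \int[P]_w cos (Y w + th).
  have ic : P.-integrable setT (EFin \o (fun w => cos (Y w + th))).
    by apply: (@bounded_integrable _ _ _ P _ 1) => //; exact: mcosY.
  have ce : `|c| <= 1.
    apply: le_trans (le_normr_Rintegral measurableT ic) _.
    have -> : 1 = \int[P]_w 1 :> R.
      by rewrite Rintegral_cst// [X in fine X](@probability_setT _ _ _ P) mulr1.
    apply: le_Rintegral => //; first exact: integrable_norm ic.
    exact: finite_measure_integrable_cst.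
  (* Base case: the weights [cos (Y w + th)] and its mean [c] give [Z] the same transform by
     [cosZV], hence the same integral over the event that [Z] lies in [B]. *)
  have := @fourier_uniqueness _ _ _ _ R P Z (fun w => cos (Y w + th)) P Z (cst c) 1
    mZ (mcosY th VY) mZ (measurable_cst _) (fun _ => c1 _) (fun _ => ce).
  move=> /(_ _ B mB).
  rewrite !Rintegral_preimage_indic RintegralZl// => H.
  under eq_Rintegral do rewrite /indl big_nil mul1r.
  rewrite H.
    by congr (_ * _); apply: eq_Rintegral => w _; rewrite /indl big_nil mul1r.
  move=> xi eta; rewrite /weighted_cos cosZV// RintegralZl//.
  exact: integrable_cos.
have [Vx mx] := gl x (or_introl erefl).
have gl' : good_list l by move=> y yl; apply: gl; right.
pose f w := indl l w * cos (Y w + th).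
have mf : measurable_fun setT f by apply: measurable_funM; [exact: mindl|exact: mcosY].
have f1 w : `|f w| <= 1 by rewrite normrM mulr_ile1.
pose g w := f w * (\1_B (Z w) : R).
have mg : measurable_fun setT g by exact: measurable_funM.
have B1 w : `|\1_B (Z w) : R| <= 1.
  by rewrite indicE; case: (_ \in _); rewrite ?normr1 ?normr0.
have g1 w : `|g w| <= 1 by rewrite normrM mulr_ile1.
have pB1 : `|pB| <= 1.
  apply: le_trans (le_normr_Rintegral measurableT i1B) _.
  have -> : 1 = \int[P]_w 1 :> R.
    by rewrite Rintegral_cst// [X in fine X](@probability_setT _ _ _ P) mulr1.
  apply: le_Rintegral => //; first exact: integrable_norm i1B.
  exact: finite_measure_integrable_cst.
have mfp : measurable_fun setT (fun w => f w * pB) by exact: measurable_funM.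
have fp1 w : `|f w * pB| <= 1 by rewrite normrM mulr_ile1.
have := @fourier_uniqueness _ _ _ _ R P x.1 g P x.1 (fun w => f w * pB) 1
    (mV Vx) mg (mV Vx) mfp g1 fp1.
move=> /(_ _ x.2 mx).
rewrite !Rintegral_preimage_indic => H.
have ifx : P.-integrable setT (EFin \o (fun w => indl (x :: l) w * cos (Y w + th))).
  apply: (@bounded_integrable _ _ _ P _ 1).
    by apply: measurable_funM; [exact: mindl|exact: mcosY].
  by move=> w; rewrite normrM mulr_ile1.
have -> : \int[P]_w (indl (x :: l) w * cos (Y w + th) * (\1_B (Z w) : R)) =
    \int[P]_w (g w * \1_(x.2) (x.1 w)).
  by apply: eq_Rintegral => w _; rewrite /g /f /indl big_cons; ring.
rewrite -/pB -RintegralZr// H.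
  by apply: eq_Rintegral => w _; rewrite /f /indl big_cons; ring.
move=> t eta; rewrite /weighted_cos.
have VYp r : V (Y + cst r * x.1) by exact: VD.
have prodE w : cos (Y w + th) * cos (t * x.1 w + eta) =
    2^-1 * (cos ((Y + cst t * x.1) w + (th + eta)) +
            cos ((Y + cst (- t) * x.1) w + (th - eta))).
  rewrite -[(Y + cst t * x.1) w]/(Y w + t * x.1 w).
  rewrite -[(Y + cst (- t) * x.1) w]/(Y w + - t * x.1 w).
  have -> : Y w + t * x.1 w + (th + eta) = (Y w + th) + (t * x.1 w + eta) by ring.
  have -> : Y w + - t * x.1 w + (th - eta) = (Y w + th) - (t * x.1 w + eta) by ring.
  by set a := Y w + th; set b := t * _ + eta; rewrite cosD cosB; field.
have ii r th' : P.-integrable setT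
    (EFin \o (fun w => indl l w * cos ((Y + cst r * x.1) w + th'))).
  apply: (@bounded_integrable _ _ _ P _ 1).
    by apply: measurable_funM; [exact: mindl|exact: mcosY].
  by move=> w; rewrite normrM mulr_ile1.
have iiB r th' : P.-integrable setT
    (EFin \o (fun w => indl l w * cos ((Y + cst r * x.1) w + th') * (\1_B (Z w) : R))).
  apply: (@bounded_integrable _ _ _ P _ 1).
    by apply: measurable_funM => //; apply: measurable_funM; [exact: mindl|exact: mcosY].
  by move=> w; rewrite normrM mulr_ile1// normrM mulr_ile1.
transitivity (2^-1 * (
   \int[P]_w (indl l w * cos ((Y + cst t * x.1) w + (th + eta)) * (\1_B (Z w) : R)) +
   \int[P]_w (indl l w * cos ((Y + cst (- t) * x.1) w + (th - eta)) * (\1_B (Z w) : R)))).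
  rewrite -RintegralD// -RintegralZl//; last exact: (integrableD measurableT (iiB _ _) (iiB _ _)).
  apply: eq_Rintegral => w _.
  transitivity (indl l w * (cos (Y w + th) * cos (t * x.1 w + eta)) * \1_B (Z w)).
    by rewrite /g /f; ring.
  by rewrite prodE; ring.
have i2 := integrableD measurableT (ii t (th + eta)) (ii (- t) (th - eta)).
have i3 := integrableZl measurableT 2^-1 i2.
rewrite !IH// -/pB -mulrDl mulrA -(RintegralD measurableT (ii _ _) (ii _ _)).
rewrite -(RintegralZl _ measurableT i2) -(RintegralZr _ measurableT i3).
apply: eq_Rintegral => w _.
transitivity (indl l w * (cos (Y w + th) * cos (t * x.1 w + eta)) * pB).
  by rewrite prodE; ring.
by rewrite /f; ring.
Qed.

Let list_event (l : seq ((Omega -> R) * set R)) :=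
  [set w | forall x, List.In x l -> x.2 (x.1 w)].

Let indl_event l w : indl l w = \1_(list_event l) w.
Proof.
elim: l => [|x l IH].
  by rewrite /indl big_nil indicE mem_set.
rewrite /indl big_cons -/(indl l w) IH !indicE -natrM mulnb; congr (_%:R); congr nat_of_bool.
apply/idP/idP => [/andP[]|]; rewrite !inE.
  by move=> xw lw y [<-//|]; exact: lw.
by move=> H; apply/andP; rewrite !inE; split;
  [apply: H; left|move=> y yl; apply: H; right].
Qed.

Let measurable_list_event l : good_list l -> measurable (list_event l).
Proof.
elim: l => [_|x l IH gl].
  by rewrite (_ : list_event _ = setT)// predeqE => w; split => // _ x [].
have -> : list_event (x :: l) = x.1 @^-1` x.2 `&` list_event l.
  rewrite predeqE => w; split => [H|[xw lw] y [<-//|]]; last exact: lw.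
  by split; [apply: H; left|move=> y yl; apply: H; right].
have [Vx mx] := gl x (or_introl erefl).
apply: measurableI; last by apply: IH => y yl; apply: gl; right.
by rewrite -[X in measurable X]setTI; exact: (mV Vx).
Qed.

Let independent_list (B : set R) l : measurable B -> good_list l ->
  P (list_event l `&` Z @^-1` B) = (P (list_event l) * P (Z @^-1` B))%E.
Proof.
move=> mB gl; have ml := measurable_list_event gl.
have mZB : measurable (Z @^-1` B) by rewrite -[X in measurable X]setTI; exact: mZ.
have K := key mB gl 0 V0.
have E w : indl l w * cos ((0 : Omega -> R) w + 0) = \1_(list_event l) w.
  by rewrite indl_event addr0 cos0 mulr1.
rewrite -!Rintegral_indic//; last exact: measurableI.
rewrite -EFinM; congr EFin.
transitivity (\int[P]_w (indl l w * cos ((0 : Omega -> R) w + 0) * (\1_B (Z w) : R))).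
  by apply: eq_Rintegral => w _; rewrite E indicI.
by rewrite K; congr (_ * _); apply: eq_Rintegral => w _; rewrite E.
Qed.

Let eq_off_null (A A' N : set Omega) : measurable A -> measurable A' ->
  measurable N -> P N = 0%E -> A `\` N = A' `\` N -> P A = P A'.
Proof.
move=> mA mA' mN PN E.
have H C : measurable C -> P C = P (C `\` N).
  move=> mC; rewrite (measureDI P mC mN).
  rewrite [X in (_ + X)%E](_ : _ = 0%E) ?adde0//.
  by apply: (subset_measure0 _ mN) => //; exact: measurableI.
by rewrite H// E -H.
Qed.

(** A pi-lambda argument. Asking that the events of [F] be list events only off a null set
    accommodates a completed filtration, whose null sets need not be events of the variables in [V];
    the class [G] of such events is still stable under intersection. *)
Lemma independent_of_cos (F : set (set Omega)) :
  (forall A, F A -> measurable A /\ exists l N, [/\ good_list l, measurable N, P N = 0%E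
    & A `\` N = list_event l `\` N]) ->
  independent P <<s F >> (sigma_of Z).
Proof.
move=> FA A _ sFA [B mB <-]; rewrite setTI.
have mZB : measurable (Z @^-1` B) by rewrite -[X in measurable X]setTI; exact: mZ.
pose G := [set A | measurable A /\ exists l N, [/\ good_list l, measurable N, P N = 0%E
    & A `\` N = list_event l `\` N]].
pose H := [set A | measurable A /\ P (A `&` Z @^-1` B) = (P A * P (Z @^-1` B))%E].
have FG : F `<=` G by exact: FA.
have sG : <<s F >> `<=` <<s G >> by exact: sub_smallest2r.
suff: <<s G >> `<=` H by move=> /(_ _ (sG _ sFA)) [].
apply: lambda_system_subset => //.
- move=> A1 A2 [mA1 [l1 [N1 [gl1 mN1 PN1 E1]]]] [mA2 [l2 [N2 [gl2 mN2 PN2 E2]]]].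
  split; first exact: measurableI.
  exists (l1 ++ l2), (N1 `|` N2); split.
  + by move=> x /(@List.in_app_or _ l1 l2)[]; [exact: gl1|exact: gl2].
  + exact: measurableU.
  + by rewrite measureU0.
  + rewrite predeqE => w; split.
    * move=> [[A1w A2w] nN]; split => //.
      have N1w : ~ N1 w by move=> n; apply: nN; left.
      have N2w : ~ N2 w by move=> n; apply: nN; right.
      have [l1w _] : (list_event l1 `\` N1) w by rewrite -E1.
      have [l2w _] : (list_event l2 `\` N2) w by rewrite -E2.
      by move=> x /(@List.in_app_or _ l1 l2)[]; [exact: l1w|exact: l2w].
    * move=> [lw nN]; split => //.
      have N1w : ~ N1 w by move=> n; apply: nN; left.
      have N2w : ~ N2 w by move=> n; apply: nN; right.
      have [A1w _] : (A1 `\` N1) w.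
        by rewrite E1; split => // x xl; apply: lw; apply: List.in_or_app; left.
      have [A2w _] : (A2 `\` N2) w.
        by rewrite E2; split => // x xl; apply: lw; apply: List.in_or_app; right.
      by [].
- apply/dynkin_lambda_system; split => //.
  + by split => //; rewrite setTI [X in (X * _)%E](@probability_setT _ _ _ P) mul1e.
  + move=> A1 [mA1 E1]; split; first exact: measurableC.
    rewrite setIC -setDE measureD//; last by rewrite ltey_eq fin_num_measure.
    rewrite [X in (_ - P X)%E](_ : _ = A1 `&` Z @^-1` B) ?E1 ?probability_setC//; last first.
      by rewrite setIC.
    rewrite muleBl ?mul1e ?fin_num_measure// fin_num_adde_defr// fin_numN fin_num_measure//.
  + move=> A_ tA mA; split; first by apply: bigcup_measurable => k _; case: (mA k).
    rewrite setI_bigcupl !measure_bigcup//.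
    + rewrite muleC -[P (Z @^-1` B)]fineK ?fin_num_measure// -nneseriesZl//.
      by apply: eq_eseriesr => k _; case: (mA k) => _ E1; rewrite [LHS]E1 muleC fineK ?fin_num_measure.
    + by move=> k _; case: (mA k).
    + by move=> k _; apply: measurableI => //; case: (mA k).
    + by apply: trivIset_setIr.
- move=> A1 [mA1 [l [N [gl mN PN E]]]]; split => //.
  have ml := measurable_list_event gl.
  rewrite (eq_off_null mA1 ml mN PN E) -independent_list//.
  apply: (eq_off_null _ _ mN PN); [exact: measurableI..|].
  have Ew w : (A1 `\` N) w = (list_event l `\` N) w by rewrite E.
  rewrite predeqE => w; split => -[[h Bw] nN].
    by have [] : (list_event l `\` N) w by rewrite -Ew.
  by have [] : (A1 `\` N) w by rewrite Ew.
Qed.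

End IndependenceFromCosines.

(** * Gaussian spaces *)

Section GaussianSpace.
Context {d : measure_display} {Omega : measurableType d} {R : realType}.
Variable P : probability Omega R.
Implicit Types (X Y Z : Omega -> R) (H : set (Omega -> R)).
Local Notation L2 := (square_integrable P).

Definition gaussian X := L2 X /\ gaussian_cf P (iprod P X X) X.

Definition linear_space H := H 0 /\ forall Y Y' t, H Y -> H Y' -> H (Y + cst t * Y').

Definition L2_closure H X :=
  L2 X /\ forall e, 0 < e -> exists Y, H Y /\ norm2 P (X - Y) <= e.

Definition gaussian_space H :=
  [/\ linear_space H, H `<=` gaussian & L2_closure H `<=` H].

(** Gaussian laws survive L2 limits by [gaussian_cf_limit]. The closure is what lets path integrals,
    as limits of Riemann sums, stay in the space. *)
Lemma L2_closure_gaussian_space H : linear_space H -> H `<=` gaussian ->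
  gaussian_space (L2_closure H).
Proof.
move=> [H0 HD] Hg.
have HL Y : H Y -> L2 Y by move=> /Hg[].
split.
- split.
    split; first exact: square_integrable_cst.
    by move=> e e0; exists 0; split => //; rewrite subrr norm20 ltW.
  move=> Y Y' t [LY aY] [LY' aY'].
  have LtY' := square_integrableZ t LY'.
  split; first exact: square_integrableD.
  move=> e e0.
  have [Z [HZ YZ]] := aY (e / 2) (divr_gt0 e0 (ltr0Sn _ 1)).
  have e1 : 0 < e / 2 / (`|t| + 1) by rewrite !divr_gt0// ltr_wpDl.
  have [Z' [HZ' YZ']] := aY' _ e1.
  exists (Z + cst t * Z'); split; first exact: HD.
  have LZ := HL _ HZ; have LZ' := HL _ HZ'.
  have -> : Y + cst t * Y' - (Z + cst t * Z') = (Y - Z) + cst t * (Y' - Z').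
    by rewrite mulrBr opprD addrACA.
  apply: le_trans (norm2D _ _) _; first exact: square_integrableB.
    by apply: square_integrableZ; exact: square_integrableB.
  rewrite norm2Z; last exact: square_integrableB.
  rewrite (splitr e) lerD//.
  apply: (@le_trans _ _ (`|t| * (e / 2 / (`|t| + 1)))); first by rewrite ler_wpM2l.
  rewrite mulrA ler_pdivrMr ?ltr_wpDl// mulrC ler_wpM2l ?lerDl//.
  by rewrite divr_ge0// ltW.
- move=> X [LX aX]; split => //; apply: gaussian_cf_limit => // e e0.
  by have [Y [/Hg[LY YN] XY]] := aX e e0; exists Y.
- move=> X [LX aX]; split => // e e0.
  have e2 : 0 < e / 2 by rewrite divr_gt0.
  have [Y [[LY aY] XY]] := aX _ e2; have [Z [HZ YZ]] := aY _ e2.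
  exists Z; split => //; have LZ := HL _ HZ.
  rewrite -(subrKA Y) (splitr e); apply: le_trans (norm2D _ _) _;
    [exact: square_integrableB..|exact: lerD].
Qed.

Section Theory.
Variable H : set (Omega -> R).
Hypothesis HG : gaussian_space H.

Lemma gspace_square_integrable X : H X -> L2 X.
Proof. by have [_ Hg _] := HG; move=> /Hg[]. Qed.

Lemma gspace_cf X : H X -> gaussian_cf P (iprod P X X) X.
Proof. by have [_ Hg _] := HG; move=> /Hg[]. Qed.

Lemma gspace0 : H 0. Proof. by have [[]] := HG. Qed.

Lemma gspace_lin X Y t : H X -> H Y -> H (X + cst t * Y).
Proof. by have [[_ +] _ _] := HG; exact. Qed.

Lemma gspaceD X Y : H X -> H Y -> H (X + Y).
Proof.
move=> HX HY; have := gspace_lin 1 HX HY.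
by rewrite (_ : cst 1 * Y = Y)// funeqE => w; rewrite fctE mul1r.
Qed.

Lemma gspaceZ X t : H X -> H (cst t * X).
Proof. by move=> HX; rewrite -[_ * _]add0r; exact: gspace_lin gspace0 HX. Qed.

Lemma gspaceB X Y : H X -> H Y -> H (X - Y).
Proof.
move=> HX HY; have := gspace_lin (-1) HX HY.
by rewrite (_ : cst (-1) * Y = - Y)// funeqE => w; rewrite !fctE mulN1r.
Qed.

Lemma gspace_sum (I : Type) (r : seq I) (Q : pred I) (F : I -> Omega -> R) :
  (forall i, Q i -> H (F i)) -> H (\sum_(i <- r | Q i) F i).
Proof.
move=> HF; elim/big_rec : _ => [|i X Qi HX]; first exact: gspace0.
by apply: gspaceD => //; exact: HF.
Qed.

Lemma gspace_limit X : L2 X ->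
  (forall e, 0 < e -> exists Y, H Y /\ norm2 P (X - Y) <= e) -> H X.
Proof. by have [_ _ +] := HG; move=> clH LX aX; exact: clH. Qed.

(** The product of cosines is half the sum of the cosines of Y + xi Z and Y - xi Z. Both lie in the
    space, and by orthogonality both have variance E[Y^2] + xi^2 E[Z^2]; the exponentials therefore
    factor out and the phases recombine. *)
Lemma gspace_cos_orthogonal Z Y xi eta th : H Z -> H Y -> iprod P Z Y = 0 ->
  \int[P]_w (cos (Y w + th) * cos (xi * Z w + eta)) =
  \int[P]_w cos (Y w + th) * \int[P]_w cos (xi * Z w + eta).
Proof.
move=> HZ HY ZY; have LZ := gspace_square_integrable HZ.
have LY := gspace_square_integrable HY.
have LrZ r := square_integrableZ r LZ.
have cf r th' : \int[P]_w cos ((Y + cst r * Z) w + th') =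
    expR (- (iprod P Y Y + r ^+ 2 * iprod P Z Z) / 2) * cos th'.
  have := gspace_cf (gspace_lin r HY HZ) 1 th'.
  under eq_Rintegral do rewrite mul1r.
  move=> ->; congr (expR _ * _).
  rewrite iprodDl// ?iprodDr// ?iprodZl// ?iprodZr//; last exact: square_integrableD.
  by rewrite (iprodC P Y Z) ZY; field.
have icos r th' : P.-integrable setT (EFin \o (fun w => cos ((Y + cst r * Z) w + th'))).
  have := integrable_cos P 1 th' (gspace_square_integrable (gspace_lin r HY HZ)).1.
  by apply: eq_integrable => // w _; rewrite /= mul1r.
transitivity (\int[P]_w (2^-1 * (cos ((Y + cst xi * Z) w + (th + eta)) +
    cos ((Y + cst (- xi) * Z) w + (th - eta))))).
  apply: eq_Rintegral => w _.
  rewrite -[(Y + cst xi * Z) w]/(Y w + xi * Z w).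
  rewrite -[(Y + cst (- xi) * Z) w]/(Y w + - xi * Z w).
  have -> : Y w + xi * Z w + (th + eta) = (Y w + th) + (xi * Z w + eta) by ring.
  have -> : Y w + - xi * Z w + (th - eta) = (Y w + th) - (xi * Z w + eta) by ring.
  by set a := Y w + th; set b := xi * _ + eta; rewrite cosD cosB; field.
rewrite RintegralZl//; last exact: (integrableD measurableT (icos _ _) (icos _ _)).
rewrite (RintegralD measurableT (icos _ _) (icos _ _)) !cf sqrrN.
rewrite (gspace_cf HZ).
have := cf 0 th; rewrite (_ : Y + cst 0 * Z = Y); last first.
  by rewrite funeqE => w; rewrite !fctE mul0r addr0.
move=> ->; rewrite expr0n/= mul0r addr0 cosD cosB.
have -> : - (iprod P Y Y + xi ^+ 2 * iprod P Z Z) / 2 =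
  - iprod P Y Y / 2 + - xi ^+ 2 * iprod P Z Z / 2 by field.
by rewrite expRD; field.
Qed.

Lemma gspace_law X : H X -> 0 < iprod P X X -> forall Y : set R, measurable Y ->
  P (X @^-1` Y) = normal_prob 0 (Num.sqrt (iprod P X X)) Y.
Proof.
move=> HX X0; apply: law_of_gaussian_cf => //; last exact: gspace_cf.
by have [] := gspace_square_integrable HX.
Qed.

(* Each generator of the completed filtration coincides, off a null set, with
   an event determined by the part of the space orthogonal to [Z]. *)
Lemma gspace_independent (X X' : R -> Omega -> R) (N : set Omega) Z t :
  measurable N -> P N = 0%E -> (forall s, 0 <= s <= t -> measurable_fun setT (X s)) ->
  (forall s w, 0 <= s <= t -> ~ N w -> X s w = X' s w) ->
  (forall s, 0 <= s <= t -> H (X' s)) -> H Z ->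
  (forall s, 0 <= s <= t -> iprod P Z (X' s) = 0) ->
  independent P (natural_filtration P X t) (sigma_of Z).
Proof.
move=> mN PN mX XX' HX' HZ ZX'.
pose V := [set Y | H Y /\ iprod P Z Y = 0].
have LZ := gspace_square_integrable HZ.
apply: (@independent_of_cos _ _ _ P V Z).
- by split; [exact: gspace0|rewrite iprodC iprod0l].
- by move=> Y [/gspace_square_integrable []].
- move=> Y Y' r [HY ZY] [HY' ZY']; split; first exact: gspace_lin.
  have LY := gspace_square_integrable HY; have LY' := gspace_square_integrable HY'.
  rewrite iprodDr//; last exact: square_integrableZ.
  by rewrite iprodZr// ZY ZY' mulr0 addr0.
- by case: LZ.
- by move=> xi eta th Y [HY ZY]; exact: gspace_cos_orthogonal.
- move=> A [[s]|[mA PA]].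
    rewrite /= in_itv/= => st [C mC <-]; split.
      by apply: mX.
    exists [:: (X' s, C)], N; split => //.
      move=> x [<-|//]; split => //; split; [exact: HX'|exact: ZX'].
    rewrite setTI predeqE => w; split => -[] /=.
      by move=> Xw Nw; split => // x [<-|//]; rewrite /= -XX'.
    by move=> H1 Nw; split => //; rewrite XX'//; exact: (H1 (X' s, C) (or_introl erefl)).
  split => //; exists [:: (0, set0)], A; split => //.
    move=> x [<-|//]; split; last exact: measurable0.
    by split; [exact: gspace0|rewrite iprodC iprod0l].
  rewrite predeqE => w; split => -[] //=.
  by move=> H1 _; have := H1 (0, set0) (or_introl erefl).
Qed.

End Theory.
End GaussianSpace.

(** * The bridge as a Gaussian process *)

Section BrownianGaussian.
Context {d : measure_display} {Omega : measurableType d} {R : realType}.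
Variable P : probability Omega R.
Implicit Types (X Y Z : R -> Omega -> R).

Lemma sigma_of_measurable (f : Omega -> R) (G : set (set Omega)) :
  measurable_fun setT (f : g_sigma_algebraType G -> R) <-> sigma_of f `<=` <<s G >>.
Proof.
split=> [mf _ [B mB <-]|fG]; first exact: mf.
by move=> _ B mB; apply: fG; exists B.
Qed.

Lemma sigma_of_comp (Z : Omega -> R) (f : R -> R) : measurable_fun setT f ->
  sigma_of (f \o Z) `<=` sigma_of Z.
Proof.
move=> mf _ [B mB <-]; exists (f @^-1` B); last by rewrite !setTI.
by rewrite -[X in measurable X]setTI; exact: mf.
Qed.

Lemma gaussian_cf_ae v (X Y : Omega -> R) (N : set Omega) :
  measurable N -> P N = 0%E -> measurable_fun setT X -> measurable_fun setT Y ->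
  (forall w, ~ N w -> X w = Y w) -> gaussian_cf P v X -> gaussian_cf P v Y.
Proof.
move=> mN PN mX mY XY XN t th; rewrite -XN /Rintegral; congr fine.
apply: ae_eq_integral => //.
- by apply/measurable_EFinP; exact: measurable_cos_affine.
- by apply/measurable_EFinP; exact: measurable_cos_affine.
exists N; split => // w /= nE; apply: contrapT => Nw; apply: nE => _.
by rewrite XY.
Qed.

Lemma gaussian_cf0 : gaussian_cf P 0 0.
Proof.
move=> t th; under eq_Rintegral do rewrite mulr0 add0r.
by rewrite Rintegral_cst// [X in fine X](@probability_setT _ _ _ P) mulr0 mul0r expR0 mul1r mulr1.
Qed.

Lemma gaussian_cfZ v c (X : Omega -> R) :
  gaussian_cf P v X -> gaussian_cf P (c ^+ 2 * v) (cst c * X).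
Proof.
move=> XN t th; have := XN (t * c) th.
under eq_Rintegral do rewrite -mulrA.
by move=> ->; congr (expR _ * _); rewrite exprMn; field.
Qed.

Definition combination X (l : seq (R * R)) : Omega -> R :=
  \sum_(x <- l) cst x.1 * X x.2.

Lemma combination_cons X x l :
  combination X (x :: l) = cst x.1 * X x.2 + combination X l.
Proof. by rewrite /combination big_cons. Qed.

Lemma combination_raw X (t : R) l : (forall x, x \in l -> 0 <= x.2 <= t) ->
  sigma_of (combination X l) `<=` raw_natural_filtration X t.
Proof.
move=> lt; apply/sigma_of_measurable; set G := \bigcup_(s in _) _.
elim: l lt => [|x l IH] lt.
  by rewrite /combination big_nil; exact: measurable_cst.
rewrite combination_cons; apply: measurable_funD; last first.
  by apply: IH => y yl; apply: lt; rewrite inE yl orbT.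
apply: measurable_funM => //; apply/sigma_of_measurable => A HA.
apply: sub_sigma_algebra; exists x.2 => //=.
by rewrite in_itv/=; apply: lt; rewrite inE eqxx.
Qed.

Section OneProcess.
Variables (T : R) (X : R -> Omega -> R).
Hypothesis T0 : 0 < T.
Hypothesis BX : standard_brownian_motion P `[0, T] X.

Let mX t : 0 <= t <= T -> measurable_fun setT (X t).
Proof. by move=> tT; case: BX => + _ _ _ _; apply; rewrite /= in_itv. Qed.

Lemma combination_measurable l : (forall x, x \in l -> 0 <= x.2 <= T) ->
  measurable_fun setT (combination X l).
Proof.
elim: l => [|x l IH] lt; first by rewrite /combination big_nil; exact: measurable_cst.
rewrite combination_cons; apply: measurable_funD; last first.
  by apply: IH => y yl; apply: lt; rewrite inE yl orbT.
by apply: measurable_funM => //; apply: mX; apply: lt; rewrite inE eqxx.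
Qed.

Lemma brownian_increment_cf s t : 0 <= s <= t -> t <= T ->
  gaussian_cf P (t - s) (X t - X s).
Proof.
move=> /andP[s0 st] tT; move: st; rewrite le_eqVlt => /predU1P[<-|st].
  by rewrite !subrr; exact: gaussian_cf0.
have Is : `[0, T]%classic s by rewrite /= in_itv/= s0 ltW// (lt_le_trans st).
have It : `[0, T]%classic t by rewrite /= in_itv/= tT andbT ltW// (le_lt_trans s0).
case: BX => _ _ _ /(_ _ _ Is It st)[_ law] _.
have -> : t - s = Num.sqrt (t - s) ^+ 2 by rewrite sqr_sqrtr// subr_ge0 ltW.
apply: gaussian_cf_of_law => //; first by rewrite sqrtr_gt0 subr_gt0.
by apply: measurable_funB; apply: mX.
Qed.

Lemma brownian_null0 : exists N, [/\ measurable N, P N = 0%E & forall w, ~ N w -> X 0 w = 0].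
Proof.
case: BX => _ _ [N [mN PN sN]] _ _; exists N; split => // w Nw.
by apply: contrapT => Xw; apply: Nw; exact: sN.
Qed.

(** With times in decreasing order, c X_t + c' X_s = (c + c') X_s + c (X_t - X_s), where the
    increment is independent of everything up to [s]. The remaining list is one shorter but has a
    modified head, hence the induction on the size. *)
Let combination_sorted_cf n l : size l = n ->
  sorted (fun x y : R * R => y.2 <= x.2) l -> (forall x, x \in l -> 0 <= x.2 <= T) ->
  exists2 v, 0 <= v & gaussian_cf P v (combination X l).
Proof.
elim: n l => [|n IH] [|[c t] l]//=.
  by move=> _ _ _; exists 0 => //; rewrite /combination big_nil; exact: gaussian_cf0.
move=> [ln] + lT; have tT : 0 <= t <= T by apply: (lT (c, t)); rewrite inE eqxx.
case: l ln lT => [|[c' s] l] ln lT.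
  move=> _.
  have [N [mN PN N0]] := brownian_null0.
  have H := @brownian_increment_cf 0 t; rewrite subr0 lexx/= in H.
  case/andP: tT => t0 tT; have {}H := gaussian_cfZ c (H t0 tT).
  exists (c ^+ 2 * t); first by rewrite mulr_ge0// sqr_ge0.
  rewrite /combination big_seq1/=.
  apply: (gaussian_cf_ae mN PN _ _ _ H).
  - apply: measurable_funM => //; apply: measurable_funB; apply: mX.
      by rewrite t0 tT.
    by rewrite lexx ltW.
  - by apply: measurable_funM => //; apply: mX; rewrite t0 tT.
  - by move=> w Nw; rewrite !fctE N0// subr0.
move=> /= /andP[st pl].
have sT : 0 <= s <= T by apply: (lT (c', s)); rewrite !inE eqxx orbT.
have [s0 _] := andP sT; have [t0 tT'] := andP tT.
have lT' x : x \in (c + c', s) :: l -> 0 <= x.2 <= T.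
  by rewrite inE => /predU1P[->//|xl]; apply: lT; rewrite !inE xl !orbT.
have sl : sorted (fun x y : R * R => y.2 <= x.2) ((c + c', s) :: l).
  by move: pl; case: (l).
have [v v0 vcf] := IH ((c + c', s) :: l) ln sl lT'.
have E : combination X [:: (c, t), (c', s) & l] =
    combination X ((c + c', s) :: l) + cst c * (X t - X s).
  rewrite !combination_cons/= funeqE => w.
  by rewrite !fctE; ring.
rewrite E; exists (v + c ^+ 2 * (t - s)).
  by rewrite addr_ge0// mulr_ge0 ?sqr_ge0// subr_ge0.
move: st; rewrite le_eqVlt => /predU1P[<-|st].
  by rewrite !subrr mulr0 addr0 (_ : _ + _ = combination X ((c + c', s) :: l))//
    funeqE => w; rewrite !fctE mulr0 addr0.
have Is : `[0, T]%classic s by rewrite /= in_itv.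
have It : `[0, T]%classic t by rewrite /= in_itv.
have [_ _ _ /(_ _ _ Is It st)[ind _] _] := BX.
apply: (gaussian_cfD _ _ _ _ ind vcf).
- exact: combination_measurable.
- by apply: measurable_funM => //; apply: measurable_funB; exact: mX.
- apply: combination_raw => x; rewrite inE => /predU1P[->|xl] /=.
    by rewrite s0 lexx.
  have := lT' x; rewrite inE xl orbT => /(_ isT)/andP[-> _] /=.
  have tr : transitive (fun x y : R * R => y.2 <= x.2).
    by move=> a b e ab be; exact: le_trans be ab.
  have := order_path_min tr pl => /allP/(_ _ xl).
  by [].
- have := @sigma_of_comp (X t \- X s) (fun y => c * y).
  apply; exact: measurable_funM.
- by apply: gaussian_cfZ; apply: brownian_increment_cf => //; rewrite s0 ltW.
Qed.

(** The variance itself is left unspecified; covariances are recovered later by polarisation. *)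
Lemma combination_cf l : (forall x, x \in l -> 0 <= x.2 <= T) ->
  exists2 v, 0 <= v & gaussian_cf P v (combination X l).
Proof.
move=> lT; pose leT (x y : R * R) := y.2 <= x.2.
have tot : total leT by move=> x y; rewrite /leT le_total.
have -> : combination X l = combination X (sort leT l).
  by apply: perm_big; rewrite perm_sym perm_sort.
apply: (combination_sorted_cf (n := size (sort leT l))) => //.
  exact: sort_sorted.
by move=> x; rewrite mem_sort; exact: lT.
Qed.

End OneProcess.
End BrownianGaussian.

(** * Freezing time outside [0, T] *)

Section Clamp.
Context {R : realType}.
Implicit Types (T t : R).

(** Composition with it makes a path that is continuous on [0, T] continuous on the whole line, so
    that the sequel works with plain continuity. *)
Definition clamp T t : R := Num.max 0 (Num.min t T).

Lemma clamp_itv T t : 0 < T -> 0 <= clamp T t <= T.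
Proof.
by move=> T0; rewrite /clamp le_max lexx /= ge_max (ltW T0) /= ge_min lexx orbT.
Qed.

Lemma clamp_id T t : 0 <= t <= T -> clamp T t = t.
Proof. by case/andP => t0 tT; rewrite /clamp min_l// max_r. Qed.

Lemma clamp_continuous T : continuous (clamp T).
Proof.
move=> t; suff : {for t, continuous (clamp T)} by [].
apply: continuous_max; first exact: cvg_cst.
by apply: continuous_min; [exact: cvg_id|exact: cvg_cst].
Qed.

Lemma continuous_clamp (f : R -> R) T : 0 < T ->
  {within `[0, T], continuous f} -> continuous (f \o clamp T).
Proof.
move=> T0 /subspace_continuousP cf t.
have cc := @clamp_continuous T t.
have It : `[0, T]%classic (clamp T t) by rewrite /= in_itv/=; exact: clamp_itv.
move=> U fU; have wU := cf _ It U fU.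
have cU : \forall s \near t, `[0, T]%classic (clamp T s) -> U (f (clamp T s)).
  exact: (cc _ wU).
suff : \forall s \near t, U (f (clamp T s)) by [].
apply: filterS cU => s; apply.
by rewrite /= in_itv/=; exact: clamp_itv.
Qed.

End Clamp.

(** * A version of the bridge with continuous paths, inside a Gaussian space *)

Section BetaSetup.
Context {d : measure_display} {Omega : measurableType d} {R : realType}.
Variables (P : probability Omega R) (T : R) (W B : R -> Omega -> R).
Hypotheses (T0 : 0 < T) (BW : standard_brownian_motion P `[0, T] W).
Hypotheses (BB : standard_brownian_motion P `[0, T] B).
Hypothesis WB : independent_processes P T W B.

Let good_null (X : R -> Omega -> R) : standard_brownian_motion P `[0, T] X ->
  exists N, [/\ measurable N, P N = 0%E & forall w, ~ N w ->
    X 0 w = 0 /\ {within `[0, T], continuous (X ^~ w)}].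
Proof.
move=> BX; have [N0 [mN0 PN0 N0P]] := brownian_null0 BX.
case: BX => _ _ _ _ [N1 [mN1 PN1 N1P]].
exists (N0 `|` N1); split; [exact: measurableU|by rewrite measureU0|].
move=> w nN; split; first by apply: N0P => n; apply: nN; left.
by apply: contrapT => nc; apply: nN; right; apply: N1P.
Qed.

Let N := projT1 (cid (good_null BW)) `|` projT1 (cid (good_null BB)).

Let mN : measurable N.
Proof.
by rewrite /N; case: cid => N1 [] /= mN1 _ _; case: cid => N2 [] /= mN2 _ _; exact: measurableU.
Qed.

Let PN : P N = 0%E.
Proof.
rewrite /N; case: cid => N1 [] /= mN1 PN1 _; case: cid => N2 [] /= mN2 PN2 _.
by rewrite measureU0.
Qed.

Let NW w : ~ N w -> W 0 w = 0 /\ {within `[0, T], continuous (W ^~ w)}.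
Proof.
rewrite /N; case: cid => N1 [] /= _ _ H nN.
by apply: H => n; apply: nN; left.
Qed.

Let NB w : ~ N w -> B 0 w = 0 /\ {within `[0, T], continuous (B ^~ w)}.
Proof.
rewrite /N; case: (cid (good_null BB)) => N2 [] /= _ _ H nN.
by apply: H => n; apply: nN; right.
Qed.

(** Off the null set [N] the paths of W and B are continuous and start at 0; setting the process to
    0 on [N] makes every path so. *)
Let clean (X : R -> Omega -> R) t w : R := \1_(~` N) w * X (clamp T t) w.

Let clean_off X t w : ~ N w -> clean X t w = X (clamp T t) w.
Proof. by move=> Nw; rewrite /clean indicE mem_set ?mul1r. Qed.

Let clean_on X t w : N w -> clean X t w = 0.
Proof. by move=> Nw; rewrite /clean indicE memNset ?mul0r// => -[]. Qed.

Let clean_continuous X : (forall w, ~ N w -> {within `[0, T], continuous (X ^~ w)}) ->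
  forall w, continuous (clean X ^~ w).
Proof.
move=> cX w; have [Nw|Nw] := pselect (N w).
  by under eq_fun do rewrite clean_on//; exact: cst_continuous.
under eq_fun do rewrite clean_off//.
exact: (continuous_clamp T0 (cX w Nw)).
Qed.

Let H0 := [set Y | exists l1 l2,
  Y = combination (clean W) l1 + combination (clean B) l2].

Let clamp_list (l : seq (R * R)) := [seq (x.1, clamp T x.2) | x <- l].

Let clamp_listT l x : x \in clamp_list l -> 0 <= x.2 <= T.
Proof. by case/mapP => y _ ->; exact: clamp_itv. Qed.

Let combination_clean X l w : ~ N w ->
  combination X (clamp_list l) w = combination (clean X) l w.
Proof.
move=> Nw; rewrite /combination big_map !fct_sumE.
by apply: eq_bigr => x _; rewrite !fctE clean_off.
Qed.

Let measurable_clean X t : standard_brownian_motion P `[0, T] X ->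
  measurable_fun setT (clean X t).
Proof.
case=> mX _ _ _ _; apply: measurable_funM.
  by apply: measurable_indic; exact: measurableC.
by apply: mX; rewrite /= in_itv/=; exact: clamp_itv.
Qed.

Let measurable_combination_clean X l : standard_brownian_motion P `[0, T] X ->
  measurable_fun setT (combination (clean X) l).
Proof.
move=> BX; elim: l => [|x l IH]; first by rewrite /combination big_nil; exact: measurable_cst.
rewrite combination_cons; apply: measurable_funD => //.
by apply: measurable_funM => //; exact: measurable_clean.
Qed.

(** Independence of W and B concerns their raw filtrations, to which the cleaned variables, altered
    on [N], need not be adapted. It is applied to the original variables at clamped times, and the
    law is then carried over off [N]. *)
Let H0_cf Y : H0 Y -> exists2 v, 0 <= v & gaussian_cf P v Y.
Proof.
move=> [l1 [l2 ->]].
have [v1 v10 c1] := combination_cf T0 BW (@clamp_listT l1).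
have [v2 v20 c2] := combination_cf T0 BB (@clamp_listT l2).
exists (v1 + v2); first exact: addr_ge0.
apply: (gaussian_cf_ae mN PN _ _ _ (gaussian_cfD _ _ _ _ WB c1 c2)).
- by apply: measurable_funD; [exact: (combination_measurable BW (@clamp_listT l1))
    |exact: (combination_measurable BB (@clamp_listT l2))].
- by apply: measurable_funD; exact: measurable_combination_clean.
- by move=> w Nw; rewrite !fctE !combination_clean.
- exact: (combination_measurable BW (@clamp_listT l1)).
- exact: (combination_measurable BB (@clamp_listT l2)).
- exact: (combination_raw (@clamp_listT l1)).
- exact: (combination_raw (@clamp_listT l2)).
Qed.

Let H0_measurable Y : H0 Y -> measurable_fun setT Y.
Proof.
by move=> [l1 [l2 ->]]; apply: measurable_funD; exact: measurable_combination_clean.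
Qed.

Let H0_var Y v : H0 Y -> 0 <= v -> gaussian_cf P v Y ->
  square_integrable P Y /\ iprod P Y Y = v.
Proof. by move=> HY v0; apply: gaussian_cf_square_integrable => //; exact: H0_measurable. Qed.

Let H0_gaussian : H0 `<=` gaussian P.
Proof.
move=> Y HY; have [v v0 c] := H0_cf HY.
by have [LY vE] := H0_var HY v0 c; split => //; rewrite vE.
Qed.

Let combinationZ (X : R -> Omega -> R) t l : combination X [seq (t * x.1, x.2) | x <- l] = cst t * combination X l.
Proof.
rewrite /combination big_map mulr_sumr; apply: eq_bigr => x _.
by rewrite mulrA.
Qed.

Let H0_linear : linear_space H0.
Proof.
split; first by exists [::], [::]; rewrite /combination !big_nil addr0.
move=> _ _ t [l1 [l2 ->]] [l3 [l4 ->]].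
exists (l1 ++ [seq (t * x.1, x.2) | x <- l3]), (l2 ++ [seq (t * x.1, x.2) | x <- l4]).
have catE (X : R -> Omega -> R) l l' : combination X (l ++ l') = combination X l + combination X l'.
  by rewrite /combination big_cat.
by rewrite !catE !combinationZ mulrDr addrACA.
Qed.

Let cleanW t : H0 (clean W t).
Proof.
exists [:: (1, t)], [::]; rewrite /combination big_nil big_seq1 addr0/=.
by rewrite funeqE => w; rewrite fctE mul1r.
Qed.

Let cleanB t : H0 (clean B t).
Proof.
exists [::], [:: (1, t)]; rewrite /combination big_nil big_seq1 add0r/=.
by rewrite funeqE => w; rewrite fctE mul1r.
Qed.

Let varE Y v : H0 Y -> 0 <= v -> gaussian_cf P v Y -> iprod P Y Y = v.
Proof. by move=> HY v0 c; have [] := H0_var HY v0 c. Qed.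

Let LH Y : H0 Y -> square_integrable P Y. Proof. by move=> /H0_gaussian[]. Qed.

Let clean_increment X s t : standard_brownian_motion P `[0, T] X ->
  0 <= s <= t -> t <= T -> gaussian_cf P (t - s) (clean X t - clean X s).
Proof.
move=> BX /andP[s0 st] tT.
have sT : 0 <= s <= T by rewrite s0 (le_trans st).
have tT' : 0 <= t <= T by rewrite tT (le_trans s0).
have [mX _ _ _ _] := BX.
apply: (gaussian_cf_ae mN PN _ _ _ (brownian_increment_cf BX _ tT)).
- by apply: measurable_funB; apply: mX; rewrite /= in_itv.
- by apply: measurable_funB; exact: measurable_clean.
- by move=> w Nw; rewrite !fctE !clean_off// !clamp_id.
- by rewrite s0 st.
Qed.

Let clean0 X : (forall w, ~ N w -> X 0 w = 0) -> clean X 0 = 0.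
Proof.
move=> X0; rewrite funeqE => w; have [Nw|Nw] := pselect (N w).
  by rewrite clean_on.
by rewrite clean_off// clamp_id ?X0// lexx ltW.
Qed.

(** Polarisation: the variances of X_s, X_t and X_t - X_s are [s], [t] and [t - s]. *)
Let clean_cov X s t : standard_brownian_motion P `[0, T] X ->
  (forall t, H0 (clean X t)) -> (forall w, ~ N w -> X 0 w = 0) ->
  0 <= s <= t -> t <= T -> iprod P (clean X s) (clean X t) = s.
Proof.
move=> BX HX X0 /andP[s0 st] tT.
have var r : 0 <= r <= T -> iprod P (clean X r) (clean X r) = r.
  case/andP => r0 rT; have := clean_increment BX (s := 0) (t := r).
  rewrite lexx r0 clean0// !subr0 => /(_ isT rT) c.
  by apply: varE.
have LX r := LH (HX r).
have HB : H0 (clean X t - clean X s).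
  have [_ /(_ _ _ (-1) (HX t) (HX s))] := H0_linear.
  by rewrite (_ : cst (-1) * _ = - clean X s)// funeqE => w; rewrite !fctE mulN1r.
have st' : 0 <= s <= t by rewrite s0 st.
have ts : 0 <= t - s by rewrite subr_ge0.
have := varE HB ts (clean_increment BX st' tT).
rewrite iprodBl// ?iprodBr//; last exact: square_integrableB.
rewrite var ?tT ?(le_trans s0 st)// var ?s0 ?(le_trans st tT)//.
by rewrite (iprodC P (clean X t)); lra.
Qed.

(** Polarisation again: the sum of the two independent variables has variance [s + t]. The product
    rule [independent_prod] is for bounded functions and would not apply directly. *)
Let cross s t : 0 <= s <= T -> 0 <= t <= T -> iprod P (clean W s) (clean B t) = 0.
Proof.
move=> sT tT; have [s0 _] := andP sT; have [t0 _] := andP tT.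
have [mW _ _ _ _] := BW; have [mB _ _ _ _] := BB.
have W0 w : ~ N w -> W 0 w = 0 by move=> /NW[].
have B0 w : ~ N w -> B 0 w = 0 by move=> /NB[].
have HWB : H0 (clean W s + clean B t).
  by exists [:: (1, s)], [:: (1, t)]; rewrite /combination !big_seq1/=; congr (_ + _);
    rewrite funeqE => w; rewrite !fctE mul1r.
have c1 : gaussian_cf P s (combination W [:: (1, s)]).
  have := clean_increment BW (s := 0) (t := s).
  case/andP: sT => _ sT; rewrite lexx s0 clean0// !subr0 => /(_ isT sT) c.
  apply: (gaussian_cf_ae mN PN _ _ _ c).
  - exact: measurable_clean.
  - by apply: (combination_measurable BW) => x; rewrite inE => /eqP->/=; rewrite s0.
  - by move=> w Nw; rewrite /combination big_seq1 !fctE mul1r/= clean_off// clamp_id ?s0.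
have c2 : gaussian_cf P t (combination B [:: (1, t)]).
  have := clean_increment BB (s := 0) (t := t).
  case/andP: tT => _ tT; rewrite lexx t0 clean0// !subr0 => /(_ isT tT) c.
  apply: (gaussian_cf_ae mN PN _ _ _ c).
  - exact: measurable_clean.
  - by apply: (combination_measurable BB) => x; rewrite inE => /eqP->/=; rewrite t0.
  - by move=> w Nw; rewrite /combination big_seq1 !fctE mul1r/= clean_off// clamp_id ?t0.
have l1 (x : R * R) : x \in [:: (1, s)] -> 0 <= x.2 <= T by rewrite inE => /eqP->.
have l2 (x : R * R) : x \in [:: (1, t)] -> 0 <= x.2 <= T by rewrite inE => /eqP->.
have c12 : gaussian_cf P (s + t) (clean W s + clean B t).
  apply: (gaussian_cf_ae mN PN _ _ _ (gaussian_cfD _ _ _ _ WB c1 c2)).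
  - by apply: measurable_funD; [exact: (combination_measurable BW l1)
      |exact: (combination_measurable BB l2)].
  - exact: H0_measurable.
  - by move=> w Nw; rewrite /combination !big_seq1 !fctE !mul1r/= !clean_off// !clamp_id.
  - exact: (combination_measurable BW l1).
  - exact: (combination_measurable BB l2).
  - exact: (combination_raw l1).
  - exact: (combination_raw l2).
have LW := LH (cleanW s); have LB := LH (cleanB t).
have := varE HWB (addr_ge0 s0 t0) c12.
rewrite iprodDl// ?iprodDr//; last exact: square_integrableD.
have -> : iprod P (clean W s) (clean W s) = s.
  by apply: clean_cov => //; rewrite ?s0 ?lexx//; case/andP: sT.
have -> : iprod P (clean B t) (clean B t) = t.
  by apply: clean_cov => //; rewrite ?t0 ?lexx//; case/andP: tT.
by rewrite (iprodC P (clean B t)); lra.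
Qed.

Lemma beta_setup : exists (N : set Omega) (H : set (Omega -> R)) (b : R -> Omega -> R),
  [/\ measurable N /\ P N = 0%E,
      gaussian_space P H /\ (forall t, H (b t)),
      (forall w, continuous (b ^~ w)) /\ b 0 = 0,
      forall t, 0 <= t <= T -> b t = (fun w => \1_(~` N) w * bar_beta T W B t w)
    & forall s t, 0 <= s <= t -> t <= T ->
      iprod P (b s) (b t) = s - s * t / T + s ^+ 2 * t / T ^+ 2].
Proof.
pose b t := clean W t + cst (- (t / T)) * clean W T + cst (t / T) * clean B t.
have Hb t : H0 (b t).
  have [_ lin] := H0_linear.
  exact: (lin _ _ _ (lin _ _ _ (cleanW t) (cleanW T)) (cleanB t)).
have W0 w : ~ N w -> W 0 w = 0 by move=> /NW[].
have B0 w : ~ N w -> B 0 w = 0 by move=> /NB[].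
exists N, (L2_closure P H0), b; split => //.
- split; first exact: L2_closure_gaussian_space.
  move=> t; split; first exact: LH.
  by move=> e e0; exists (b t); split => //; rewrite subrr norm20 ltW.
- split.
    move=> w t; have cW := @clean_continuous W (fun w Nw => (NW Nw).2) w.
    have cB := @clean_continuous B (fun w Nw => (NB Nw).2) w.
    have ct : {for t, continuous (fun t : R => t / T)} by apply: cvgM; [exact: cvg_id|exact: cvg_cst].
    rewrite /b; apply: cvgD; last by apply: cvgM; [exact: ct|exact: cB].
    apply: cvgD; first exact: cW.
    by apply: cvgM; [exact: cvgN ct|exact: cvg_cst].
  rewrite /b !clean0// mul0r oppr0 mulr0 add0r addr0.
  by rewrite funeqE => w; rewrite !fctE mul0r.
- move=> t tT; rewrite funeqE => w.
  rewrite -[LHS]/(clean W t w + - (t / T) * clean W T w + t / T * clean B t w).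
  rewrite /bar_beta /clean.
  have TT : 0 <= T <= T by rewrite lexx ltW.
  by rewrite !(clamp_id tT) (clamp_id TT); ring.
- move=> s t st tT; have [s0 st'] := andP st.
  have t0 : 0 <= t := le_trans s0 st'.
  have sT : s <= T := le_trans st' tT.
  have LW r := LH (cleanW r); have LB r := LH (cleanB r).
  have LcW r r' := square_integrableZ r (LW r').
  have LcB r r' := square_integrableZ r (LB r').
  have LWW r r' := square_integrableD (LW r') (LcW r T).
  have WW r r' : 0 <= r <= r' -> r' <= T -> iprod P (clean W r) (clean W r') = r by exact: clean_cov.
  have BBc r r' : 0 <= r <= r' -> r' <= T -> iprod P (clean B r) (clean B r') = r by exact: clean_cov.
  have Lb r : square_integrable P (clean W r + cst (- (r / T)) * clean W T + cst (r / T) * clean B r).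
    by apply: square_integrableD => //; apply: square_integrableD.
  have LWc r r' : square_integrable P (clean W r + cst r' * clean W T).
    by apply: square_integrableD.
  rewrite /b !(iprodDl, iprodDr, iprodZl, iprodZr)//.
  rewrite !(iprodC P (clean B s) (clean W _)).
  rewrite !cross ?s0 ?t0 ?lexx ?(ltW T0)//.
  rewrite (WW s t)// (WW s T) ?s0 ?lexx// (iprodC P (clean W T)) (WW t T) ?t0 ?lexx//.
  rewrite (WW T T) ?lexx ?(ltW T0)// (BBc s t)//.
  by field; rewrite gt_eqF.
Qed.

End BetaSetup.

(** * Pathwise integrals *)

Lemma primitive_cst {R : realType} (c t : R) : 0 <= t -> primitive (cst c) t = t * c.
Proof.
move=> t0; pose F (u : R) := u * c.
transitivity (F t - F 0); last by rewrite /F mul0r subr0.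
apply: primitive_unique => //.
- by move=> s; apply: cvgM; [exact: cvg_id|exact: cvg_cst].
- by move=> s; exact: cvg_cst.
- by move=> s _; apply: is_derive_eq; rewrite /GRing.scale/=; ring.
Qed.

Section PathIntegral.
Context {d : measure_display} {Omega : measurableType d} {R : realType}.
Variable P : probability Omega R.
Local Notation L2 := (square_integrable P).
Implicit Types (X : R -> Omega -> R) (s t a b : R).

Definition path_integral X t : Omega -> R := fun w => primitive (X ^~ w) t.

Definition riemann_process X a b (n : nat) : Omega -> R :=
  \sum_(0 <= k < n) cst ((b - a) / n%:R) * X (a + k%:R * ((b - a) / n%:R)).

Lemma riemann_processE X a b n w :
  riemann_process X a b n w = riemann_sum (X ^~ w) a b n.
Proof. by rewrite /riemann_process fct_sumE. Qed.

Lemma riemann_point a b (n k : nat) : a <= b -> (k < n.+1)%N ->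
  a <= a + k%:R * ((b - a) / n.+1%:R) <= b.
Proof.
move=> ab kn; have n0 : 0 < n.+1%:R :> R by rewrite ltr0n.
have h0 : 0 <= (b - a) / n.+1%:R by rewrite divr_ge0 ?subr_ge0// ltW.
rewrite lerDl mulr_ge0//= -lerBrDl mulrA ler_pdivrMr// mulrC ler_wpM2l ?subr_ge0//.
by rewrite ler_nat ltnW.
Qed.

Lemma riemann_process_square_integrable X a b n : a <= b ->
  (forall s, a <= s <= b -> L2 (X s)) -> L2 (riemann_process X a b n.+1).
Proof.
move=> ab LX; rewrite /riemann_process big_mkord.
apply: square_integrable_sum => k _; apply: square_integrableZ.
by apply: LX; exact: riemann_point.
Qed.

(** Minkowski's inequality for integrals: it holds for Riemann sums by the triangle inequality, and
    [norm2_fatou] passes to the pathwise limit, where the sums of [K] are eventually below their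
    limit plus [e]. *)
Lemma path_integral_norm2 X (K : R -> R) a b : 0 <= a -> a <= b ->
  (forall w, continuous (X ^~ w)) -> continuous K ->
  (forall s, a <= s <= b -> L2 (X s)) ->
  (forall s, a <= s <= b -> norm2 P (X s) <= K s) ->
  L2 (path_integral X b - path_integral X a) /\
  norm2 P (path_integral X b - path_integral X a) <= primitive K b - primitive K a.
Proof.
move=> a0 ab cX cK LX XK.
pose S n := riemann_process X a b n.+1.
have LS n : L2 (S n) by exact: riemann_process_square_integrable.
have SK n : norm2 P (S n) <= riemann_sum K a b n.+1.
  rewrite /S /riemann_process /riemann_sum !big_mkord.
  apply: le_trans; first apply: norm2_sum.
    by move=> k _; apply: square_integrableZ; apply: LX; exact: riemann_point.
  apply: ler_sum => k _.
  have kab := riemann_point ab (ltn_ord k).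
  rewrite norm2Z; last exact: LX.
  have h0 : 0 <= (b - a) / n.+1%:R by rewrite divr_ge0 ?subr_ge0.
  by rewrite ger0_norm// ler_wpM2l//; exact: XK.
have Scvg w : S n w @[n --> \oo] --> (path_integral X b - path_integral X a) w.
  have := riemann_sum_cvg (cX w) a0 ab; rewrite -cvg_shiftS.
  by under eq_fun do rewrite -riemann_processE.
have Kcvg : riemann_sum K a b n.+1 @[n --> \oo] --> primitive K b - primitive K a.
  have := riemann_sum_cvg cK a0 ab; by rewrite -cvg_shiftS.
set I := path_integral X b - _; set J := primitive K b - _.
have J0 : 0 <= J.
  rewrite /J -(cvg_lim _ Kcvg)//; apply: limr_ge; first by apply/cvg_ex; eexists; exact: Kcvg.
  apply: nearW => n.
  exact: le_trans (norm2_ge0 _ _) (SK n).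
have key e : 0 < e -> L2 I /\ norm2 P I <= J + e.
  move=> e0.
  have [m _ mP] : \forall n \near \oo, riemann_sum K a b n.+1 <= J + e.
    by apply: (cvgr_le _ Kcvg); rewrite ltrDl.
  apply: (@norm2_fatou _ _ _ P (fun n => S (n + m)%N)).
  - by rewrite addr_ge0// ltW.
  - by move=> n; exact: LS.
  - by move=> n; apply: le_trans (SK _) _; apply: mP; rewrite /= leq_addl.
  - by move=> w; rewrite (cvg_shiftn m (S ^~ w)); exact: Scvg.
split; first by have [] := key 1 ltr01.
by apply/ler_addgt0Pr => e e0; have [] := key e e0.
Qed.

Lemma path_integralB X (x : Omega -> R) a b w : 0 <= a -> a <= b ->
  continuous (X ^~ w) ->
  (path_integral (fun s => X s - x) b - path_integral (fun s => X s - x) a) w =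
  (path_integral X b - path_integral X a - cst (b - a) * x) w.
Proof.
move=> a0 ab cX.
rewrite -[LHS]/(primitive _ b - primitive _ a).
rewrite -[RHS]/(primitive _ b - primitive _ a - (b - a) * x w).
have H t : 0 <= t -> primitive (fun s => X s w - x w) t = primitive (X ^~ w) t - t * x w.
  move=> t0; pose F u := primitive (X ^~ w) u - u * x w.
  transitivity (F t - F 0); last by rewrite /F primitive0 mul0r subrr subr0.
  apply: primitive_unique => //.
  - move=> s; apply: cvgB; first exact: continuous_primitive.
    by apply: cvgM; [exact: cvg_id|exact: cvg_cst].
  - by move=> s; apply: cvgB; [exact: cX|exact: cvg_cst].
  - move=> s /andP[s0 _]; have dp := is_derive_primitive cX s0.
    by apply: is_derive_eq; rewrite /GRing.scale/=; ring.
rewrite -[X in X - _ = _]/(primitive (fun s => X s w - x w) b).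
rewrite -[X in _ - X = _]/(primitive (fun s => X s w - x w) a).
by rewrite !H ?(le_trans a0)//; ring.
Qed.

Lemma path_integral_step X a b e : 0 <= a -> a <= b ->
  (forall w, continuous (X ^~ w)) ->
  (forall s, a <= s <= b -> L2 (X s)) ->
  (forall s, a <= s <= b -> norm2 P (X s - X a) <= e) ->
  norm2 P (path_integral X b - path_integral X a - cst (b - a) * X a) <= (b - a) * e.
Proof.
move=> a0 ab cX LX Xe.
have LXa : L2 (X a) by apply: LX; rewrite lexx.
have := @path_integral_norm2 (fun s => X s - X a) (cst e) a b a0 ab.
case.
- by move=> w s; apply: cvgB; [exact: cX|exact: cvg_cst].
- by move=> s; exact: cvg_cst.
- by move=> s sab; apply: square_integrableB => //; exact: LX.
- by [].
move=> _; rewrite (_ : path_integral _ b - _ =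
  path_integral X b - path_integral X a - cst (b - a) * X a); last first.
  by rewrite funeqE => w; exact: path_integralB.
by rewrite !primitive_cst ?(le_trans a0)// -mulrBl.
Qed.

End PathIntegral.

(** * Processes that are continuous both pathwise and in L2 *)

Section RegularProcess.
Context {d : measure_display} {Omega : measurableType d} {R : realType}.
Variables (P : probability Omega R) (H : set (Omega -> R)) (T : R).
Variable G : R -> set (set Omega).
Hypotheses (HG : gaussian_space P H) (T0 : 0 < T).
Hypothesis G_mono : forall s t, s <= t -> G s `<=` G t.
Local Notation L2 := (square_integrable P).
Implicit Types (X Y : R -> Omega -> R) (s t a b : R).

Definition adapted_fun t (x : Omega -> R) :=
  measurable_fun setT (x : g_sigma_algebraType (G t) -> R).

(** A class stable under sums, multiplication by continuous functions and path integration, so that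
    every process built from the bridge belongs to it. Continuity in L2 comes in addition to
    continuity of paths: it makes Riemann sums converge in norm, which keeps integrals in the closed
    space and lets inner products pass under them. *)
Record regular X : Prop := Regular {
  regular_path : forall w, continuous (X ^~ w);
  regular_adapted : forall t, 0 <= t <= T -> adapted_fun t (X t);
  regular_gspace : forall t, 0 <= t <= T -> H (X t);
  regular_continuous : forall e, 0 < e -> exists2 r, 0 < r &
    forall s t, 0 <= s <= T -> 0 <= t <= T -> `|s - t| < r -> norm2 P (X s - X t) <= e;
  regular_bounded : exists2 K, 0 <= K & forall t, 0 <= t <= T -> norm2 P (X t) <= K }.

Lemma regular_square_integrable X t : regular X -> 0 <= t <= T -> L2 (X t).
Proof. by move=> rX tT; apply: (gspace_square_integrable HG); exact: regular_gspace. Qed.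

Lemma adapted_funW s t x : s <= t -> adapted_fun s x -> adapted_fun t x.
Proof.
move=> st /sigma_of_measurable xs; apply/sigma_of_measurable.
apply: subset_trans xs _; have := G_mono st; exact: sub_smallest2r.
Qed.

Lemma regularD X Y : regular X -> regular Y -> regular (fun t => X t + Y t).
Proof.
move=> rX rY; split.
- by move=> w t; apply: cvgD; exact: regular_path.
- by move=> t tT; apply: measurable_funD; exact: regular_adapted.
- by move=> t tT; apply: (gspaceD HG); exact: regular_gspace.
- move=> e e0; have e2 : 0 < e / 2 by rewrite divr_gt0.
  have [r r0 rP] := regular_continuous rX e2.
  have [r' r'0 r'P] := regular_continuous rY e2.
  exists (Num.min r r'); first by rewrite lt_min r0.
  move=> s t sT tT; rewrite lt_min => /andP[sr sr'].
  have -> : X s + Y s - (X t + Y t) = (X s - X t) + (Y s - Y t).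
    by rewrite opprD addrACA.
  apply: le_trans (norm2D _ _) _; try by apply: square_integrableB; exact: regular_square_integrable.
  by rewrite (splitr e) lerD// ?rP ?r'P.
- have [K K0 KP] := regular_bounded rX; have [K' K'0 K'P] := regular_bounded rY.
  exists (K + K'); first exact: addr_ge0.
  move=> t tT; apply: le_trans (norm2D _ _) _; try exact: regular_square_integrable.
  by rewrite lerD// ?KP ?K'P.
Qed.

Lemma regularM (phi : R -> R) X : continuous phi -> regular X ->
  regular (fun t => cst (phi t) * X t).
Proof.
move=> cphi rX.
have [M M0 MP] := bounded_segment 0 T cphi.
have [K K0 KP] := regular_bounded rX.
split.
- by move=> w t; apply: cvgM; [exact: cphi|exact: regular_path].
- by move=> t tT; apply: measurable_funM => //; exact: regular_adapted.
- by move=> t tT; apply: (gspaceZ HG); exact: regular_gspace.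
- move=> e e0.
  have e1 : 0 < e / 2 / (M + 1) by rewrite !divr_gt0// ltr_wpDl.
  have e2 : 0 < e / 2 / (K + 1) by rewrite !divr_gt0// ltr_wpDl.
  have [r r0 rP] := regular_continuous rX e1.
  have [r' r'0 r'P] := uniform_continuous_segment 0 T cphi e2.
  exists (Num.min r r'); first by rewrite lt_min r0.
  move=> s t sT tT; rewrite lt_min => /andP[sr sr'].
  have Ls := regular_square_integrable rX sT; have Lt := regular_square_integrable rX tT.
  have -> : cst (phi s) * X s - cst (phi t) * X t =
      cst (phi s) * (X s - X t) + cst (phi s - phi t) * X t.
    by rewrite funeqE => w; rewrite !fctE; ring.
  apply: le_trans (norm2D _ _) _.
  + by apply: square_integrableZ; exact: square_integrableB.
  + exact: square_integrableZ.
  rewrite !norm2Z//; last exact: square_integrableB.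
  rewrite (splitr e) lerD//.
    apply: (@le_trans _ _ (M * (e / 2 / (M + 1)))).
      by rewrite ler_pM// ?norm2_ge0// ?MP// rP.
    by rewrite mulrA ler_pdivrMr ?ltr_wpDl// mulrC ler_wpM2l ?lerDl// divr_ge0// ltW.
  apply: (@le_trans _ _ (e / 2 / (K + 1) * K)).
    by rewrite ler_pM// ?norm2_ge0// ?KP// ltW// r'P.
  by rewrite mulrAC ler_pdivrMr ?ltr_wpDl// ler_wpM2l ?lerDl// divr_ge0// ltW.
- exists (M * K); first exact: mulr_ge0.
  move=> t tT; rewrite norm2Z; last exact: regular_square_integrable.
  by rewrite ler_pM// ?norm2_ge0// ?MP// KP.
Qed.

Lemma regular_path_integral_diff X a b : regular X -> 0 <= a -> a <= b -> b <= T ->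
  L2 (path_integral X b - path_integral X a).
Proof.
move=> rX a0 ab bT; have [K K0 KP] := regular_bounded rX.
have H1 s : a <= s <= b -> 0 <= s <= T.
  by move=> /andP[as_ sb]; rewrite (le_trans a0)// (le_trans sb).
have [] := @path_integral_norm2 _ _ _ P X (cst K) a b a0 ab (regular_path rX).
- by move=> s; exact: cvg_cst.
- by move=> s /H1; exact: regular_square_integrable.
- by move=> s /H1; exact: KP.
by [].
Qed.

Lemma path_integral0 X : path_integral X 0 = 0.
Proof. by rewrite funeqE => w; exact: primitive0. Qed.

Lemma regular_path_integralL2 X t : regular X -> 0 <= t <= T -> L2 (path_integral X t).
Proof.
move=> rX /andP[t0 tT]; have := regular_path_integral_diff rX (lexx 0) t0 tT.
by rewrite path_integral0 subr0.
Qed.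

(** On each step the path integral differs from its left rectangle by the step length times the L2
    modulus of continuity. *)
Lemma riemann_process_cvg2 X t e : regular X -> 0 <= t <= T -> 0 < e ->
  \forall n \near \oo, norm2 P (path_integral X t - riemann_process X 0 t n.+1) <= e.
Proof.
move=> rX /andP[t0 tT] e0.
have e1 : 0 < e / (t + 1) by rewrite divr_gt0// ltr_wpDl.
have [r r0 rP] := regular_continuous rX e1.
near=> n.
have n0 : 0 < n.+1%:R :> R by rewrite ltr0n.
pose h := t / n.+1%:R.
have h0 : 0 <= h by rewrite divr_ge0.
have hr : h < r.
  rewrite /h ltr_pdivrMr// -ltr_pdivrMl// mulrC (@lt_trans _ _ n%:R)//.
    by near: n; exact: nbhs_infty_gtr.
  by rewrite ltr_nat.
have nh : n.+1%:R * h = t by rewrite /h mulrC divfK// gt_eqF.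
pose x k : R := k%:R * h.
have xS k : x k.+1 - x k = h by rewrite /x -natr1; ring.
have x0 k : 0 <= x k by rewrite mulr_ge0.
have xle k : x k <= x k.+1 by rewrite -subr_ge0 xS.
have xt k : (k <= n.+1)%N -> x k <= t.
  by move=> kn; rewrite -nh /x ler_wpM2r// ler_nat.
have LX k : (k <= n.+1)%N -> L2 (X (x k)).
  by move=> kn; apply: regular_square_integrable; rewrite // x0 (le_trans (xt k kn)).
have -> : path_integral X t - riemann_process X 0 t n.+1 = \sum_(k < n.+1)
   (path_integral X (x k.+1) - path_integral X (x k) - cst (x k.+1 - x k) * X (x k)).
  rewrite sumrB -(big_mkord xpredT (fun k => path_integral X (x k.+1) - path_integral X (x k))).
  rewrite telescope_sumr// /x nh mul0r path_integral0 subr0; congr (_ - _).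
  rewrite /riemann_process big_mkord subr0; apply: eq_bigr => k _.
  by rewrite add0r -/h -[(_.+1)%:R * h - _]/(x k.+1 - x k) xS.
apply: le_trans; first apply: norm2_sum.
  move=> k _; apply: square_integrableB.
    by apply: regular_path_integral_diff => //; rewrite (le_trans (xt _ _)).
  by apply: square_integrableZ; apply: LX; exact: ltnW.
apply: (@le_trans _ _ (\sum_(k < n.+1) h * (e / (t + 1)))).
  apply: ler_sum => k _; rewrite -(xS k).
  have H1 s : x k <= s <= x k.+1 -> 0 <= s <= T.
    move=> /andP[ks sk]; rewrite (le_trans (x0 k))//= (le_trans sk)//.
    by rewrite (le_trans (xt _ _)).
  apply: path_integral_step => //.
  - exact: regular_path.
  - by move=> s /H1; exact: regular_square_integrable.
  - move=> s sk; apply: rP; [exact: H1|by apply: H1; rewrite lexx xle|].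
    case/andP: sk => ks sk; rewrite ger0_norm ?subr_ge0//.
    by apply: le_lt_trans hr; rewrite -(xS k) lerB.
rewrite sumr_const card_ord -mulr_natl mulrA nh.
by rewrite mulrA ler_pdivrMr ?ltr_wpDl// mulrC ler_wpM2l ?lerDl// ltW.
Unshelve. all: by end_near. Qed.

Lemma regular_integral X : regular X -> regular (path_integral X).
Proof.
move=> rX; have [K K0 KP] := regular_bounded rX.
have bnd a b : 0 <= a -> a <= b -> b <= T ->
    norm2 P (path_integral X b - path_integral X a) <= (b - a) * K.
  move=> a0 ab bT.
  have H1 s : a <= s <= b -> 0 <= s <= T.
    by move=> /andP[as_ sb]; rewrite (le_trans a0)// (le_trans sb).
  have [] := @path_integral_norm2 _ _ _ P X (cst K) a b a0 ab (regular_path rX).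
  - by move=> s; exact: cvg_cst.
  - by move=> s /H1; exact: regular_square_integrable.
  - by move=> s /H1; exact: KP.
  by rewrite !primitive_cst ?(le_trans a0)// -mulrBl.
split.
- by move=> w; apply: continuous_primitive; exact: regular_path.
- move=> t /andP[t0 tT].
  (* The sums over [0, t] use only times up to [t] and converge at every outcome, so the limit is
     measurable for the generated sigma-algebra at time [t] itself. *)
  apply: (@measurable_fun_cvg _ (g_sigma_algebraType (G t)) R setT
    (fun n => riemann_process X 0 t n.+1)).
    move=> n; rewrite /riemann_process big_mkord.
    apply: (big_ind (fun x => adapted_fun t x)).
    + exact: measurable_cst.
    + by move=> x y; exact: measurable_funD.
    + move=> k _; apply: measurable_funM => //.
      have /andP[k0 kt] := riemann_point t0 (ltn_ord k).
      by apply: (adapted_funW kt); apply: regular_adapted; rewrite // k0 (le_trans kt).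
  move=> w _; under eq_fun do rewrite riemann_processE.
  have := riemann_sum_cvg (regular_path rX (w := w)) (lexx 0) t0.
  by rewrite primitive0 subr0 -cvg_shiftS.
- move=> t tT; apply: (gspace_limit HG); first exact: regular_path_integralL2.
  move=> e e0; have [n _ nP] := riemann_process_cvg2 rX tT e0.
  exists (riemann_process X 0 t n.+1); split; last by apply: nP => /=.
  rewrite /riemann_process big_mkord; apply: (gspace_sum HG) => k _.
  case/andP: tT => t0 tT.
  apply: (gspaceZ HG); apply: regular_gspace => //.
  by have /andP[-> kt] := riemann_point t0 (ltn_ord k); exact: le_trans kt tT.
- move=> e e0; have e1 : 0 < e / (K + 1) by rewrite divr_gt0// ltr_wpDl.
  exists (e / (K + 1)) => //.
  have W s t : 0 <= s -> s <= t -> t <= T -> t - s < e / (K + 1) ->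
      norm2 P (path_integral X t - path_integral X s) <= e.
    move=> s0 st tT ts; apply: le_trans (bnd _ _ s0 st tT) _.
    apply: (@le_trans _ _ (e / (K + 1) * K)); first by rewrite ler_wpM2r// ltW.
    by rewrite mulrAC ler_pdivrMr ?ltr_wpDl// ler_wpM2l ?lerDl// ltW.
  move=> s t sT tT st; have [s0 sT'] := andP sT; have [t0 tT'] := andP tT.
  have [le|/ltW le] := leP t s.
    by apply: W => //; rewrite ger0_norm ?subr_ge0// in st.
  rewrite norm2_distC; try exact: regular_path_integralL2.
  by apply: W => //; rewrite distrC ger0_norm ?subr_ge0// in st.
- exists (T * K); first by rewrite mulr_ge0// ltW.
  move=> t /andP[t0 tT]; have := bnd 0 t (lexx 0) t0 tT.
  rewrite path_integral0 !subr0 => /le_trans; apply.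
  by rewrite ler_wpM2r.
Qed.

End RegularProcess.

(** * Covariances *)

Lemma primitive_diff {R : realType} (F f : R -> R) (a b : R) : 0 <= a -> a <= b ->
  continuous F -> continuous f -> (forall x, a < x < b -> is_derive x (1 : R) F (f x)) ->
  primitive f b - primitive f a = F b - F a.
Proof.
move=> a0 ab cF cf dF.
suff: (F \- primitive f) b = (F \- primitive f) a by rewrite /=; lra.
apply: derive0_constant => //.
- by move=> x; apply: continuousB; [exact: cF|exact: continuous_primitive].
- move=> x xt; rewrite -(subrr (f x)); apply: is_deriveB; first exact: dF.
  by apply: is_derive_primitive => //; case/andP: xt => ax _; exact: le_lt_trans ax.
Qed.

Section Covariance.
Context {d : measure_display} {Omega : measurableType d} {R : realType}.
Variables (P : probability Omega R) (H : set (Omega -> R)) (T : R).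
Variable G : R -> set (set Omega).
Hypotheses (HG : gaussian_space P H) (T0 : 0 < T).
Hypothesis G_mono : forall s t, s <= t -> G s `<=` G t.
Local Notation L2 := (square_integrable P).
Local Notation regular := (regular P H T G).
Implicit Types (X : R -> Omega -> R) (Y : Omega -> R) (s t a b : R).

Lemma continuous_iprod Y X : L2 Y -> regular X ->
  continuous (fun s => iprod P Y (X (clamp T s))).
Proof.
move=> LY rX s; apply/cvgrPdist_le => e e0.
have nY : 0 < norm2 P Y + 1 by rewrite ltr_wpDl// norm2_ge0.
have [r r0 rP] := regular_continuous rX (divr_gt0 e0 nY).
have cc := @clamp_continuous R T s.
near=> t.
have LX u := regular_square_integrable HG rX (clamp_itv u T0).
rewrite -iprodBr//; apply: le_trans (norm2_cauchy_schwarz _ _) _ => //.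
  exact: square_integrableB.
apply: (@le_trans _ _ (norm2 P Y * (e / (norm2 P Y + 1)))).
  rewrite ler_wpM2l ?norm2_ge0//; apply: rP; [exact: clamp_itv..|].
  by near: t; exact: cvgr_dist_lt.
by rewrite mulrA ler_pdivrMr// mulrC ler_wpM2l ?lerDl// ltW.
Unshelve. all: by end_near. Qed.

Lemma iprod_path_integral Y X t : L2 Y -> regular X -> 0 <= t <= T ->
  iprod P Y (path_integral X t) = primitive (fun s => iprod P Y (X (clamp T s))) t.
Proof.
move=> LY rX tT; have [t0 tT'] := andP tT.
pose c s := iprod P Y (X (clamp T s)).
have LS n := riemann_process_square_integrable (P := P) (X := X) n t0.
have H1 s : 0 <= s <= t -> L2 (X s).
  by move=> /andP[s0 st]; apply: (regular_square_integrable HG rX); rewrite s0 (le_trans st).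
have SE n : iprod P Y (riemann_process X 0 t n.+1) = riemann_sum c 0 t n.+1.
  rewrite /riemann_process /riemann_sum !big_mkord iprodC iprod_suml//; last first.
    by move=> k _; apply: square_integrableZ; apply: H1; exact: riemann_point.
  apply: eq_bigr => k _; have kt := riemann_point t0 (ltn_ord k).
  rewrite iprodZl//; last exact: H1.
  rewrite iprodC /c clamp_id//.
  by case/andP: kt => -> kt; exact: le_trans kt tT'.
have c1 : riemann_sum c 0 t n.+1 @[n --> \oo] --> primitive c t.
  have := riemann_sum_cvg (continuous_iprod LY rX) (lexx 0) t0.
  by rewrite primitive0 subr0 -cvg_shiftS.
have c2 : riemann_sum c 0 t n.+1 @[n --> \oo] --> iprod P Y (path_integral X t).
  apply/cvgrPdist_le => e e0.
  have nY : 0 < norm2 P Y + 1 by rewrite ltr_wpDl// norm2_ge0.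
  have := riemann_process_cvg2 HG rX tT (divr_gt0 e0 nY).
  apply: filterS => n nP; rewrite -SE.
  have LI := regular_path_integralL2 HG rX tT.
  rewrite -iprodBr//; [|exact: LS..].
  apply: le_trans (norm2_cauchy_schwarz _ _) _ => //.
    by apply: square_integrableB => //; exact: LS.
  apply: (@le_trans _ _ (norm2 P Y * (e / (norm2 P Y + 1)))).
    by rewrite ler_wpM2l ?norm2_ge0.
  by rewrite mulrA ler_pdivrMr// mulrC ler_wpM2l ?lerDl// ltW.
exact: (cvg_unique (@Rhausdorff R) c2 c1).
Qed.

(** All covariances with path integrals are computed this way: it suffices to exhibit an
    antiderivative of the covariance of [Y] with the integrand. *)
Lemma iprod_path_integral_diff (F : R -> R) Y X a b : L2 Y -> regular X ->
  0 <= a -> a <= b -> b <= T -> continuous F ->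
  (forall s, a < s < b -> is_derive s (1 : R) F (iprod P Y (X s))) ->
  iprod P Y (path_integral X b - path_integral X a) = F b - F a.
Proof.
move=> LY rX a0 ab bT cF dF.
have aT : 0 <= a <= T by rewrite a0 (le_trans ab).
have bT' : 0 <= b <= T by rewrite bT (le_trans a0).
rewrite iprodBr//; try exact: (regular_path_integralL2 HG rX).
rewrite !iprod_path_integral//; apply: primitive_diff => //.
  exact: continuous_iprod.
move=> s sab; rewrite clamp_id; first exact: dF.
by case/andP: sab => as_ sb; rewrite (le_trans a0 (ltW as_)) (le_trans (ltW sb) bT).
Qed.

Lemma orthogonal_path_integral Y X t : L2 Y -> regular X -> 0 <= t <= T ->
  (forall s, 0 <= s <= t -> iprod P Y (X s) = 0) ->
  iprod P Y (path_integral X t) = 0.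
Proof.
move=> LY rX /andP[t0 tT] YX.
have := @iprod_path_integral_diff (cst 0) Y X 0 t LY rX (lexx 0) t0 tT.
rewrite path_integral0 !subr0; apply => [s|s /andP[s0 st]]; first exact: cvg_cst.
rewrite YX; first exact: is_derive_cst.
by rewrite !ltW.
Qed.

End Covariance.

(** * The kernel and its antiderivatives *)

Section KernelFunctions.
Context {R : realType}.
Variable T : R.
Hypothesis T0 : 0 < T.
Implicit Types (u s r : R).

(* [gker] is the derivative of [Gker]; [Gker1] and [Gker2] are antiderivatives of
   [u * gker u] and [u ^+ 2 * gker u]. *)
Definition gker u : R := 2 * T ^+ 3 / (u ^+ 2 + T ^+ 2) ^+ 2.
Definition Gker u : R := T * u / (u ^+ 2 + T ^+ 2) + atan (u / T).
Definition Gker1 u : R := - T ^+ 3 / (u ^+ 2 + T ^+ 2).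
Definition Gker2 u : R := T ^+ 2 * (atan (u / T) - T * u / (u ^+ 2 + T ^+ 2)).
Definition Dker s : R := T - s + s * atan (s / T).

Lemma sqrD_gt0 u : 0 < u ^+ 2 + T ^+ 2.
Proof. by rewrite ltr_wpDl ?sqr_ge0// exprn_gt0. Qed.

Lemma sqrD_neq0 u : u ^+ 2 + T ^+ 2 != 0.
Proof. by rewrite gt_eqF// sqrD_gt0. Qed.

Lemma is_derive_atan_scale u : is_derive u (1 : R) (fun u => atan (u / T)) (T / (u ^+ 2 + T ^+ 2)).
Proof.
apply: is_derive_eq; rewrite /GRing.scale/=; field.
by rewrite sqrD_neq0 (gt_eqF T0).
Qed.

Lemma is_derive_Gker u : is_derive u (1 : R) Gker (gker u).
Proof.
have dA := is_derive_atan_scale u; have n0 := sqrD_neq0 u.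
by rewrite /Gker; apply: is_derive_eq; rewrite /GRing.scale/= /gker; field; rewrite n0 ?(gt_eqF T0).
Qed.

Lemma is_derive_Gker1 u : is_derive u (1 : R) Gker1 (u * gker u).
Proof.
have n0 := sqrD_neq0 u.
by rewrite /Gker1; apply: is_derive_eq; rewrite /GRing.scale/= /gker; field; rewrite n0 ?(gt_eqF T0).
Qed.

Lemma is_derive_Gker2 u : is_derive u (1 : R) Gker2 (u ^+ 2 * gker u).
Proof.
have dA := is_derive_atan_scale u; have n0 := sqrD_neq0 u.
by rewrite /Gker2; apply: is_derive_eq; rewrite /GRing.scale/= /gker; field; rewrite n0 ?(gt_eqF T0).
Qed.

(** The two terms of [Dker] never vanish together: at [s = T] there remains [T * atan 1], at 0 there
    remains [T]. This is why the drift has no singularity at [T]. *)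
Lemma Dker_gt0 s : 0 <= s <= T -> 0 < Dker s.
Proof.
move=> /andP[s0 sT]; rewrite /Dker.
have a0 : 0 <= atan (s / T) by rewrite -atan0 le_atan// divr_ge0// ltW.
move: s0; rewrite le_eqVlt => /predU1P[<-|s0]; first by rewrite subr0 mul0r addr0.
rewrite ltr_wpDl ?subr_ge0// mulr_gt0// -atan0 lt_atan// divr_gt0//.
Qed.

(* [cov u r] is the covariance of the bridge at times [u <= r]. *)
Definition cov u r : R := u - u * r / T + u ^+ 2 * r / T ^+ 2.

(* The second and third lines are the integral over [0, r] of [gker] times the
   covariance of [b u] and [b], split at [u]. *)
Lemma kernel_identity u r :
  (1 - Gker r) * cov u r +
  ((1 - u / T) * (Gker1 u - Gker1 0) + u / T ^+ 2 * (Gker2 u - Gker2 0) +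
   (u * (Gker r - Gker u) + (u ^+ 2 / T ^+ 2 - u / T) * (Gker1 r - Gker1 u))) =
  Dker r * (u * (T - u) / T ^+ 2).
Proof.
rewrite /Gker /Gker1 /Gker2 /Dker /cov mul0r atan0 expr0n/= add0r.
by field; rewrite (gt_eqF T0)/= !sqrD_neq0.
Qed.

End KernelFunctions.

(** * The diffusion coefficient and its inverse *)

Section Volatility.
Context {R : realType}.
Variable T : R.
Hypothesis T0 : 0 < T.
Implicit Types s t : R.

Definition volatility s : R := Num.sqrt ((T ^+ 2 + s ^+ 2) / T ^+ 2).
Definition volatility' s : R := s / (T ^+ 2 * volatility s).
Definition ivolatility s : R := (volatility s)^-1.
Definition ivolatility' s : R := - (s / (T ^+ 2 * volatility s ^+ 3)).

Lemma volatility_gt0 s : 0 < volatility s.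
Proof. by rewrite sqrtr_gt0 divr_gt0 ?exprn_gt0// addrC sqrD_gt0. Qed.

Lemma volatility_sqr s : volatility s ^+ 2 = 1 + s ^+ 2 / T ^+ 2.
Proof.
rewrite sqr_sqrtr ?divr_ge0 ?sqr_ge0//; last by rewrite ltW// addrC sqrD_gt0.
by field; rewrite gt_eqF.
Qed.

Lemma is_derive_volatility s : is_derive s (1 : R) volatility (volatility' s).
Proof.
have v0 := volatility_gt0 s.
have q0 : 0 < (T ^+ 2 + s ^+ 2) / T ^+ 2 by rewrite -sqrtr_gt0.
rewrite /volatility.
have d1 : is_derive s (1 : R) (fun s => (T ^+ 2 + s ^+ 2) / T ^+ 2) (2 * s / T ^+ 2).
  by apply: is_derive_eq; rewrite /GRing.scale/=; ring.
have d2 := is_derive1_sqrt q0.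
apply: is_derive_eq (is_derive1_comp _ _ ) _.
rewrite /volatility' /volatility; field.
by rewrite (gt_eqF T0) gt_eqF.
Qed.

Lemma is_derive_ivolatility s : is_derive s (1 : R) ivolatility (ivolatility' s).
Proof.
have v0 := volatility_gt0 s; have dv := is_derive_volatility s.
have n0 : volatility s != 0 by rewrite gt_eqF.
rewrite /ivolatility.
have dV := is_deriveV n0 dv.
apply: is_derive_eq; rewrite /GRing.scale/= /ivolatility' /volatility'.
by field; rewrite (gt_eqF T0) gt_eqF.
Qed.

Lemma continuous_volatility : continuous volatility.
Proof. by move=> s; exact: (is_derive_continuous (is_derive_volatility s)). Qed.

Lemma continuous_ivolatility : continuous ivolatility.
Proof. by move=> s; exact: (is_derive_continuous (is_derive_ivolatility s)). Qed.

Lemma continuous_volatility' : continuous volatility'.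
Proof.
move=> s; apply: cvgM; first exact: cvg_id.
apply: cvgV; first by rewrite mulf_neq0 ?expf_neq0 ?gt_eqF ?volatility_gt0.
by apply: cvgM; [exact: cvg_cst|exact: continuous_volatility].
Qed.

Lemma continuous_ivolatility' : continuous ivolatility'.
Proof.
move=> s; apply: cvgN; apply: cvgM; first exact: cvg_id.
apply: cvgV; first by rewrite mulf_neq0 ?expf_neq0 ?gt_eqF ?volatility_gt0.
apply: cvgM; first exact: cvg_cst.
exact: (continuous_comp (@continuous_volatility s) (@exprn_continuous R 3 _)).
Qed.

Lemma ivolatility_le1 s : ivolatility s <= 1.
Proof.
rewrite invf_le1 ?volatility_gt0// -[1]sqrtr1 ler_wsqrtr//.
by rewrite ler_pdivlMr ?exprn_gt0// mul1r lerDl sqr_ge0.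
Qed.

End Volatility.

(** * The innovation *)

Section Innovation.
Context {d : measure_display} {Omega : measurableType d} {R : realType}.
Variables (P : probability Omega R) (H : set (Omega -> R)) (T : R).
Variable G : R -> set (set Omega).
Hypotheses (HG : gaussian_space P H) (T0 : 0 < T).
Hypothesis G_mono : forall s t, s <= t -> G s `<=` G t.
Local Notation L2 := (square_integrable P).
Local Notation regular := (regular P H T G).
Local Notation iprod := (iprod P).
Local Notation norm2 := (norm2 P).
Implicit Types (X : R -> Omega -> R) (Y : Omega -> R) (s t u r : R).

Variable b : R -> Omega -> R.
Hypotheses (rb : regular b) (b0 : b 0 = 0).
Hypothesis b_cov : forall s t, 0 <= s <= t -> t <= T -> iprod (b s) (b t) = cov T s t.

(* [drift], [martingale_part] and [innovation] are the processes L, M and Bbar of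
   the header. The clamp makes [iDker] continuous on the whole line, as [Dker] may
   vanish outside [0, T]. *)
Definition iDker s : R := (Dker T (clamp T s))^-1.

Definition kernel_part s : Omega -> R := cst (gker T s) * b s.
Definition drift r : Omega -> R :=
  cst (iDker r) * (cst (1 - Gker T r) * b r + path_integral kernel_part r).
Definition martingale_part t : Omega -> R := b t + path_integral drift t.
Definition volatility_part t : Omega -> R := cst (ivolatility' T t) * martingale_part t.
Definition innovation t : Omega -> R :=
  cst (ivolatility T t) * martingale_part t - path_integral volatility_part t.

Local Notation L := drift.
Local Notation M := martingale_part.

Lemma continuous_gker : continuous (gker T).
Proof.
move=> s; apply: cvgM; first exact: cvg_cst.
apply: cvgV; first by rewrite expf_neq0// sqrD_neq0.
have c1 : {for s, continuous (fun s : R => s ^+ 2 + T ^+ 2)}.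
  by apply: cvgD; [exact: exprn_continuous|exact: cvg_cst].
exact: (continuous_comp c1 (@exprn_continuous R 2 _)).
Qed.

Lemma continuous_Gker : continuous (Gker T).
Proof. by move=> s; exact: (is_derive_continuous (is_derive_Gker T0 s)). Qed.

Lemma continuous_Dker : continuous (Dker T).
Proof.
move=> s; have dA := is_derive_atan_scale T0 s.
by rewrite /Dker; exact: is_derive_continuous.
Qed.

Lemma continuous_iDker : continuous iDker.
Proof.
move=> s; apply: cvgV; first by rewrite gt_eqF// Dker_gt0// clamp_itv.
exact: (continuous_comp (@clamp_continuous R T s) (@continuous_Dker _)).
Qed.

Lemma regular_kernel_part : regular kernel_part.
Proof. exact: (regularM HG continuous_gker). Qed.

Lemma regular_drift : regular drift.
Proof.
apply: (regularM HG continuous_iDker); apply: (regularD HG).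
  apply: (regularM HG) => // s; apply: cvgB; first exact: cvg_cst.
  exact: continuous_Gker.
exact: (regular_integral HG T0 G_mono regular_kernel_part).
Qed.

Lemma regular_martingale_part : regular M.
Proof. by apply: (regularD HG rb); exact: (regular_integral HG T0 G_mono regular_drift). Qed.

Lemma regular_volatility_part : regular volatility_part.
Proof. exact: (regularM HG (continuous_ivolatility' T0) regular_martingale_part). Qed.

Lemma regularB X X' : regular X -> regular X' -> regular (fun t => X t - X' t).
Proof.
move=> rX rX'; have -> : (fun t => X t - X' t) = (fun t => X t + cst (- 1) * X' t).
  by rewrite funeqE => t; rewrite funeqE => w; rewrite !fctE mulN1r.
by apply: (regularD HG rX); apply: (regularM HG (phi := cst (-1))) => // s; exact: cvg_cst.
Qed.

Lemma regular_innovation : regular innovation.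
Proof.
apply: regularB.
  exact: (regularM HG (continuous_ivolatility T0) regular_martingale_part).
exact: (regular_integral HG T0 G_mono regular_volatility_part).
Qed.

Let L2X X t : regular X -> 0 <= t <= T -> L2 (X t).
Proof. exact: regular_square_integrable. Qed.

Let L2I X t : regular X -> 0 <= t <= T -> L2 (path_integral X t).
Proof. exact: regular_path_integralL2. Qed.

(** The value is minus the derivative of [cov T u r] in [r], and does not depend on [r]: integrating
    the drift compensates exactly the covariance of [b u] with later increments of the bridge. *)
Lemma iprod_drift u r : 0 <= u <= r -> r <= T -> iprod (b u) (L r) = u * (T - u) / T ^+ 2.
Proof.
move=> ur rT; have [u0 ur'] := andP ur.
have uT : 0 <= u <= T by rewrite u0 (le_trans ur').
have rT' : 0 <= r <= T by rewrite rT (le_trans u0).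
have rk := regular_kernel_part.
have Lu := L2X rb uT; have Lr := L2X rb rT'.
have I1 : iprod (b u) (path_integral kernel_part u) =
    (1 - u / T) * (Gker1 T u - Gker1 T 0) + u / T ^+ 2 * (Gker2 T u - Gker2 T 0).
  (* The covariance of [b u] and [b s] changes form at [s = u], hence one antiderivative on [0, u]
     and another on [u, r]. *)
  pose F s := (1 - u / T) * Gker1 T s + u / T ^+ 2 * Gker2 T s.
  have dF s : is_derive s (1 : R) F (gker T s * cov T s u).
    have d1 := is_derive_Gker1 T0 s; have d2 := is_derive_Gker2 T0 s.
    rewrite /F; apply: is_derive_eq; rewrite /GRing.scale/= /cov.
    by field; rewrite (gt_eqF T0).
  have cF : continuous F by move=> s; exact: (is_derive_continuous (dF s)).
  have dF' s : 0 < s < u -> is_derive s (1 : R) F (iprod (b u) (kernel_part s)).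
    move=> /andP[/ltW s0 /ltW su]; have [_ uT'] := andP uT.
    rewrite iprodZr//; last by apply: L2X; rewrite // s0 (le_trans su).
    by rewrite iprodC b_cov ?s0.
  have [_ uT'] := andP uT.
  have := iprod_path_integral_diff HG T0 Lu rk (lexx 0) u0 uT' cF dF'.
  by rewrite path_integral0 subr0 => ->; rewrite /F; ring.
have I2 : iprod (b u) (path_integral kernel_part r - path_integral kernel_part u) =
    u * (Gker T r - Gker T u) + (u ^+ 2 / T ^+ 2 - u / T) * (Gker1 T r - Gker1 T u).
  pose F s := u * Gker T s + (u ^+ 2 / T ^+ 2 - u / T) * Gker1 T s.
  have dF s : is_derive s (1 : R) F (gker T s * cov T u s).
    have d1 := is_derive_Gker1 T0 s; have d2 := is_derive_Gker T0 s.
    rewrite /F; apply: is_derive_eq; rewrite /GRing.scale/= /cov.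
    by field; rewrite (gt_eqF T0).
  have cF : continuous F by move=> s; exact: (is_derive_continuous (dF s)).
  have dF' s : u < s < r -> is_derive s (1 : R) F (iprod (b u) (kernel_part s)).
    move=> /andP[/ltW us /ltW sr]; have sT := le_trans sr rT.
    by rewrite iprodZr// ?b_cov// ?u0//; apply: L2X; rewrite // sT (le_trans u0).
  by rewrite (iprod_path_integral_diff HG T0 Lu rk u0 ur' rT cF dF') /F; ring.
have Ir : iprod (b u) (path_integral kernel_part r) =
   iprod (b u) (path_integral kernel_part u) +
   iprod (b u) (path_integral kernel_part r - path_integral kernel_part u).
  by rewrite iprodBr//; [rewrite addrC subrK|exact: L2I..].
have LIr := L2I rk rT'.
rewrite /drift iprodZr//; last by apply: square_integrableD => //; exact: square_integrableZ.
rewrite iprodDr//; last exact: square_integrableZ.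
rewrite iprodZr// b_cov// Ir I1 I2 kernel_identity// /iDker clamp_id// mulKf//.
by rewrite gt_eqF// Dker_gt0.
Qed.

Lemma orthogonal_martingale_part u s t : 0 <= u <= s -> s <= t -> t <= T ->
  iprod (b u) (M t - M s) = 0.
Proof.
move=> /andP[u0 us] st tT.
have uT : 0 <= u <= T by rewrite u0 (le_trans us)// (le_trans st).
have sT : 0 <= s <= T by rewrite (le_trans u0 us) (le_trans st).
have tT' : 0 <= t <= T by rewrite tT (le_trans _ st)//; case/andP: sT.
have [s0 sT'] := andP sT.
have Lu := L2X rb uT; have rL := regular_drift.
have -> : M t - M s = (b t - b s) + (path_integral L t - path_integral L s).
  by rewrite /M opprD addrACA.
have LA : L2 (b t - b s) by apply: square_integrableB; exact: L2X.
have LI := regular_path_integral_diff HG rL s0 st tT.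
rewrite iprodDr//.
pose F r := r * (u * (T - u) / T ^+ 2).
have dF r : is_derive r (1 : R) F (u * (T - u) / T ^+ 2).
  by apply: is_derive_eq; rewrite /GRing.scale/=; ring.
have cF : continuous F by move=> r; exact: (is_derive_continuous (dF r)).
have dF' r : s < r < t -> is_derive r (1 : R) F (iprod (b u) (L r)).
  move=> /andP[/ltW sr /ltW rt]; rewrite iprod_drift//; last exact: le_trans rt tT.
  by rewrite u0 (le_trans us sr).
rewrite (iprod_path_integral_diff HG T0 Lu rL s0 st tT cF dF').
rewrite iprodBr//; try exact: L2X.
rewrite !b_cov// ?u0 ?us ?(le_trans us)// /F /cov.
by field; rewrite (gt_eqF T0).
Qed.

(** For r >= s the covariance of [b u] with M_r is a constant [m]. With h = 1/f, the increment of h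
    M then contributes m (h(t) - h(s)), and so does the integral of h' M. *)
Lemma orthogonal_innovation_bridge u s t : 0 <= u <= s -> s <= t -> t <= T ->
  iprod (b u) (innovation t - innovation s) = 0.
Proof.
move=> /andP[u0 us] st tT.
have uT : 0 <= u <= T by rewrite u0 (le_trans us)// (le_trans st).
have sT : 0 <= s <= T by rewrite (le_trans u0 us) (le_trans st).
have tT' : 0 <= t <= T by rewrite tT (le_trans _ st)//; case/andP: sT.
have [s0 sT'] := andP sT.
have Lu := L2X rb uT; have rM := regular_martingale_part; have rV := regular_volatility_part.
pose m := iprod (b u) (M s).
have mE r : s <= r <= t -> iprod (b u) (M r) = m.
  move=> /andP[sr rt]; apply/eqP; rewrite -subr_eq0 -iprodBr//; last exact: L2X.
    by rewrite orthogonal_martingale_part ?u0// (le_trans rt).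
  by apply: L2X => //; rewrite (le_trans s0 sr) (le_trans rt).
pose h := ivolatility T.
pose F r := h r * m.
have dF r : is_derive r (1 : R) F (ivolatility' T r * m).
  have dh := is_derive_ivolatility T0 r; rewrite -/h in dh.
  by rewrite /F; apply: is_derive_eq; rewrite /GRing.scale/=; ring.
have cF : continuous F by move=> r; exact: (is_derive_continuous (dF r)).
have -> : innovation t - innovation s = (cst (h t) * M t - cst (h s) * M s) -
    (path_integral volatility_part t - path_integral volatility_part s).
  by rewrite /innovation -/h funeqE => w; rewrite !fctE; ring.
have LA : L2 (cst (h t) * M t - cst (h s) * M s).
  by apply: square_integrableB; apply: square_integrableZ; exact: L2X.
have LI := regular_path_integral_diff HG rV s0 st tT.
rewrite iprodBr//.
have dF' r : s < r < t -> is_derive r (1 : R) F (iprod (b u) (volatility_part r)).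
  move=> /andP[/ltW sr /ltW rt].
  have LMr : L2 (M r) by apply: L2X => //; rewrite (le_trans s0 sr) (le_trans rt).
  by rewrite /volatility_part (iprodZr _ LMr Lu) mE ?sr.
rewrite (iprod_path_integral_diff HG T0 Lu rV s0 st tT cF dF').
rewrite iprodBr//; try by apply: square_integrableZ; exact: L2X.
rewrite !iprodZr//; try exact: L2X.
by rewrite !mE ?lexx ?st// /F subrr.
Qed.

(** Up to time [s] these processes are limits of linear combinations of the past of the bridge, so
    orthogonality to that past is inherited. *)
Lemma orthogonal_past Y s : L2 Y -> 0 <= s <= T ->
  (forall u, 0 <= u <= s -> iprod Y (b u) = 0) ->
  forall u, 0 <= u <= s -> [/\ iprod Y (L u) = 0, iprod Y (M u) = 0 & iprod Y (innovation u) = 0].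
Proof.
move=> LY /andP[s0 sT] Yb.
have uT u : 0 <= u <= s -> 0 <= u <= T by move=> /andP[-> us]; exact: le_trans us sT.
have sub u r : 0 <= u <= s -> 0 <= r <= u -> 0 <= r <= s.
  by move=> /andP[_ us] /andP[-> ru]; exact: le_trans ru us.
have rk := regular_kernel_part; have rL := regular_drift.
have rM := regular_martingale_part; have rV := regular_volatility_part.
have OI X u (rX : regular X) (us : 0 <= u <= s)
    (XY : forall r, 0 <= r <= u -> iprod Y (X r) = 0) :=
  orthogonal_path_integral HG T0 LY rX (uT u us) XY.
have YL u : 0 <= u <= s -> iprod Y (L u) = 0.
  move=> us; have Lb := L2X rb (uT _ us); have LI := L2I rk (uT _ us).
  rewrite /L iprodZr//; last by apply: square_integrableD => //; exact: square_integrableZ.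
  rewrite iprodDr//; last exact: square_integrableZ.
  rewrite iprodZr// Yb// mulr0 add0r (OI _ _ rk us) ?mulr0//.
  move=> r ru; rewrite iprodZr//; last by apply: L2X => //; apply: uT; exact: sub ru.
  by rewrite Yb ?mulr0//; exact: sub ru.
have YM u : 0 <= u <= s -> iprod Y (M u) = 0.
  move=> us; rewrite /M iprodDr//; [|exact: L2X rb (uT _ us)|exact: L2I rL (uT _ us)].
  rewrite Yb// add0r (OI _ _ rL us)//.
  by move=> r ru; apply: YL; exact: sub ru.
move=> u us; split; [exact: YL|exact: YM|].
have LM r : 0 <= r <= s -> L2 (M r) by move=> rs; apply: L2X => //; exact: uT.
have LI := L2I rV (uT _ us).
have LhM : L2 (cst (ivolatility T u) * M u) by apply: square_integrableZ; exact: LM.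
rewrite /innovation iprodBr// iprodZr// ?YM//; last exact: LM.
rewrite mulr0 sub0r (OI _ _ rV us) ?oppr0//.
move=> r ru; have rs := sub _ _ us ru.
by rewrite /volatility_part (iprodZr _ (LM _ rs) LY) YM ?mulr0.
Qed.

Lemma orthogonal_innovation u s t : 0 <= u <= s -> s <= t -> t <= T ->
  iprod (innovation t - innovation s) (innovation u) = 0.
Proof.
move=> us st tT; have [u0 us'] := andP us; have s0 := le_trans u0 us'.
have sT : 0 <= s <= T by rewrite s0 (le_trans st).
have LY : L2 (innovation t - innovation s).
  apply: square_integrableB; apply: L2X => //; try exact: regular_innovation.
  by rewrite tT (le_trans s0 st).
have Yb r : 0 <= r <= s -> iprod (innovation t - innovation s) (b r) = 0.
  by move=> rs; rewrite iprodC; exact: orthogonal_innovation_bridge.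
by have [] := orthogonal_past LY sT Yb us.
Qed.

End Innovation.

(** Over an equal subdivision finer than [r], the increments add up to at most [e * t]. This plays
    the role of a vanishing derivative. *)
Lemma constant_of_small_increments {R : realType} (phi : R -> R) t : 0 <= t ->
  (forall e, 0 < e -> exists2 r, 0 < r & forall a b, 0 <= a -> a <= b -> b <= t ->
     b - a < r -> `|phi b - phi a| <= e * (b - a)) ->
  phi t = phi 0.
Proof.
move=> t0 H; apply/eqP; rewrite -subr_eq0 -normr_eq0 eq_le normr_ge0 andbT.
apply/ler_addgt0Pl => e e0; rewrite addr0.
have [r r0 rP] := H (e / (t + 1)) (divr_gt0 e0 (ltr_wpDl t0 ltr01)).
have [n _ nP] : \forall n \near \oo, t / r < n%:R by exact: nbhs_infty_gtr.
have n0 : 0 < n.+1%:R :> R by rewrite ltr0n.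
pose x (k : nat) : R := k%:R * (t / n.+1%:R).
have xS k : x k.+1 - x k = t / n.+1%:R by rewrite /x -natr1; ring.
have h0 : 0 <= t / n.+1%:R by rewrite divr_ge0.
have xn : x n.+1 = t by rewrite /x mulrC divfK// gt_eqF.
have -> : phi t - phi 0 = \sum_(0 <= k < n.+1) (phi (x k.+1) - phi (x k)).
  by rewrite telescope_sumr// xn /x mul0r.
rewrite big_mkord; apply: le_trans (ler_norm_sum _ _ _) _.
apply: (@le_trans _ _ (\sum_(k < n.+1) e / (t + 1) * (t / n.+1%:R))).
  apply: ler_sum => k _; rewrite -(xS k); apply: rP.
  - by rewrite /x mulr_ge0.
  - by rewrite -subr_ge0 xS.
  - by rewrite -[leRHS]xn /x ler_wpM2r// ler_nat.
  - rewrite xS ltr_pdivrMr// -ltr_pdivrMl// mulrC (lt_trans (nP n _))//=.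
    by rewrite ltr_nat.
rewrite sumr_const card_ord -[leLHS]mulr_natl mulrCA (mulrC n.+1%:R) divfK ?gt_eqF//.
by rewrite mulrAC ler_pdivrMr ?ltr_wpDl// ler_wpM2l ?lerDl// ltW.
Qed.

Section BridgeIncrement.
Context {d : measure_display} {Omega : measurableType d} {R : realType}.
Variable P : probability Omega R.
Local Notation L2 := (square_integrable P).
Local Notation iprod := (iprod P).
Implicit Types (Y : Omega -> R) (s t : R).

Lemma iprod_sqrB Y1 Y2 : L2 Y1 -> L2 Y2 ->
  iprod (Y1 - Y2) (Y1 - Y2) = iprod Y1 Y1 - 2 * iprod Y1 Y2 + iprod Y2 Y2.
Proof.
move=> L1 L2'; have LB := square_integrableB L1 L2'.
by rewrite iprodBl// !iprodBr// (iprodC _ Y2 Y1); ring.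
Qed.

Lemma iprod_sqrD Y1 Y2 : L2 Y1 -> L2 Y2 ->
  iprod (Y1 + Y2) (Y1 + Y2) = iprod Y1 Y1 + 2 * iprod Y1 Y2 + iprod Y2 Y2.
Proof.
move=> L1 L2'; have LB := square_integrableD L1 L2'.
by rewrite iprodDl// !iprodDr// (iprodC _ Y2 Y1); ring.
Qed.

Lemma iprod_sqrB_orthogonal Y1 Y2 : L2 Y1 -> L2 Y2 -> iprod (Y1 - Y2) Y2 = 0 ->
  iprod (Y1 - Y2) (Y1 - Y2) = iprod Y1 Y1 - iprod Y2 Y2.
Proof.
move=> L1 L2'; rewrite iprodBl// => /eqP; rewrite subr_eq0 => /eqP E.
by rewrite iprod_sqrB// E; ring.
Qed.

Variables (T : R) (b : R -> Omega -> R).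
Hypotheses (T0 : 0 < T) (Lb : forall t, 0 <= t <= T -> L2 (b t)).
Hypothesis b_cov : forall s t, 0 <= s <= t -> t <= T -> iprod (b s) (b t) = cov T s t.

Lemma bridge_increment s t : 0 <= s <= t -> t <= T ->
  iprod (b t - b s) (b t - b s) =
  (t - s) * (1 - (t - s) / T + (t ^+ 2 + t * s - s ^+ 2) / T ^+ 2).
Proof.
move=> /andP[s0 st] tT.
have Ls : L2 (b s) by apply: Lb; rewrite // s0 (le_trans st).
have Lt : L2 (b t) by apply: Lb; rewrite // tT (le_trans s0).
rewrite iprod_sqrB// (iprodC _ (b t) (b s)) !b_cov ?s0 ?st ?lexx ?(le_trans s0) ?(le_trans st)//.
by rewrite /cov; field; rewrite gt_eqF.
Qed.

Lemma bridge_increment_le s t : 0 <= s <= t -> t <= T ->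
  iprod (b t - b s) (b t - b s) <= 3 * (t - s).
Proof.
move=> /andP[s0 st] tT; rewrite bridge_increment ?s0// mulrC ler_wpM2r ?subr_ge0//.
have h1 : 0 <= (t - s) / T by rewrite divr_ge0 ?subr_ge0// ltW.
(* The constant 3 is 1 plus this 2; the term [- (t - s) / T] only helps. *)
suff : (t ^+ 2 + t * s - s ^+ 2) / T ^+ 2 <= 2 by lra.
by rewrite ler_pdivrMr ?exprn_gt0//; nra.
Qed.

End BridgeIncrement.

(** * The variance of the innovation *)

Section InnovationVariance.
Context {d : measure_display} {Omega : measurableType d} {R : realType}.
Variables (P : probability Omega R) (H : set (Omega -> R)) (T : R).
Variable G : R -> set (set Omega).
Hypotheses (HG : gaussian_space P H) (T0 : 0 < T).
Hypothesis G_mono : forall s t, s <= t -> G s `<=` G t.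
Local Notation L2 := (square_integrable P).
Local Notation regular := (regular P H T G).
Local Notation iprod := (iprod P).
Local Notation norm2 := (norm2 P).
Implicit Types (X : R -> Omega -> R) (Y : Omega -> R) (s t u r : R).

Lemma regular_integral_lipschitz X : regular X -> exists2 K, 0 <= K &
  forall s t, 0 <= s -> s <= t -> t <= T ->
    norm2 (path_integral X t - path_integral X s) <= K * (t - s).
Proof.
move=> rX; have [K K0 KP] := regular_bounded rX; exists K => // s t s0 st tT.
have H1 u : s <= u <= t -> 0 <= u <= T.
  by move=> /andP[su ut]; rewrite (le_trans s0)// (le_trans ut).
have [] := @path_integral_norm2 _ _ _ P X (cst K) s t s0 st (regular_path rX).
- by move=> u; exact: cvg_cst.
- by move=> u /H1 uT; exact: (regular_square_integrable HG rX uT).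
- by move=> u /H1; exact: KP.
by rewrite !primitive_cst ?(le_trans s0)// -mulrBl mulrC.
Qed.

Variable b : R -> Omega -> R.
Hypotheses (rb : regular b) (b0 : b 0 = 0).
Hypothesis b_cov : forall s t, 0 <= s <= t -> t <= T -> iprod (b s) (b t) = cov T s t.

Local Notation L := (drift T b).
Local Notation M := (martingale_part T b).
Local Notation V := (volatility_part T b).
Local Notation beta' := (innovation T b).

Let L2X X t : regular X -> 0 <= t <= T -> L2 (X t).
Proof. exact: regular_square_integrable. Qed.

Let Lb t : 0 <= t <= T -> L2 (b t) := L2X rb.

Let rL : regular L := regular_drift HG T0 G_mono rb.
Let rM : regular M := regular_martingale_part HG T0 G_mono rb.
Let rV : regular V := regular_volatility_part HG T0 G_mono rb.
Let rI : regular beta' := regular_innovation HG T0 G_mono rb.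

Lemma ivolatility_lipschitz s t : 0 <= s -> s <= t -> t <= T ->
  `|ivolatility T t - ivolatility T s| <= T^-1 * (t - s).
Proof.
move=> s0; rewrite le_eqVlt => /predU1P[->|st] tT; first by rewrite !subrr normr0 mulr0.
have dh u : s < u < t -> is_derive u (1 : R) (ivolatility T) (ivolatility' T u).
  by move=> _; exact: is_derive_ivolatility.
have ch := continuous_ivolatility T0; have ch' := continuous_ivolatility' T0.
rewrite -(primitive_diff s0 (ltW st) ch ch' dh).
have [c /andP[sc ct] ->] := primitive_MVT ch' s0 st.
rewrite normrM (gtr0_norm (x := t - s)) ?subr_gt0// ler_wpM2r ?subr_ge0 ?(ltW st)//.
have c0 : 0 <= c by rewrite (le_trans s0)// ltW.
have v1 : 1 <= volatility T c.
  by rewrite -invf_le1 ?volatility_gt0//; exact: ivolatility_le1.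
rewrite /ivolatility' normrN ger0_norm; last first.
  by rewrite divr_ge0// mulr_ge0 ?exprn_ge0// ?sqr_ge0// ltW// volatility_gt0.
rewrite ler_pdivrMr; last by rewrite mulr_gt0// exprn_gt0// volatility_gt0.
have -> : T^-1 * (T ^+ 2 * volatility T c ^+ 3) = T * volatility T c ^+ 3.
  by field; rewrite gt_eqF.
rewrite (le_trans (ltW (lt_le_trans ct tT)))// ler_peMr ?(ltW T0)//.
by rewrite exprn_ege1.
Qed.

(** Besides the bridge increment weighted by 1/f(s), an increment of the innovation consists of
    integrals of L2-bounded processes and of a Lipschitz coefficient times M. Its remainder is of
    order [t - s], against the square root of [t - s] for the bridge. *)
Lemma innovation_remainder : exists2 C, 0 <= C &
  forall s t, 0 <= s -> s <= t -> t <= T ->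
    L2 (beta' t - beta' s - cst (ivolatility T s) * (b t - b s)) /\
    norm2 (beta' t - beta' s - cst (ivolatility T s) * (b t - b s)) <= C * (t - s).
Proof.
have [KL KL0 KLP] := regular_integral_lipschitz rL.
have [KV KV0 KVP] := regular_integral_lipschitz rV.
have [KM KM0 KMP] := regular_bounded rM.
exists (KL + T^-1 * KM + KV).
  by rewrite !addr_ge0// mulr_ge0// invr_ge0 ltW.
move=> s t s0 st tT; have st0 : 0 <= t - s by rewrite subr_ge0.
have sT : 0 <= s <= T by rewrite s0 (le_trans st).
have tT' : 0 <= t <= T by rewrite tT (le_trans s0).
have LL := regular_path_integral_diff HG rL s0 st tT.
have LV := regular_path_integral_diff HG rV s0 st tT.
have LM := L2X rM tT'.
have -> : beta' t - beta' s - cst (ivolatility T s) * (b t - b s) =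
   cst (ivolatility T s) * (path_integral L t - path_integral L s) +
   cst (ivolatility T t - ivolatility T s) * M t -
   (path_integral V t - path_integral V s).
  have ME r : M r = b r + path_integral L r by [].
  rewrite /innovation !ME; move: (path_integral V t) (path_integral V s).
  move: (path_integral L t) (path_integral L s) (b t) (b s).
  move: (ivolatility T s) (ivolatility T t) => *.
  by rewrite funeqE => w; rewrite !fctE; ring.
have LA := square_integrableZ (ivolatility T s) LL.
have LB := square_integrableZ (ivolatility T t - ivolatility T s) LM.
have LAB := square_integrableD LA LB.
split; first exact: square_integrableB.
apply: le_trans (norm2B LAB LV) _; rewrite [leRHS]mulrDl lerD//; last exact: KVP.
apply: le_trans (norm2D LA LB) _; rewrite [leRHS]mulrDl lerD//.
  rewrite norm2Z// -[leRHS]mul1r ler_pM ?norm2_ge0//; last exact: KLP.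
  by rewrite ger0_norm ?ivolatility_le1// invr_ge0 ltW// volatility_gt0.
rewrite norm2Z// mulrAC ler_pM ?norm2_ge0//; last exact: KMP.
exact: ivolatility_lipschitz.
Qed.

Lemma iprod_innovation_increment s t : 0 <= s <= t -> t <= T ->
  iprod (beta' t - beta' s) (beta' t - beta' s) =
  iprod (beta' t) (beta' t) - iprod (beta' s) (beta' s).
Proof.
move=> /andP[s0 st] tT.
have Ls : L2 (beta' s) by apply: L2X; rewrite // s0 (le_trans st).
have Lt : L2 (beta' t) by apply: L2X; rewrite // tT (le_trans s0).
have ss : 0 <= s <= s by rewrite s0 lexx.
apply: (iprod_sqrB_orthogonal Lt Ls).
exact: (orthogonal_innovation HG T0 G_mono rb b_cov ss st tT).
Qed.

(** The substitute for computing the bracket of M: to first order a bridge increment has variance (1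
    + s^2 / T^2) (t - s), which the factor 1 / f(s)^2 reduces to t - s; the other terms are of
    higher order. *)
Lemma innovation_increment_small e : 0 < e -> exists2 r, 0 < r &
  forall s t, 0 <= s -> s <= t -> t <= T -> t - s < r ->
    `|iprod (beta' t - beta' s) (beta' t - beta' s) - (t - s)| <= e * (t - s).
Proof.
move=> e0; have [C C0 CP] := innovation_remainder.
(* Weight in the inequality 2 x z <= eta x^2 + z^2 / eta for the cross term: as x^2 <= 3 (t - s),
   its first part costs e (t - s) / 2. *)
pose eta := e / 6; have eta0 : 0 < eta by rewrite divr_gt0.
(* Coefficients of (t - s)^2 coming from the bridge increment, the cross term and the square of the
   remainder. *)
pose K := 4 / T + C ^+ 2 / eta + C ^+ 2.
have K0 : 0 < K.
  apply: ltr_wpDr; first exact: sqr_ge0.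
  by apply: ltr_wpDr; [rewrite divr_ge0 ?sqr_ge0// ltW|rewrite divr_gt0].
exists (e / 2 / K); first by rewrite !divr_gt0.
move=> s t s0 st tT tsr.
have sT : 0 <= s <= T by rewrite s0 (le_trans st).
have tT' : 0 <= t <= T by rewrite tT (le_trans s0).
have [] := CP s t s0 st tT; set X := b t - b s; set h := ivolatility T s.
set D := beta' t - beta' s; set Z := D - cst h * X => LZ nZ.
have LX : L2 X by apply: square_integrableB; exact: L2X.
have LhX := square_integrableZ h LX.
have -> : D = cst h * X + Z by rewrite /Z addrC subrK.
rewrite iprod_sqrD// (iprodZl _ LX LhX) (iprodZr _ LX LX) (iprodZl _ LX LZ).
set x := iprod X X; set y := iprod X Z; set z := iprod Z Z.
have ts0 : 0 <= t - s by rewrite subr_ge0.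
have h0 : 0 <= h by rewrite invr_ge0 ltW// volatility_gt0.
have h1 : h <= 1 by exact: ivolatility_le1.
have nX : norm2 X ^+ 2 <= 3 * (t - s) by rewrite norm2_sqr (bridge_increment_le T0 Lb b_cov)// s0.
have zC : z <= (C * (t - s)) ^+ 2.
  by rewrite /z -norm2_le// mulr_ge0.
have yb : 2 * `|y| <= eta * (3 * (t - s)) + (C * (t - s)) ^+ 2 / eta.
  have y1 := norm2_cauchy_schwarz LX LZ; rewrite -/y in y1.
  have n2 : norm2 Z ^+ 2 <= (C * (t - s)) ^+ 2 by rewrite norm2_sqr.
  have amgm : 2 * (norm2 X * norm2 Z) <= eta * norm2 X ^+ 2 + norm2 Z ^+ 2 / eta.
    rewrite -subr_ge0.
    have -> : eta * norm2 X ^+ 2 + norm2 Z ^+ 2 / eta - 2 * (norm2 X * norm2 Z) =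
      (eta * norm2 X - norm2 Z) ^+ 2 / eta by field; rewrite gt_eqF.
    by rewrite divr_ge0 ?sqr_ge0// ltW.
  have m1 : eta * norm2 X ^+ 2 <= eta * (3 * (t - s)) by rewrite ler_wpM2l// ltW.
  have m2 : norm2 Z ^+ 2 / eta <= (C * (t - s)) ^+ 2 / eta.
    by rewrite ler_wpM2r// invr_ge0 ltW.
  lra.
(* By [bridge_increment] and h^2 (1 + s^2 / T^2) = 1 the difference is h^2 ((t + 2 s) / T^2 - 1 / T)
   (t - s)^2, where h <= 1 and t + 2 s <= 3 T. *)
have xb : `|h * (h * x) - (t - s)| <= 4 / T * (t - s) ^+ 2.
  have hv : h ^+ 2 * (1 + s ^+ 2 / T ^+ 2) = 1.
    rewrite -volatility_sqr// /h /ivolatility -exprMn mulVf ?expr1n//.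
    by rewrite gt_eqF// volatility_gt0.
  have -> : h * (h * x) - (t - s) =
    h ^+ 2 * (((t + 2 * s) / T ^+ 2 - T^-1) * (t - s) ^+ 2).
    rewrite /x (bridge_increment T0 Lb b_cov) ?s0//.
    have tsE : t - s = (t - s) * (h ^+ 2 * (1 + s ^+ 2 / T ^+ 2)) by rewrite hv mulr1.
    by rewrite [X in _ - X = _]tsE; field; rewrite gt_eqF.
  rewrite normrM ger0_norm ?sqr_ge0// normrM (ger0_norm (sqr_ge0 _)).
  rewrite -[leRHS]mul1r ler_pM ?sqr_ge0 ?mulr_ge0 ?sqr_ge0//.
    by rewrite expr_le1.
  rewrite ler_wpM2r ?sqr_ge0//.
  apply: le_trans (ler_normB _ _) _.
  rewrite !ger0_norm ?invr_ge0 ?(ltW T0)//; last first.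
    by rewrite divr_ge0 ?sqr_ge0// addr_ge0 ?mulr_ge0// (le_trans s0).
  have : (t + 2 * s) / T ^+ 2 <= 3 / T.
    rewrite ler_pdivrMr ?exprn_gt0//.
    have -> : 3 / T * T ^+ 2 = 3 * T by field; rewrite gt_eqF.
    by case/andP: sT; lra.
  have -> : 4 / T = 3 / T + T^-1 by field; rewrite gt_eqF.
  lra.
have z0 : 0 <= z by exact: iprod_ge0.
have hy : `|h * y| <= `|y|.
  by rewrite normrM (ger0_norm h0) -[leRHS]mul1r ler_wpM2r.
have -> : h * (h * x) + 2 * (h * y) + z - (t - s) =
  (h * (h * x) - (t - s)) + (h * y) + (h * y) + z by ring.
have tri : `|(h * (h * x) - (t - s)) + h * y + h * y + z| <=
    `|h * (h * x) - (t - s)| + `|h * y| + `|h * y| + z.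
  rewrite -[in leRHS](ger0_norm z0).
  by do 2 (apply: le_trans (ler_normD _ _) _; rewrite lerD2r); exact: ler_normD.
apply: le_trans tri _.
apply: (@le_trans _ _ ((t - s) * (e / 2 + K * (t - s)))).
  have -> : (t - s) * (e / 2 + K * (t - s)) = 4 / T * (t - s) ^+ 2 +
     (eta * (3 * (t - s)) + (C * (t - s)) ^+ 2 / eta) + (C * (t - s)) ^+ 2.
    rewrite /K /eta; field.
    by rewrite !gt_eqF.
  lra.
rewrite mulrC ler_wpM2r//.
move: tsr; rewrite ltr_pdivlMr// mulrC => /ltW; lra.
Qed.

Lemma innovation0 : beta' 0 = 0.
Proof.
by rewrite /innovation /martingale_part b0 !path_integral0 addr0 mulr0 subr0.
Qed.

Lemma innovation_variance t : 0 <= t <= T -> iprod (beta' t) (beta' t) = t.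
Proof.
move=> /andP[t0 tT].
pose phi u := iprod (beta' u) (beta' u) - u.
suff : phi t = phi 0 by rewrite /phi innovation0 iprod0l subrr => /eqP; rewrite subr_eq0 => /eqP.
apply: constant_of_small_increments => // e e0.
have [r r0 rP] := innovation_increment_small e0.
exists r => // a c a0 ac ct acr; have cT := le_trans ct tT.
have := rP a c a0 ac cT acr; rewrite iprod_innovation_increment ?a0//.
rewrite /phi; move: (iprod (beta' c) _) (iprod (beta' a) _) => x y.
by have -> : x - c - (y - a) = x - y - (c - a) by ring.
Qed.

Lemma innovation_increment_variance s t : 0 <= s <= t -> t <= T ->
  iprod (beta' t - beta' s) (beta' t - beta' s) = t - s.
Proof.
move=> st tT; have [s0 st'] := andP st; rewrite iprod_innovation_increment//.
by rewrite !innovation_variance// ?s0 ?tT ?(le_trans st')// (le_trans s0).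
Qed.

End InnovationVariance.

(** * Stochastic integrals of deterministic functions *)

Section Chebyshev.
Context {d : measure_display} {Omega : measurableType d} {R : realType}.
Variable P : probability Omega R.
Local Notation L2 := (square_integrable P).
Implicit Types (X : R -> Omega -> R) (Y : Omega -> R) (s t u r : R).

Lemma measurable_norm_gt Y eps : measurable_fun setT Y -> measurable [set w | eps < `|Y w|].
Proof.
move=> mY; have mN : measurable_fun setT (fun w => `|Y w|) by apply: measurableT_comp.
rewrite -[X in measurable X]setTI.
have -> : [set w | eps < `|Y w|] = (fun w => `|Y w|) @^-1` `]eps, +oo[%classic.
  by apply/seteqP; split => w /=; rewrite in_itv/= andbT.
exact: mN.
Qed.

Lemma chebyshev_norm2 Y r eps : L2 Y -> norm2 P Y <= r -> 0 < eps ->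
  (P [set w | (eps < `|Y w|)%R] <= ((r / eps) ^+ 2)%:E)%E.
Proof.
move=> LY Yr eps0; have [mY _] := LY.
have mA := measurable_norm_gt eps mY.
have e2 : 0 < eps ^+ 2 by rewrite exprn_gt0.
have r0 : 0 <= r by exact: le_trans (norm2_ge0 _ _) Yr.
have : ((eps ^+ 2)%:E * P [set w | (eps < `|Y w|)%R] <= (r ^+ 2)%:E)%E.
  apply: (@le_trans _ _ (\int[P]_w (Y w ^+ 2)%:E)%E); last first.
    by rewrite -iprodE// lee_fin -norm2_le.
  rewrite -(integral_cst P mA (eps ^+ 2)%:E) integral_mkcond.
  apply: ge0_le_integral => //.
  - by move=> w _; rewrite patchE; case: ifP => // _; rewrite lee_fin ltW.
  - apply/(measurable_restrictT _ mA); exact: measurable_cst.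
  - by apply/measurable_EFinP; exact: measurable_funX.
  - move=> w _; rewrite patchE; case: ifPn => [|_]; last by rewrite lee_fin sqr_ge0.
    rewrite inE /= => /ltW eY; rewrite lee_fin -[leRHS]real_normK ?num_real//.
    by rewrite ler_sqr// nnegrE ?normr_ge0 ?(ltW eps0).
rewrite -lee_pdivlMl// => /le_trans; apply.
by rewrite -EFinM lee_fin expr_div_n mulrC.
Qed.

Lemma iprod_orthogonal_sum (D : nat -> Omega -> R) n :
  (forall i, (i < n)%N -> L2 (D i)) ->
  (forall i j, (i < j < n)%N -> iprod P (D j) (D i) = 0) ->
  iprod P (\sum_(0 <= i < n) D i) (\sum_(0 <= i < n) D i) =
  \sum_(0 <= i < n) iprod P (D i) (D i).
Proof.
elim: n => [|n IH] LD oD; first by rewrite !big_nil iprod0l.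
rewrite !big_nat_recr//= -IH; first last.
- by move=> i j /andP[ij jn]; apply: oD; rewrite ij (ltn_trans jn).
- by move=> i ni; apply: LD; exact: ltn_trans ni _.
have LS : L2 (\sum_(0 <= i < n) D i).
  rewrite big_mkord; apply: square_integrable_sum => i _; apply: LD.
  exact: ltn_trans (ltn_ord i) _.
have LDn : L2 (D n) by exact: LD.
rewrite iprod_sqrD//; suff -> : iprod P (\sum_(0 <= i < n) D i) (D n) = 0 by ring.
rewrite big_mkord iprod_suml//; last first.
  by move=> i _; apply: LD; exact: ltn_trans (ltn_ord i) _.
by apply: big1 => i _; rewrite iprodC oD// ltn_ord ltnSn.
Qed.

End Chebyshev.

Section StochasticIntegral.
Context {d : measure_display} {Omega : measurableType d} {R : realType}.
Variables (P : probability Omega R) (H : set (Omega -> R)) (T : R).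
Variable G : R -> set (set Omega).
Hypotheses (HG : gaussian_space P H) (T0 : 0 < T).
Hypothesis G_mono : forall s t, s <= t -> G s `<=` G t.
Local Notation L2 := (square_integrable P).
Local Notation regular := (regular P H T G).
Local Notation iprod := (iprod P).
Local Notation norm2 := (norm2 P).
Implicit Types (X : R -> Omega -> R) (Y : Omega -> R) (s t u r a b c : R).

Variables f f' : R -> R.
Hypotheses (df : forall s, is_derive s (1 : R) f (f' s)) (cf' : continuous f').

Let cf : continuous f. Proof. by move=> s; exact: (is_derive_continuous (df s)). Qed.

Definition weighted X s : Omega -> R := cst (f' s) * X s.

(* Integration by parts: the stochastic integral of [f] against [X] over [0, t]. *)
Definition by_parts X t : Omega -> R :=
  cst (f t) * X t - cst (f 0) * X 0 - path_integral (weighted X) t.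

(* The error on the step [a, b] when the integrand is replaced by [c]. *)
Definition step_error X c a b : Omega -> R :=
  cst (c - f b) * (X b - X a) - cst (f b - f a) * X a +
  (path_integral (weighted X) b - path_integral (weighted X) a).

Lemma step_errorE X c a b :
  cst c * (X b - X a) - (by_parts X b - by_parts X a) = step_error X c a b.
Proof.
rewrite /by_parts /step_error; move: (path_integral _ b) (path_integral _ a) => p q.
move: (X a) (X b) (X 0) (f a) (f b) (f 0) => *.
by rewrite funeqE => w; rewrite !fctE; ring.
Qed.

Lemma regular_weighted X : regular X -> regular (weighted X).
Proof. exact: (regularM HG cf'). Qed.

Let L2X X t : regular X -> 0 <= t <= T -> L2 (X t).
Proof. exact: regular_square_integrable. Qed.

Lemma step_error_square_integrable X c a b : regular X -> 0 <= a -> a <= b -> b <= T ->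
  L2 (step_error X c a b).
Proof.
move=> rX a0 ab bT.
have La : L2 (X a) by apply: L2X; rewrite // a0 (le_trans ab).
have Lb : L2 (X b) by apply: L2X; rewrite // bT (le_trans a0).
apply: square_integrableD.
  by apply: square_integrableB; apply: square_integrableZ => //; exact: square_integrableB.
exact: (regular_path_integral_diff HG (regular_weighted rX)).
Qed.

Lemma by_parts_square_integrable X t : regular X -> 0 <= t <= T -> L2 (by_parts X t).
Proof.
move=> rX tT.
have L0 : L2 (X 0) by apply: L2X; rewrite // lexx ltW.
apply: square_integrableB.
  by apply: square_integrableB; apply: square_integrableZ => //; exact: L2X.
exact: (regular_path_integralL2 HG (regular_weighted rX)).
Qed.

(** Centred at [X a], the error is (c - f(b)) (X_b - X_a) plus the integral of f' (X - X_a). The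
    first term costs [delta * om]; as f' >= 0, the second costs om (f(b) - f(a)) <= 2 delta om,
    since f is within [delta] of [c] at both ends. *)
Lemma step_error_norm2 X c a b delta om : regular X -> 0 <= a -> a <= b -> b <= T ->
  (forall s, a <= s <= b -> 0 <= f' s) ->
  `|c - f a| <= delta -> `|c - f b| <= delta ->
  (forall s, a <= s <= b -> norm2 (X s - X a) <= om) ->
  norm2 (step_error X c a b) <= 3 * delta * om.
Proof.
move=> rX a0 ab bT f'0 ca cb Xom.
have La : L2 (X a) by apply: L2X; rewrite // a0 (le_trans ab).
have Lb : L2 (X b) by apply: L2X; rewrite // bT (le_trans a0).
have om0 : 0 <= om by apply: le_trans (norm2_ge0 _ _) (Xom a _); rewrite lexx.
have delta0 : 0 <= delta by exact: le_trans (normr_ge0 _) ca.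
pose X' s : Omega -> R := cst (f' s) * (X s - X a).
have X'E t w : 0 <= t -> path_integral X' t w =
    path_integral (weighted X) t w - (f t - f 0) * X a w.
  move=> t0; rewrite /path_integral.
  have cw : continuous (weighted X ^~ w) := regular_path (regular_weighted rX) (w := w).
  pose F u := primitive (weighted X ^~ w) u - f u * X a w.
  transitivity (F t - F 0); last by rewrite /F primitive0; ring.
  apply: primitive_unique => //.
  - move=> s; apply: cvgB; first exact: continuous_primitive.
    by apply: cvgM; [exact: cf|exact: cvg_cst].
  - move=> s; apply: cvgM; first exact: cf'.
    by apply: cvgB; [exact: (regular_path rX)|exact: cvg_cst].
  - move=> s /andP[s0 _]; have dp := is_derive_primitive cw s0; have dfs := df s.
    rewrite /F; apply: is_derive_eq; rewrite /GRing.scale/=.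
    by rewrite -[weighted X s w]/(f' s * X s w) -[X' s w]/(f' s * (X s w - X a w)); ring.
have -> : step_error X c a b =
    cst (c - f b) * (X b - X a) + (path_integral X' b - path_integral X' a).
  rewrite /step_error funeqE => w; rewrite !fctE !X'E ?(le_trans a0)//.
  by move: (path_integral _ b w) (path_integral _ a w) => p q; ring.
have H1 s : a <= s <= b -> L2 (X s).
  by move=> /andP[as_ sb]; apply: L2X; rewrite // (le_trans a0 as_) (le_trans sb).
have := @path_integral_norm2 _ _ _ P X' (fun s => om * f' s) a b a0 ab.
case.
- move=> w s; apply: cvgM; first exact: cf'.
  by apply: cvgB; [exact: (regular_path rX)|exact: cvg_cst].
- by move=> s; apply: cvgM; [exact: cvg_cst|exact: cf'].
- by move=> s /H1 LXs; apply: square_integrableZ; exact: square_integrableB.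
- move=> s sab; have LXs := H1 s sab; rewrite norm2Z; last exact: square_integrableB.
  by rewrite ger0_norm ?f'0// mulrC ler_wpM2r ?f'0// Xom.
move=> LI; have dof s : a < s < b -> is_derive s (1 : R) (fun s => om * f s) (om * f' s).
  by move=> _; have dfs := df s; apply: is_derive_eq; rewrite /GRing.scale/=; ring.
rewrite (primitive_diff a0 ab _ _ dof); first last.
- by move=> s; apply: cvgM; [exact: cvg_cst|exact: cf'].
- by move=> s; apply: cvgM; [exact: cvg_cst|exact: cf].
move=> nI; apply: le_trans (norm2D _ LI) _.
  by apply: square_integrableZ; exact: square_integrableB.
rewrite norm2Z; last exact: square_integrableB.
have n1 : `|c - f b| * norm2 (X b - X a) <= delta * om.
  by rewrite ler_pM ?norm2_ge0// Xom// ab lexx.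
have n2 : om * f b - om * f a <= 2 * delta * om.
  rewrite -mulrBr mulrC ler_wpM2r//.
  by move: ca cb; rewrite !ler_norml => /andP[? ?] /andP[? ?]; lra.
by move: n1 n2 nI; lra.
Qed.

(** The covariance of X_u with X_s is a constant [m] for s in [a, b], so the boundary term and the
    integral contribute - m (f(b) - f(a)) and + m (f(b) - f(a)). *)
Lemma step_error_orthogonal X c a b u : regular X ->
  (forall u s t, 0 <= u <= s -> s <= t -> t <= T -> iprod (X t - X s) (X u) = 0) ->
  0 <= u <= a -> a <= b -> b <= T ->
  iprod (step_error X c a b) (X u) = 0.
Proof.
move=> rX oX /andP[u0 ua] ab bT.
have a0 := le_trans u0 ua.
have LX s : 0 <= s <= b -> L2 (X s).
  by move=> /andP[s0 sb]; apply: L2X; rewrite // s0 (le_trans sb).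
have Lu : L2 (X u) by apply: LX; rewrite u0 (le_trans ua).
have La : L2 (X a) by apply: LX; rewrite a0.
have Lb : L2 (X b) by apply: LX; rewrite lexx (le_trans a0).
have Lab := square_integrableB Lb La.
have LI := regular_path_integral_diff HG (regular_weighted rX) a0 ab bT.
pose m := iprod (X u) (X a).
have mE s : a <= s <= b -> iprod (X u) (X s) = m.
  move=> /andP[as_ sb]; have sT := le_trans sb bT.
  have Ls : L2 (X s) by apply: LX; rewrite sb (le_trans a0).
  by apply/eqP; rewrite -subr_eq0 /m -(iprodBr Ls La Lu) iprodC oX ?u0.
pose F s := m * f s.
have cF : continuous F by move=> s; apply: cvgM; [exact: cvg_cst|exact: cf].
have dF s : a < s < b -> is_derive s (1 : R) F (iprod (X u) (weighted X s)).
  move=> /andP[as_ sb]; have Ls : L2 (X s) by apply: LX; rewrite (ltW sb) (le_trans a0)// ltW.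
  rewrite (iprodZr _ Ls Lu) mE ?(ltW as_) ?(ltW sb)//.
  by have dfs := df s; rewrite /F; apply: is_derive_eq; rewrite /GRing.scale/=; ring.
have IE := iprod_path_integral_diff HG T0 Lu (regular_weighted rX) a0 ab bT cF dF.
have LA := square_integrableZ (c - f b) Lab.
have LB := square_integrableZ (f b - f a) La.
rewrite /step_error (iprodDl (square_integrableB LA LB) LI Lu) (iprodBl LA LB Lu).
rewrite (iprodZl _ Lab Lu) (iprodZl _ La Lu) oX ?u0//.
by rewrite (iprodC _ (path_integral _ b - _)) IE -(iprodC _ (X u)) /F -/m; ring.
Qed.

(** The earlier error is a linear functional of [X] on [0, b'], and the later one is orthogonal to
    each of these variables. *)
Lemma step_error_orthogonal2 X c a b c' a' b' : regular X ->
  (forall u s t, 0 <= u <= s -> s <= t -> t <= T -> iprod (X t - X s) (X u) = 0) ->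
  0 <= a' -> a' <= b' -> b' <= a -> a <= b -> b <= T ->
  iprod (step_error X c a b) (step_error X c' a' b') = 0.
Proof.
move=> rX oX a'0 a'b' b'a ab bT.
have b'0 := le_trans a'0 a'b'; have a0 := le_trans b'0 b'a.
have b'T : b' <= T by rewrite (le_trans b'a)// (le_trans ab).
have LD := step_error_square_integrable c rX a0 ab bT.
set D := step_error X c a b in LD *.
have DX u : 0 <= u <= b' -> iprod D (X u) = 0.
  move=> /andP[u0 ub]; apply: step_error_orthogonal => //.
  by rewrite u0 (le_trans ub).
have LX u : 0 <= u <= b' -> L2 (X u).
  by move=> /andP[u0 ub]; apply: L2X; rewrite // u0 (le_trans ub).
have DI u : 0 <= u <= b' -> iprod D (path_integral (weighted X) u) = 0.
  move=> /andP[u0 ub]; have uT : 0 <= u <= T by rewrite u0 (le_trans ub).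
  apply: (orthogonal_path_integral HG T0 LD (regular_weighted rX) uT) => s /andP[s0 su].
  have sb : 0 <= s <= b' by rewrite s0 (le_trans su).
  by rewrite (iprodZr _ (LX _ sb) LD) DX ?mulr0.
have a'b : 0 <= a' <= b' by rewrite a'0.
have b'b : 0 <= b' <= b' by rewrite b'0 lexx.
have La := LX _ a'b; have Lb := LX _ b'b.
have LIa : L2 (path_integral (weighted X) a').
  by apply: (regular_path_integralL2 HG (regular_weighted rX)); rewrite a'0 (le_trans a'b').
have LIb : L2 (path_integral (weighted X) b').
  by apply: (regular_path_integralL2 HG (regular_weighted rX)); rewrite b'0.
have LBA := square_integrableB Lb La.
have L1 := square_integrableZ (c' - f b') LBA.
have L3 := square_integrableZ (f b' - f a') La.
rewrite [X in iprod D X]/step_error.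
rewrite (iprodDr (square_integrableB L1 L3) (square_integrableB LIb LIa) LD).
rewrite (iprodBr L1 L3 LD) (iprodBr LIb LIa LD) (iprodZr _ LBA LD) (iprodZr _ La LD).
by rewrite (iprodBr Lb La LD) !DX// !DI//; ring.
Qed.

Section Partition.
Variables (X : R -> Omega -> R) (t delta : R) (p : seq R) (c : nat -> R).
Hypotheses (rX : regular X) (t0 : 0 <= t) (tT : t <= T).
Hypothesis f'0 : forall s, 0 <= s <= t -> 0 <= f' s.
Hypotheses (pt : itv_partition 0 t p) (pc : step_close f t p c delta).

Let x := nth t (0 :: p).

Lemma partition_lt i : (i < size p)%N -> x i < x i.+1.
Proof.
move=> ip; case: pt => /(pathP t) => /(_ i ip) xi _; exact: xi.
Qed.

Lemma partition_ge0 i : (i <= size p)%N -> 0 <= x i.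
Proof.
elim: i => [|i IH] ip; first by [].
by rewrite (le_trans (IH (ltnW ip)))// ltW// partition_lt.
Qed.

Lemma partition_last : x (size p) = t.
Proof.
by case: pt => _ /eqP <-; rewrite /x (last_nth t).
Qed.

Lemma partition_mono i j : (i <= j)%N -> (j <= size p)%N -> x i <= x j.
Proof.
elim: j => [|j IH]; first by rewrite leqn0 => /eqP ->.
rewrite leq_eqVlt => /predU1P[->//|ij] jp.
by rewrite (le_trans (IH _ _))// ?(ltnW jp)// ltW// partition_lt.
Qed.

Lemma partition_le i : (i <= size p)%N -> x i <= t.
Proof. by move=> ip; rewrite -[leRHS]partition_last partition_mono. Qed.

Lemma step_close_right i : (i < size p)%N -> `|c i - f (x i.+1)| <= delta.
Proof. by move=> ip; apply: pc => //; rewrite partition_lt//= lexx. Qed.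

(** [step_close] speaks of left-open intervals; continuity of [f] extends the bound to the left
    end. *)
Lemma step_close_left i : (i < size p)%N -> `|c i - f (x i)| <= delta.
Proof.
move=> ip; apply/ler_addgt0Pr => e e0.
have [r r0 rP] := uniform_continuous_segment 0 t cf e0.
have xx := partition_lt ip.
pose u := Num.min (x i.+1) (x i + r / 2).
have xu : x i < u by rewrite lt_min xx/= ltrDl divr_gt0.
have ux : u <= x i.+1 by rewrite ge_min lexx.
have ur : `|x i - u| < r.
  rewrite distrC ger0_norm ?subr_ge0 ?(ltW xu)// ltrBlDl.
  have : u <= x i + r / 2 by rewrite ge_min lexx orbT.
  move=> /le_lt_trans; apply; rewrite ltrD2l; lra.
have cu : `|c i - f u| <= delta by apply: pc; rewrite // xu.
have fu : `|f (x i) - f u| < e.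
  by apply: rP => //; rewrite partition_ge0 ?partition_le// ltnW.
have -> : c i - f (x i) = (c i - f u) - (f (x i) - f u) by ring.
by apply: le_trans (ler_normB _ _) _; rewrite lerD// ltW.
Qed.

Lemma step_integral_error : (fun w => step_integral X t p c w - by_parts X t w) =
  \sum_(0 <= i < size p) step_error X (c i) (x i) (x i.+1).
Proof.
under eq_bigr do rewrite -step_errorE.
rewrite sumrB telescope_sumr// partition_last.
have -> : by_parts X (x 0) = 0.
  by rewrite /by_parts /x/= path_integral0 subrr subr0.
rewrite subr0 funeqE => w; rewrite fctE; congr (_ - _).
by rewrite /step_integral fct_sumE.
Qed.

Lemma partition_T i : (i < size p)%N -> [/\ 0 <= x i, x i <= x i.+1 & x i.+1 <= T].
Proof.
move=> ip; split; [by rewrite partition_ge0// ltnW|by rewrite ltW// partition_lt|].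
by rewrite (le_trans _ tT)// partition_le.
Qed.

Lemma step_integral_error_L2 :
  L2 (fun w => step_integral X t p c w - by_parts X t w).
Proof.
rewrite step_integral_error big_mkord; apply: square_integrable_sum => i _.
by have [? ? ?] := partition_T (ltn_ord i); exact: step_error_square_integrable.
Qed.

Let interval_f'0 i s : (i < size p)%N -> x i <= s <= x i.+1 -> 0 <= f' s.
Proof.
move=> ip /andP[xs sx]; apply: f'0; rewrite (le_trans _ xs) ?partition_ge0 ?(ltnW ip)//=.
by rewrite (le_trans sx) ?partition_le.
Qed.

Let sum_increments : \sum_(0 <= i < size p) (x i.+1 - x i) = t.
Proof. by rewrite telescope_sumr// partition_last subr0. Qed.

(** The errors of the steps are orthogonal, so their squares add up: each is at most
    [9 * delta ^+ 2 * C] times the step length. *)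
Lemma martingale_step_error (C : R) : 0 <= C ->
  (forall u s t, 0 <= u <= s -> s <= t -> t <= T -> iprod (X t - X s) (X u) = 0) ->
  (forall s t, 0 <= s <= t -> t <= T -> iprod (X t - X s) (X t - X s) <= C * (t - s)) ->
  norm2 (fun w => step_integral X t p c w - by_parts X t w) <= 3 * Num.sqrt (C * t) * delta.
Proof.
move=> C0 oX vX.
(* Without any step, nothing forces [delta] to be nonnegative; but then [t = 0] and both sides
   vanish. *)
case: (posnP (size p)) => [p0|p0].
  have tE : t = 0 by rewrite -sum_increments p0 big_nil.
  by rewrite step_integral_error p0 big_nil norm20 [X in C * X]tE mulr0 sqrtr0 mulr0 mul0r.
have delta0 : 0 <= delta by exact: le_trans (normr_ge0 _) (step_close_left p0).
rewrite norm2_le; last by rewrite !mulr_ge0 ?sqrtr_ge0.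
rewrite step_integral_error iprod_orthogonal_sum; first last.
- move=> i j /andP[ij jp]; have ip := ltn_trans ij jp.
  have [? ? ?] := partition_T ip; have [? ? ?] := partition_T jp.
  apply: step_error_orthogonal2 => //.
  by apply: partition_mono; rewrite // ltnW.
- by move=> i ip; have [? ? ?] := partition_T ip; exact: step_error_square_integrable.
apply: (@le_trans _ _ (\sum_(0 <= i < size p) (9 * delta ^+ 2 * C * (x i.+1 - x i)))).
  rewrite !big_mkord; apply: ler_sum => i _; have ip := ltn_ord i.
  have [xi0 xx xT] := partition_T ip.
  have xx0 : 0 <= C * (x i.+1 - x i) by rewrite mulr_ge0 ?subr_ge0.
  have := @step_error_norm2 X (c i) (x i) (x i.+1) delta (Num.sqrt (C * (x i.+1 - x i)))
    rX xi0 xx xT.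
  rewrite norm2_le; last by rewrite !mulr_ge0 ?sqrtr_ge0.
  rewrite !exprMn sqr_sqrtr// => le; apply: le_trans (le _ _ _ _) _.
  - by move=> s; exact: interval_f'0.
  - exact: step_close_left.
  - exact: step_close_right.
  - move=> s /andP[xs sx]; rewrite norm2_le ?sqrtr_ge0// sqr_sqrtr//.
    apply: le_trans (vX _ _ _ _) _; first by rewrite xi0.
      exact: le_trans sx xT.
    by rewrite ler_wpM2l// lerB.
  - by apply/le_of_eq; ring.
rewrite -mulr_sumr sum_increments !exprMn sqr_sqrtr ?mulr_ge0//.
by apply/le_of_eq; ring.
Qed.

Lemma drift_step_error (K : R) :
  (forall s t, 0 <= s -> s <= t -> t <= T -> norm2 (X t - X s) <= K * (t - s)) ->
  norm2 (fun w => step_integral X t p c w - by_parts X t w) <= 3 * (K * t) * delta.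
Proof.
move=> vX; rewrite step_integral_error big_mkord.
apply: le_trans; first apply: norm2_sum.
  by move=> i _; have [? ? ?] := partition_T (ltn_ord i); exact: step_error_square_integrable.
apply: (@le_trans _ _ (\sum_(i < size p) (3 * delta * K * (x i.+1 - x i)))).
  apply: ler_sum => i _; have ip := ltn_ord i.
  have [xi0 xx xT] := partition_T ip.
  have K0 : 0 <= K.
    have := vX _ _ xi0 xx xT; move/(le_trans (norm2_ge0 _ _)).
    by rewrite pmulr_lge0// subr_gt0 partition_lt.
  rewrite -mulrA; apply: step_error_norm2 => //.
  - by move=> s; exact: interval_f'0.
  - exact: step_close_left.
  - exact: step_close_right.
  - move=> s /andP[xs sx]; apply: le_trans (vX _ _ xi0 xs _) _; first exact: le_trans sx xT.
    by rewrite ler_wpM2l// lerB.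
rewrite -mulr_sumr -(big_mkord xpredT (fun i => x i.+1 - x i)) sum_increments.
by apply/le_of_eq; ring.
Qed.

End Partition.

End StochasticIntegral.

Section StochasticIntegralIntro.
Context {d : measure_display} {Omega : measurableType d} {R : realType}.
Variable P : probability Omega R.
Local Notation L2 := (square_integrable P).
Implicit Types (X : R -> Omega -> R) (Y : Omega -> R) (s t u r : R).

(** A bound in L2 that is linear in [delta] gives convergence in probability by Chebyshev. [X0] is
    the given process and [X] its regular version, equal to it off [N]. *)
Lemma is_stochastic_integral_of_norm2 (f : R -> R) X0 X Y t K (N : set Omega) :
  0 <= t -> continuous f -> measurable_fun setT Y -> measurable N -> P N = 0%E ->
  (forall s, 0 <= s <= t -> measurable_fun setT (X0 s)) ->
  (forall s, 0 <= s <= t -> forall w, ~ N w -> X0 s w = X s w) -> 0 <= K ->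
  (forall p c delta, itv_partition 0 t p -> step_close f t p c delta ->
    L2 (fun w => step_integral X t p c w - Y w) /\
    norm2 P (fun w => step_integral X t p c w - Y w) <= K * delta) ->
  is_stochastic_integral P f X0 t Y.
Proof.
move=> t0 cf mY mN PN mX0 X0X K0 XY; split => //.
  exact: continuous_subspaceT.
move=> eps eta eps0 eta0.
(* Chosen so that (K delta / eps)^2 <= eta. *)
pose delta := eps * Num.sqrt eta / (K + 1).
have delta0 : 0 < delta by rewrite !mulr_gt0 ?sqrtr_gt0// invr_gt0 ltr_wpDl.
exists delta => // p c pt pc.
have [LZ nZ] := XY p c delta pt pc.
set Z := fun w => _ - _ in LZ nZ.
pose Z0 w := step_integral X0 t p c w - Y w.
have xI i : (i <= size p)%N -> 0 <= nth t (0 :: p) i <= t.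
  by move=> ip; rewrite (partition_ge0 pt)// (partition_le pt).
have mZ0 : measurable_fun setT Z0.
  apply: measurable_funB => //; rewrite /step_integral.
  under eq_fun do rewrite big_mkord.
  apply: measurable_sum => i; have ip := ltn_ord i.
  apply: measurable_funM => //; apply: measurable_funB; apply: mX0; apply: xI => //.
  exact: ltnW.
have mZ : measurable_fun setT Z by case: LZ.
have Z0Z w : ~ N w -> Z0 w = Z w.
  move=> Nw; congr (_ - _); rewrite /step_integral !big_nat; apply: eq_bigr => i /andP[_ ip].
  by rewrite !(X0X _ (xI _ _) _ Nw)// ltnW.
apply: (@le_trans _ _ (P ([set w | (eps < `|Z w|)%R] `|` N))).
  apply: le_measure; rewrite ?inE; [exact: measurable_norm_gt|by apply: measurableU => //; exact: measurable_norm_gt|].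
  move=> w /= eZ; have [Nw|Nw] := pselect (N w); [by right|left => /=].
  by rewrite -Z0Z.
rewrite measureU0//; last exact: measurable_norm_gt.
apply: le_trans (chebyshev_norm2 LZ nZ eps0) _; rewrite lee_fin.
have -> : K * delta / eps = K / (K + 1) * Num.sqrt eta.
  by rewrite /delta; field; rewrite !gt_eqF// ltr_wpDl.
rewrite exprMn sqr_sqrtr ?(ltW eta0)// -[leRHS]mul1r ler_wpM2r ?(ltW eta0)//.
have K1 : 0 < K + 1 by rewrite ltr_wpDl.
by rewrite expr_le1// ?divr_ge0 ?(ltW K1)// ler_pdivrMr// mul1r lerDl.
Qed.

End StochasticIntegralIntro.

(** * The two stochastic integrals of the decomposition *)

Section Application.
Context {d : measure_display} {Omega : measurableType d} {R : realType}.
Variables (P : probability Omega R) (H : set (Omega -> R)) (T : R).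
Variable G : R -> set (set Omega).
Hypotheses (HG : gaussian_space P H) (T0 : 0 < T).
Hypothesis G_mono : forall s t, s <= t -> G s `<=` G t.
Local Notation L2 := (square_integrable P).
Local Notation regular := (regular P H T G).
Local Notation iprod := (iprod P).
Local Notation norm2 := (norm2 P).
Implicit Types (X : R -> Omega -> R) (Y : Omega -> R) (s t u r : R).

Variable b : R -> Omega -> R.
Hypotheses (rb : regular b) (b0 : b 0 = 0).
Hypothesis b_cov : forall s t, 0 <= s <= t -> t <= T -> iprod (b s) (b t) = cov T s t.

Local Notation L := (drift T b).
Local Notation M := (martingale_part T b).
Local Notation V := (volatility_part T b).
Local Notation beta' := (innovation T b).

Let L2X X t : regular X -> 0 <= t <= T -> L2 (X t).
Proof. exact: regular_square_integrable. Qed.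

Let rL : regular L := regular_drift HG T0 G_mono rb.
Let rM : regular M := regular_martingale_part HG T0 G_mono rb.
Let rV : regular V := regular_volatility_part HG T0 G_mono rb.
Let rI : regular beta' := regular_innovation HG T0 G_mono rb.
Let rPL : regular (path_integral L) := regular_integral HG T0 G_mono rL.

Lemma path_integral_continuousB X1 X2 t : (forall w, continuous (X1 ^~ w)) ->
  (forall w, continuous (X2 ^~ w)) ->
  path_integral (fun s => X1 s - X2 s) t = path_integral X1 t - path_integral X2 t.
Proof.
move=> c1 c2; rewrite funeqE => w.
by apply: RintegralB => //; exact: continuous_integrable_segment.
Qed.

Lemma path_integral_continuousZ (k : R) X1 t : (forall w, continuous (X1 ^~ w)) ->
  path_integral (fun s => cst k * X1 s) t = cst k * path_integral X1 t.
Proof.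
move=> c1; rewrite funeqE => w.
by apply: RintegralZl => //; exact: continuous_integrable_segment.
Qed.

(** The two integrations by parts are inverse to each other. With h = 1/f and I the integral of h'
    M, the identity f h' = - f' h makes - f I an antiderivative of f' Bbar = f' (h M - I), so that f
    Bbar + f I = f h M = M. *)
Lemma martingale_part_by_parts t : 0 <= t ->
  M t = by_parts (volatility T) (volatility' T) beta' t.
Proof.
move=> t0; rewrite /by_parts innovation0// mulr0 subr0 funeqE => w.
pose f := volatility T; pose h := ivolatility T.
pose I s := path_integral V s w; pose m s := M s w.
have cV : continuous (V ^~ w) := regular_path rV (w := w).
have cI : continuous I by exact: continuous_primitive.
have fh s : f s * h s = 1 by rewrite mulfV// gt_eqF// volatility_gt0.
have bE s : beta' s w = h s * m s - I s by [].
pose F s := - (f s * I s).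
have cF : continuous F.
  by move=> s; apply: cvgN; apply: cvgM; [exact: continuous_volatility|exact: cI].
have PE : path_integral (weighted (volatility' T) beta') t w = F t - F 0.
  apply: primitive_unique => //.
    move=> s; apply: cvgM; first exact: continuous_volatility'.
    exact: (regular_path rI).
  move=> s /andP[s0 _]; have dI : is_derive s (1 : R) I (V s w) := is_derive_primitive cV s0.
  have df : is_derive s (1 : R) f (volatility' T s) := is_derive_volatility T0 s.
  rewrite /F; apply: is_derive_eq; rewrite /GRing.scale/=.
  rewrite -[weighted _ _ _ _]/(volatility' T s * beta' s w) bE.
  rewrite -[V s w]/(ivolatility' T s * m s).
  have : f s * ivolatility' T s = - (volatility' T s * h s).
    rewrite /ivolatility' /volatility' /h /ivolatility -/(f s).
    by field; rewrite (gt_eqF T0) gt_eqF// volatility_gt0.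
  move: (I s) (m s) => i ms e.
  have -> : - (f s *: (ivolatility' T s * ms) + i *: volatility' T s) =
     - (f s * ivolatility' T s) * ms - i * volatility' T s.
    by rewrite /GRing.scale/=; ring.
  by rewrite e; ring.
rewrite -[RHS]/(f t * beta' t w - path_integral (weighted (volatility' T) beta') t w).
rewrite PE bE /F; have -> : I 0 = 0 by exact: primitive0.
rewrite -/(m t) mulrBr mulrA fh mul1r; ring.
Qed.

Lemma volatility_stochastic_integral t : 0 <= t < T ->
  is_stochastic_integral P (volatility T) beta' t (M t).
Proof.
move=> /andP[t0 tT]; have tT' : 0 <= t <= T by rewrite t0 ltW.
have cv := continuous_volatility T0; have cv' := continuous_volatility' T0.
have dv := is_derive_volatility T0.
apply: (is_stochastic_integral_of_norm2 (K := 3 * Num.sqrt (1 * t)) (X := beta')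
  (N := set0) t0) => //.
- by have [] := L2X rM tT'.
- by move=> s /andP[s0 st]; have [] := L2X rI (_ : 0 <= s <= T); rewrite // s0 (le_trans st)// ltW.
move=> p c delta pt pc; rewrite martingale_part_by_parts//.
have v'0 s : 0 <= s <= t -> 0 <= volatility' T s.
  move=> /andP[s0 _]; rewrite divr_ge0// mulr_ge0 ?sqr_ge0//.
  by rewrite ltW// volatility_gt0.
split; first exact: (step_integral_error_L2 HG (volatility T) cv' c rI (ltW tT) pt).
apply: (martingale_step_error HG T0 dv cv' rI t0 (ltW tT) v'0 pt pc ler01).
  by move=> u s r us sr rT; exact: (orthogonal_innovation HG T0 G_mono rb b_cov us sr rT).
move=> s r sr rT.
by rewrite (innovation_increment_variance HG T0 G_mono rb b0 b_cov sr rT) mul1r.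
Qed.

Lemma orthogonal_martingale u s t : 0 <= u <= s -> s <= t -> t <= T ->
  iprod (M t - M s) (M u) = 0.
Proof.
move=> us st tT; have [u0 us'] := andP us; have s0 := le_trans u0 us'.
have sT : 0 <= s <= T by rewrite s0 (le_trans st).
have tT' : 0 <= t <= T by rewrite tT (le_trans s0).
have LY : L2 (M t - M s) := square_integrableB (L2X rM tT') (L2X rM sT).
have Yb r : 0 <= r <= s -> iprod (M t - M s) (b r) = 0.
  by move=> rs; rewrite iprodC; exact: (orthogonal_martingale_part HG T0 G_mono rb b_cov rs st tT).
by have [] := orthogonal_past HG T0 G_mono rb LY sT Yb us.
Qed.

Lemma martingale_increment_variance : exists2 C, 0 <= C &
  forall s t, 0 <= s <= t -> t <= T -> iprod (M t - M s) (M t - M s) <= C * (t - s).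
Proof.
have [K K0 KP] := regular_integral_lipschitz HG rL.
(* From (x + y)^2 <= 2 x^2 + 2 y^2, where x^2 <= 3 (t - s) for the bridge and y <= K (t - s) for the
   integrated drift, one factor t - s being at most T. *)
exists (6 + 2 * K ^+ 2 * T); first by rewrite addr_ge0// !mulr_ge0 ?sqr_ge0// ltW.
move=> s t st tT; have [s0 st'] := andP st.
have sT : 0 <= s <= T by rewrite s0 (le_trans st').
have tT' : 0 <= t <= T by rewrite tT (le_trans s0).
have LX : L2 (b t - b s) := square_integrableB (L2X rb tT') (L2X rb sT).
have LI := regular_path_integral_diff HG rL s0 st' tT.
have -> : M t - M s = (b t - b s) + (path_integral L t - path_integral L s).
  by rewrite /M opprD addrACA.
have nX : norm2 (b t - b s) ^+ 2 <= 3 * (t - s).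
  rewrite norm2_sqr; exact: (bridge_increment_le T0 (fun t => L2X (t := t) rb) b_cov st tT).
have nI : norm2 (path_integral L t - path_integral L s) <= K * (t - s) := KP _ _ s0 st' tT.
rewrite -norm2_sqr; apply: (@le_trans _ _
  ((norm2 (b t - b s) + norm2 (path_integral L t - path_integral L s)) ^+ 2)).
  by rewrite ler_sqr ?nnegrE ?addr_ge0 ?norm2_ge0//; exact: norm2D.
have n0 := norm2_ge0 P (path_integral L t - path_integral L s).
move: (norm2 (b t - b s)) (norm2 (path_integral L t - path_integral L s)) nX nI n0 => x y x2 yK y0.
have y2 : y ^+ 2 <= K ^+ 2 * T * (t - s).
  apply: (@le_trans _ _ ((K * (t - s)) ^+ 2)); first by rewrite ler_sqr ?nnegrE ?mulr_ge0 ?subr_ge0//.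
  rewrite exprMn -mulrA ler_wpM2l ?sqr_ge0// expr2 ler_wpM2r ?subr_ge0//; lra.
have := sqr_ge0 (x - y); lra.
Qed.

Definition inner_integral s : Omega -> R := b s - cst (T - s) * L s.

(** In [u], the kernel is an affine function of [Gker], so its derivative is a multiple of [gker];
    the coefficients of [b s] agree because s atan(s / T) = D(s) - (T - s). *)
Lemma inner_integral_by_parts s : 0 <= s <= T ->
  inner_integral s =
  by_parts (kernel_a T s) (fun u => (T - s) / Dker T s * gker T u) b s.
Proof.
move=> sT; rewrite /inner_integral /by_parts b0 mulr0 subr0.
have D0 := Dker_gt0 T0 sT.
have -> : path_integral (weighted (fun u => (T - s) / Dker T s * gker T u) b) s =
    cst ((T - s) / Dker T s) * path_integral (kernel_part T b) s.
  rewrite -path_integral_continuousZ; last exact: (regular_path (regular_kernel_part HG T0 rb)).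
  congr path_integral; rewrite funeqE => u; rewrite funeqE => w.
  by rewrite /weighted /kernel_part !fctE; ring.
rewrite /drift /iDker clamp_id//; move: (path_integral _ s) => I.
rewrite funeqE => w; rewrite !fctE; move: (I w) (b s w) => i x.
rewrite /kernel_a /Gker.
have DE : T - s + s * atan (s / T) = Dker T s by [].
rewrite !DE; have aE : s * atan (s / T) = Dker T s - (T - s) by rewrite /Dker; ring.
rewrite aE; field; rewrite (gt_eqF D0)//= sqrD_neq0//.
Qed.

(** The bridge fits neither error estimate, so it is written as M minus the integral of L: the step
    errors of M are orthogonal, those of the integral, Lipschitz in L2, are added, and the constants
    of the two bounds are summed. *)
Lemma kernel_stochastic_integral X0 (N : set Omega) s : measurable N -> P N = 0%E ->
  (forall u, 0 <= u <= T -> measurable_fun setT (X0 u)) ->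
  (forall u, 0 <= u <= T -> forall w, ~ N w -> X0 u w = b u w) -> 0 <= s < T ->
  is_stochastic_integral P (kernel_a T s) X0 s (inner_integral s).
Proof.
move=> mN PN mX0 X0b /andP[s0 sT]; have sT' : 0 <= s <= T by rewrite s0 ltW.
have D0 := Dker_gt0 T0 sT'.
pose k := (T - s) / Dker T s; pose k' u := k * gker T u.
have k0 : 0 <= k by apply: divr_ge0; rewrite ?subr_ge0 ltW.
have dk u : is_derive u (1 : R) (kernel_a T s) (k' u).
  have dG := is_derive_Gker T0 u.
  have -> : kernel_a T s = fun u => k * Gker T u + s * atan (s / T) / Dker T s by [].
  by apply: is_derive_eq; rewrite /GRing.scale/= /k'; ring.
have ck : continuous (kernel_a T s) by move=> u; exact: (is_derive_continuous (dk u)).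
have ck' : continuous k'.
  by move=> u; apply: cvgM; [exact: cvg_cst|exact: (continuous_gker T0)].
have k'0 u : 0 <= u <= s -> 0 <= k' u.
  by move=> _; rewrite mulr_ge0// divr_ge0 ?sqr_ge0// mulr_ge0// exprn_ge0 ?ltW.
have [C C0 CP] := martingale_increment_variance.
have [K K0 KP] := regular_integral_lipschitz HG rL.
have us u : 0 <= u <= s -> 0 <= u <= T.
  by move=> /andP[-> us]; rewrite (le_trans us)// ltW.
rewrite inner_integral_by_parts//.
apply: (is_stochastic_integral_of_norm2 (K := 3 * Num.sqrt (C * s) + 3 * (K * s)) (X := b)
  (N := N) s0) => //.
- by have [] := by_parts_square_integrable HG T0 (kernel_a T s) ck' rb sT'.
- by move=> u /us; exact: mX0.
- by move=> u /us; exact: X0b.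
- by rewrite addr_ge0// mulr_ge0 ?sqrtr_ge0// mulr_ge0.
move=> p c delta pt pc.
split; first exact: (step_integral_error_L2 HG (kernel_a T s) ck' c rb (ltW sT) pt).
have -> : (fun w => step_integral b s p c w - by_parts (kernel_a T s) k' b s w) =
  (fun w => step_integral M s p c w - by_parts (kernel_a T s) k' M s w) -
  (fun w => step_integral (path_integral L) s p c w -
     by_parts (kernel_a T s) k' (path_integral L) s w).
  have bE u : b u = M u - path_integral L u by rewrite /martingale_part addrK.
  have -> : by_parts (kernel_a T s) k' b s =
    by_parts (kernel_a T s) k' M s - by_parts (kernel_a T s) k' (path_integral L) s.
    rewrite /by_parts.
    have -> : weighted k' b = fun u => weighted k' M u - weighted k' (path_integral L) u.
      by rewrite funeqE => u; rewrite /weighted bE mulrBr.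
    have cM := regular_path (regular_weighted HG ck' rM).
    have cI := regular_path (regular_weighted HG ck' rPL).
    rewrite path_integral_continuousB//.
    rewrite !bE; move: (path_integral _ s) (path_integral _ s) => *.
    move: (M s) (M 0) (path_integral L s) (path_integral L 0) => *.
    by rewrite funeqE => w; rewrite !fctE; ring.
  have SE w : step_integral b s p c w =
      step_integral M s p c w - step_integral (path_integral L) s p c w.
    rewrite /step_integral -sumrB; apply: eq_bigr => i _; rewrite !bE.
    move: (M _) (M _) (path_integral L _) (path_integral L _) => m1 m2 l1 l2.
    by rewrite !fctE; ring.
  rewrite funeqE => w; rewrite SE.
  move: (by_parts _ _ M s) (by_parts _ _ (path_integral L) s) => y1 y2.
  by rewrite !fctE; ring.
rewrite mulrDl; apply: le_trans (norm2B _ _) _.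
- exact: (step_integral_error_L2 HG (kernel_a T s) ck' c rM (ltW sT) pt).
- exact: (step_integral_error_L2 HG (kernel_a T s) ck' c rPL (ltW sT) pt).
apply: lerD.
  apply: (martingale_step_error HG T0 dk ck' rM s0 (ltW sT) k'0 pt pc C0) => //.
  exact: orthogonal_martingale.
exact: (drift_step_error HG dk ck' rPL (ltW sT) k'0 pt pc KP).
Qed.

End Application.

(** * The canonical decomposition *)

Lemma independent_mean0 {d : measure_display} {Omega : measurableType d} {R : realType}
    (P : probability Omega R) (v : R) (Z : Omega -> R) (F : set (set Omega)) (E : set Omega) :
  square_integrable P Z -> gaussian_cf P v Z -> measurable E ->
  sigma_of (\1_E : Omega -> R) `<=` F -> independent P F (sigma_of Z) ->
  \int[P]_(w in E) Z w = 0.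
Proof.
move=> LZ gZ mE EF FZ; have [mZ _] := LZ.
(* [Z] is unbounded: it is replaced by [sin (a Z) / a] and [a] tends to 0. *)
pose a n : R := harmonic n.
have a0 n : 0 < a n by rewrite /a /harmonic/= invr_gt0.
have sinE x : sin x = cos (x + - (pi / 2)) :> R.
  by rewrite cosB cos_pihalf sin_pihalf mulr0 mulr1 add0r.
pose f n w : R := \1_E w * (cos (a n * Z w + - (pi / 2)) / a n).
have -> : \int[P]_(w in E) Z w = \int[P]_w (\1_E w * Z w).
  rewrite Rintegral_mkcond; apply: eq_Rintegral => w _.
  by rewrite patchE indicE; case: ifPn => _; rewrite ?mul1r ?mul0r.
have f0 n : \int[P]_w f n w = 0.
  (* The product rule takes functions of random variables: the indicator of [E] is written as that
     of the point 1 applied to itself. *)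
  transitivity (\int[P]_w ((a n)^-1 *
     (\1_[set (1 : R)] (\1_E w : R) * cos (a n * Z w + - (pi / 2))))).
    apply: eq_Rintegral => w _; rewrite /f.
    have -> : \1_[set (1 : R)] (\1_E w : R) = (\1_E w : R).
      rewrite !indicE; case: (w \in E).
        by rewrite mem_set.
      by rewrite memNset//= => /eqP; rewrite eq_sym oner_eq0.
    by ring.
  have mc : measurable_fun setT (fun x : R => cos (a n * x + - (pi / 2))).
    by apply: measurable_cos_affine.
  have m1 : measurable_fun setT (\1_[set (1 : R)] : R -> R) by [].
  have i1 (x : R) : `|\1_[set (1 : R)] x : R| <= 1.
    by rewrite indicE; case: (x \in _); rewrite ?normr1 ?normr0.
  have i2 (x : R) : `|cos (a n * x + - (pi / 2))| <= 1.
    by rewrite ler_norml cos_geN1 cos_le1.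
  have m2 : measurable_fun setT (\1_E : Omega -> R) by [].
  rewrite RintegralZl//.
    rewrite (independent_prod m2 mZ EF (@subset_refl _ _) FZ m1 mc i1 i2).
    by rewrite gZ cosN cos_pihalf !mulr0.
  apply: (@bounded_integrable _ _ _ P _ 1).
    apply: measurable_funM; first exact: (measurableT_comp m1 m2).
    exact: measurable_cos_affine.
  by move=> w; rewrite normrM mulr_ile1.
have cf w : f n w @[n --> \oo] --> \1_E w * Z w.
  apply: cvgM; first exact: cvg_cst.
  have ds : is_derive 0 (1 : R) (fun x : R => sin (x * Z w)) (Z w).
    by apply: is_derive_eq; rewrite /GRing.scale/= mul0r cos0; ring.
  have := is_derive_cvg_seq ds _ _ (@cvg_harmonic R).
  under eq_fun do rewrite sinE; apply; first by rewrite mul0r sin0.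
  by move=> n; rewrite gt_eqF// a0.
suff : \int[P]_w f n w @[n --> \oo] --> \int[P]_w (\1_E w * Z w).
  have -> : (fun n => \int[P]_w f n w) = cst 0 by rewrite funeqE => n; exact: f0.
  by move=> c0; exact: (cvg_unique (@Rhausdorff R) c0 (cvg_cst _)).
apply: (@Rintegral_dominated_cvg _ _ _ P f _ (fun w => `|Z w|)) => //.
- move=> n; apply: measurable_funM => //; apply: measurable_funM => //.
  exact: measurable_cos_affine.
- have := square_integrable_integrable LZ => /integrable_abse.
  by [].
- move=> n w; rewrite /f normrM -[leRHS]mul1r ler_pM//.
    by rewrite indicE; case: (w \in E); rewrite ?normr1 ?normr0.
  rewrite -sinE normrM normfV (gtr0_norm (a0 n)) ler_pdivrMr//.
  by apply: le_trans (sin_le_norm _) _; rewrite normrM (gtr0_norm (a0 n)) mulrC.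
Qed.

Lemma integral_eq_of_difference {d : measure_display} {Omega : measurableType d}
    {R : realType} (P : probability Omega R) (E : set Omega) (X Y : Omega -> R) :
  measurable E -> P.-integrable E (EFin \o X) -> P.-integrable E (EFin \o Y) ->
  \int[P]_(w in E) (X - Y) w = 0 ->
  (\int[P]_(w in E) (X w)%:E = \int[P]_(w in E) (Y w)%:E)%E.
Proof.
move=> mE iX iY; rewrite RintegralB// => /eqP; rewrite subr_eq0 => /eqP.
rewrite /Rintegral => e0.
have fX : (\int[P]_(w in E) (X w)%:E)%E \is a fin_num := integrable_fin_num mE iX.
have fY : (\int[P]_(w in E) (Y w)%:E)%E \is a fin_num := integrable_fin_num mE iY.
by rewrite -(fineK fX) -(fineK fY) e0.
Qed.

(** If |f| <= K on the segment, the primitive plus K x is nondecreasing, and the primitive is a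
    difference of monotone functions. *)
Lemma bounded_variation_primitive {R : realType} (f : R -> R) t : continuous f -> 0 <= t ->
  bounded_variation 0 t (primitive f).
Proof.
move=> cf; rewrite le_eqVlt => /predU1P[<-|t0]; first exact: bounded_variationxx.
have [K K0 KP] := bounded_segment 0 t cf.
have -> : primitive f = (fun x => primitive f x + K * x) \+ (\- (fun x => K * x)).
  by rewrite funeqE => x /=; rewrite addrK.
apply: bounded_variationD => //; last first.
  apply: bounded_variationN; apply: nondecreasing_bounded_variation => x y _ _ xy.
  by rewrite ler_wpM2l.
apply: nondecreasing_bounded_variation => x y; rewrite !in_itv/= => /andP[x0 xt] /andP[y0 yt].
rewrite le_eqVlt => /predU1P[->//|xy].
have [c /andP[xc cy] pE] := primitive_MVT cf x0 xy.
have ct : 0 <= c <= t by rewrite (le_trans x0 (ltW xc)) (le_trans (ltW cy)).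
have := KP c ct; rewrite ler_norml => /andP[cK _].
have : - K * (y - x) <= f c * (y - x) by rewrite ler_wpM2r// subr_ge0 ltW.
by rewrite -pE; lra.
Qed.

(** * Adaptedness, the martingale property and the final formula *)

Section Assembly.
Context {d : measure_display} {Omega : measurableType d} {R : realType}.
Variables (P : probability Omega R) (H : set (Omega -> R)) (T : R) (N : set Omega).
Variables (beta b : R -> Omega -> R).
Hypotheses (T0 : 0 < T) (mN : measurable N) (PN : P N = 0%E).
Hypotheses (HG : gaussian_space P H) (Hb : forall t, H (b t)).
Hypotheses (cb : forall w, continuous (b ^~ w)) (b0 : b 0 = 0).
Hypothesis mbeta : forall t, 0 <= t <= T -> measurable_fun setT (beta t).
Hypothesis bE : forall t, 0 <= t <= T -> b t = (fun w => \1_(~` N) w * beta t w).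
Hypothesis b_cov : forall s t, 0 <= s <= t -> t <= T -> iprod P (b s) (b t) = cov T s t.
Local Notation L2 := (square_integrable P).
Implicit Types (X : R -> Omega -> R) (Y : Omega -> R) (s t u r : R).

Local Notation F := (natural_filtration P beta).

Definition generators t : set (set Omega) :=
  (\bigcup_(s in `[0, t]%classic) sigma_of (beta s)) `|`
  [set N | measurable N /\ P N = 0%E].

Lemma generators_mono s t : s <= t -> generators s `<=` generators t.
Proof.
move=> st; apply: setSU; apply: bigcup_subset => u /=.
by rewrite !in_itv/= => /andP[-> us]; exact: le_trans us st.
Qed.

Let Lb t : 0 <= t <= T -> L2 (b t). Proof. by move=> _; exact: gspace_square_integrable (Hb t). Qed.

Lemma regular_bridge : regular P H T generators b.
Proof.
have small s t e : 0 < e -> 0 <= s -> s <= t -> t <= T -> t - s < e ^+ 2 / 3 ->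
    norm2 P (b t - b s) <= e.
  move=> e0 s0 st tT ts; rewrite norm2_le ?(ltW e0)//.
  apply: le_trans (bridge_increment_le T0 Lb b_cov _ tT) _; first by rewrite s0.
  by move: ts; rewrite ltr_pdivlMr//; lra.
split => //.
- move=> t tT; rewrite /adapted_fun bE//; apply: measurable_funM.
    (* The version [b] is adapted because the completed filtration contains [N] at every time. *)
    have GN : measurable (N : set (g_sigma_algebraType (generators t))).
      by apply: sub_gen_smallest; right.
    by apply: measurable_indic; exact: measurableC.
  apply/sigma_of_measurable => A sA; apply: sub_gen_smallest; left; exists t => //=.
  by rewrite in_itv/= lexx andbT; case/andP: tT.
- move=> e e0; exists (e ^+ 2 / 3); first by rewrite divr_gt0 ?exprn_gt0.
  move=> s t sT tT st; have [s0 sT'] := andP sT; have [t0 tT'] := andP tT.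
  have [le|/ltW le] := leP t s.
    by apply: small => //; rewrite ger0_norm ?subr_ge0// in st.
  rewrite norm2_distC; try exact: Lb.
  by apply: small => //; rewrite distrC ger0_norm ?subr_ge0// in st.
- exists (Num.sqrt (3 * T)); first exact: sqrtr_ge0.
  move=> t /andP[t0 tT]; rewrite norm2_le ?sqrtr_ge0// sqr_sqrtr ?mulr_ge0 ?(ltW T0)//.
  have zt : 0 <= (0 : R) <= t by rewrite lexx.
  have := bridge_increment_le T0 Lb b_cov zt tT; rewrite b0 !subr0 => /le_trans; apply.
  by rewrite ler_wpM2l.
Qed.

Let mono := generators_mono.
Let rb := regular_bridge.
Let rL := regular_drift HG T0 mono rb.
Let rM := regular_martingale_part HG T0 mono rb.
Let rI := regular_innovation HG T0 mono rb.
Let rPL := regular_integral HG T0 mono rL.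

Local Notation L := (drift T b).
Local Notation M := (martingale_part T b).

Lemma filtration_measurable t A : 0 <= t <= T -> F t A -> measurable A.
Proof.
move=> /andP[t0 tT]; apply: smallest_sub; first exact: sigma_algebra_measurable.
move=> B [[s /= + [C mC <-]]|[]//]; rewrite in_itv/= => /andP[s0 st].
by apply: mbeta; rewrite // s0 (le_trans st).
Qed.

Lemma regular_sigma_of X t : regular P H T generators X -> 0 <= t <= T ->
  sigma_of (X t) `<=` F t.
Proof. by move=> rX tT; apply/sigma_of_measurable; exact: (regular_adapted rX). Qed.

Lemma independent_past X s t : regular P H T generators X -> 0 <= s <= t -> t <= T ->
  (forall u, 0 <= u <= s -> iprod P (b u) (X t - X s) = 0) ->
  independent P (F s) (sigma_of (X t - X s)).
Proof.
move=> rX /andP[s0 st] tT oX.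
have sT : 0 <= s <= T by rewrite s0 (le_trans st).
have tT' : 0 <= t <= T by rewrite tT (le_trans s0).
have HZ : H (X t - X s) by apply: (gspaceB HG); exact: (regular_gspace rX).
apply: (gspace_independent HG (X' := b) mN PN) => //.
- by move=> u /andP[u0 us]; apply: mbeta; rewrite u0 (le_trans us)//; case/andP: sT.
- move=> u w /andP[u0 us] Nw; rewrite bE ?u0 ?(le_trans us)//; last by case/andP: sT.
  by rewrite indicE mem_set// mul1r.
- by move=> u us; rewrite iprodC oX.
Qed.

Lemma innovation_brownian : brownian_motion P F `[0, T] (innovation T b).
Proof.
have LI t : 0 <= t <= T -> L2 (innovation T b t).
  by move=> tT; exact: (regular_square_integrable HG rI tT).
split.
- by move=> t; rewrite /= in_itv/= => /LI[].
- by move=> t; rewrite /= in_itv/= => tT; exact: (regular_sigma_of rI).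
- by apply: aeW => w; rewrite innovation0.
- move=> s t; rewrite /= !in_itv/= => /andP[s0 sT] /andP[t0 tT] st.
  have st' : 0 <= s <= t by rewrite s0 ltW.
  split.
    apply: (independent_past rI st' tT) => u us.
    exact: (orthogonal_innovation_bridge HG T0 mono rb b_cov us (ltW st) tT).
  have vI := innovation_increment_variance HG T0 mono rb b0 b_cov st' tT.
  move=> Y mY; rewrite -vI; apply: (gspace_law HG) => //; last by rewrite vI subr_gt0.
  by apply: (gspaceB HG); apply: (regular_gspace rI); rewrite ?s0 ?t0.
- by apply: aeW => w; apply: continuous_subspaceT; exact: (regular_path rI).
Qed.

Lemma martingale_part_martingale : martingale P F `[0, T[%classic M.
Proof.
have inT t : `[0, T[%classic t -> 0 <= t <= T.
  by rewrite /= in_itv/= => /andP[-> /ltW].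
have LM t : 0 <= t <= T -> L2 (M t).
  by move=> tT; exact: (regular_square_integrable HG rM tT).
split.
- by move=> t /inT tT; exact: (regular_sigma_of rM).
- by move=> t /inT /LM; exact: square_integrable_integrable.
move=> s t /inT sT /inT tT st E FE.
have mE := filtration_measurable sT FE.
have st' : 0 <= s <= t by case/andP: sT => ->.
have tT' : t <= T by case/andP: tT.
have HZ : H (M t - M s) by apply: (gspaceB HG); exact: (regular_gspace rM).
have Z0 : \int[P]_(w in E) (M t - M s) w = 0.
  apply: (independent_mean0 (gspace_square_integrable HG HZ) (gspace_cf HG HZ) mE).
    apply/sigma_of_measurable; apply: measurable_indic; exact: FE.
  apply: (independent_past rM st' tT') => u us.
  exact: (orthogonal_martingale_part HG T0 mono rb b_cov us st tT').
have iE u : 0 <= u <= T -> P.-integrable E (EFin \o M u).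
  move=> /LM/square_integrable_integrable; exact: integrableS.
exact: (integral_eq_of_difference mE (iE _ tT) (iE _ sT) Z0).
Qed.

Lemma martingale_part_local_martingale : local_martingale P F T M.
Proof.
(* M is a true martingale on [0, T[, so the constant time [T] localises it; for t < T the event that
   it has occurred is empty. *)
exists (fun _ _ => T); split.
- move=> _; split=> [w|t /andP[t0 tT]]; first by rewrite lexx ltW.
  rewrite (_ : [set _ | _] = set0); first exact: (@measurable0 _ (g_sigma_algebraType (generators t))).
  by apply/seteqP; split=> // w /=; rewrite leNgt tT.
- by apply: aeW => w; split => //; exact: cvg_cst.
- move=> _; have [aM iM eM] := martingale_part_martingale.
  have minE t : `[0, T[%classic t -> Num.min t T = t.
    by rewrite /= in_itv/= => /andP[_ /ltW tT]; rewrite min_l.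
  split.
  + by move=> t tT; rewrite /= (minE t tT); exact: aM.
  + by move=> t tT; rewrite /= (minE t tT); exact: iM.
  + by move=> s t sT tT; rewrite (minE s sT) (minE t tT); exact: eM.
Qed.

Definition finite_variation_part t : Omega -> R := - path_integral L t.
Local Notation A := finite_variation_part.

Lemma bridge_decomposition t w : 0 <= t <= T -> ~ N w -> beta t w = M t w + A t w.
Proof.
move=> tT Nw; rewrite -[RHS]/(b t w + path_integral L t w - path_integral L t w) addrK.
by rewrite bE// indicE mem_set// mul1r.
Qed.

Lemma finite_variation_partE t w : 0 <= t < T -> ~ N w ->
  A t w = - (\int[lebesgue_measure]_(s in `[0, t]) (beta s w / (T - s)))
    + \int[lebesgue_measure]_(s in `[0, t]) (inner_integral T b s w / (T - s)).
Proof.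
move=> /andP[t0 tT] Nw.
(* Equal to 1 / (T - s) on [0, t] and continuous on the whole line, as [t < T]. *)
pose q s : R := (T - Num.min s t)^-1.
have T0q s : 0 < T - Num.min s t by rewrite subr_gt0 gt_min tT orbT.
have cq : continuous q.
  move=> s; apply: cvgV; first by rewrite gt_eqF.
  apply: cvgB; first exact: cvg_cst.
  by apply: continuous_min; [exact: cvg_id|exact: cvg_cst].
have cL : continuous (L ^~ w) := regular_path rL (w := w).
have cbq : continuous (fun s => b s w * q s).
  by move=> s; apply: cvgM; [exact: cb|exact: cq].
have qE s : s \in `[0, t]%classic -> q s = (T - s)^-1.
  by rewrite inE /= in_itv/= => /andP[_ st]; rewrite /q min_l.
have -> : \int[lebesgue_measure]_(s in `[0, t]) (beta s w / (T - s)) =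
    \int[lebesgue_measure]_(s in `[0, t]) (b s w * q s).
  apply: eq_Rintegral => s st; rewrite qE//; move: st.
  rewrite inE /= in_itv/= => /andP[s0 st].
  by rewrite bE ?s0 ?(le_trans st (ltW tT))// indicE mem_set// mul1r.
have -> : \int[lebesgue_measure]_(s in `[0, t]) (inner_integral T b s w / (T - s)) =
    \int[lebesgue_measure]_(s in `[0, t]) (b s w * q s - L s w).
  apply: eq_Rintegral => s st; rewrite qE//; move: st.
  rewrite inE /= in_itv/= => /andP[s0 st].
  rewrite -[inner_integral T b s w]/(b s w - (T - s) * L s w).
  by rewrite mulrBl mulrAC divff ?mul1r// subr_eq0 gt_eqF// (le_lt_trans st).
rewrite RintegralB//; try exact: continuous_integrable_segment.
by rewrite addrA addNr add0r.
Qed.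

Lemma bridge_canonical_decomposition : canonical_decomposition P F T beta M A.
Proof.
have aeN (Q : Omega -> Prop) : (forall w, ~ N w -> Q w) -> {ae P, forall w, Q w}.
  by move=> NQ; exists N; split => // w nQ; apply: contrapT => Nw; exact: nQ (NQ _ Nw).
have inT t : `[0, T[%classic t -> 0 <= t <= T.
  by rewrite /= in_itv/= => /andP[-> /ltW].
have M0 : M 0 = 0 by rewrite /martingale_part b0 path_integral0 addr0.
have A0 : A 0 = 0 by rewrite /A path_integral0 oppr0.
have T00 : 0 <= (0 : R) <= T by rewrite lexx ltW.
split.
- by apply: aeW => w; rewrite M0 A0.
- split; first exact: martingale_part_local_martingale.
  by apply: aeW => w; apply: continuous_subspaceT; exact: (regular_path rM).
- split.
    move=> t /inT tT; apply/sigma_of_measurable; apply: measurableT_comp => //.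
    exact: (regular_adapted rPL).
  apply: aeW => w; apply: continuous_subspaceT => t; apply: cvgN.
  exact: (regular_path rPL).
- apply: aeW => w t /andP[t0 _]; apply: bounded_variationN.
  by apply: bounded_variation_primitive => //; exact: (regular_path rL).
- apply: aeN => w Nw t /andP[t0 tT].
  rewrite (bridge_decomposition T00 Nw) M0 A0 addr0 add0r.
  by rewrite bridge_decomposition// t0 ltW.
Qed.

End Assembly.

Unset Implicit Arguments.

(* [J s] is the inner stochastic integral, in its version continuous in [s];
   [A] is the finite variation part, equal to the sum of the two ds-integrals
   outside a null set (on which, [P] not being assumed complete, these pathwise
   integrals need not be measurable). *)
Theorem proposition2p4 (R : realType) (d : measure_display)
    (Omega : measurableType d) (P : probability Omega R)
    (T : R) (W B : R -> Omega -> R) :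
  0 < T ->
  standard_brownian_motion P `[0, T] W ->
  standard_brownian_motion P `[0, T] B ->
  independent_processes P T W B ->
  let beta := bar_beta T W B in
  let F := natural_filtration P beta in
  exists (Bbar M J A : R -> Omega -> R),
  [/\ brownian_motion P F `[0, T] Bbar,
      forall t, 0 <= t < T ->
        is_stochastic_integral P
          (fun s => Num.sqrt ((T ^+ 2 + s ^+ 2) / T ^+ 2)) Bbar t (M t),
      (forall s, 0 <= s < T ->
        is_stochastic_integral P (kernel_a T s) beta s (J s)) /\
      continuous_process P `[0, T[ J,
      {ae P, forall w, forall t, 0 <= t < T ->
        A t w = - (\int[lebesgue_measure]_(s in `[0, t]) (beta s w / (T - s)))
                + (\int[lebesgue_measure]_(s in `[0, t]) (J s w / (T - s))) /\
        beta t w = M t w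
          - (\int[lebesgue_measure]_(s in `[0, t]) (beta s w / (T - s)))
          + (\int[lebesgue_measure]_(s in `[0, t]) (J s w / (T - s)))}
    & canonical_decomposition P F T beta M A].
Proof.
move=> T0 BW BB WB beta F.
have [N [H [b [[mN PN] [HG Hb] [cb b0] bE b_cov]]]] := beta_setup T0 BW BB WB.
have mproc X t : standard_brownian_motion P `[0, T] X -> 0 <= t <= T ->
    measurable_fun setT (X t).
  by case=> mX _ _ _ _ tT; apply: mX; rewrite /= in_itv.
have mbeta t : 0 <= t <= T -> measurable_fun setT (beta t).
  move=> tT; have TT : 0 <= T <= T by rewrite lexx ltW.
  apply: measurable_funD; first apply: measurable_funB; first exact: mproc.
    by apply: measurable_funM => //; exact: mproc.
  by apply: measurable_funM => //; exact: mproc.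
have mono := @generators_mono _ _ _ P beta.
have rb := regular_bridge T0 mN PN HG Hb cb b0 bE b_cov.
have rL := regular_drift HG T0 mono rb.
exists (innovation T b), (martingale_part T b), (inner_integral T b), (finite_variation_part T b).
split.
- exact: (innovation_brownian T0 mN PN HG Hb cb b0 mbeta bE b_cov).
- exact: (volatility_stochastic_integral HG T0 mono rb b0 b_cov).
- split=> [s sT|].
    apply: (kernel_stochastic_integral HG T0 mono rb b0 b_cov mN PN mbeta) => // u uT w Nw.
    by rewrite bE// indicE mem_set// mul1r.
  apply: aeW => w; apply: continuous_subspaceT => s.
  apply: cvgB; first exact: cb.
  apply: cvgM; last exact: (regular_path rL).
  by apply: cvgB; [exact: cvg_cst|exact: cvg_id].
- exists N; split => // w nw; apply: contrapT => Nw; apply: nw => t /andP[t0 tT].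
  have AE := finite_variation_partE T0 mN PN HG Hb cb b0 bE b_cov (introT andP (conj t0 tT)) Nw.
  have tT' : 0 <= t <= T by rewrite t0 ltW.
  split; first exact: AE.
  by rewrite -addrA -AE; exact: (bridge_decomposition bE tT' Nw).
- exact: (bridge_canonical_decomposition T0 mN PN HG Hb cb b0 mbeta bE b_cov).
Qed.
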